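(* Let $\mathcal G$ be a compact finite metric graph with Dirichlet vertex set $\mathsf V_{\mathrm D}$ satisfying the standing assumption of the context, and let $\ell_{\min}=\min_{e\in\mathsf E}\ell_e$ be its minimal edge length. Then $$\mathcal Q_t(\mathcal G;\mathsf V_{\mathrm D}) = |\mathcal G| - \frac{2\sqrt t}{\sqrt\pi}\,\#\mathsf V_{\mathrm D} + \mathcal O\Big(\sqrt t\,e^{-\frac{\ell_{\min}^2}{4t}}\Big)\qquad\text{as } t\to0^+.$$
   Context: Metric graph: $\mathcal G$ is obtained from a finite set $\mathsf E$ of edges, each $e\in\mathsf E$ identified with an interval $[0,\ell_e]$, $0<\ell_e<\infty$, by gluing endpoints at a finite set $\mathsf V$ of vertices (loops and multiple edges allowed). $\deg(v)$ is the number of edge ends at $v$ (a loop counts twice). $|\mathcal G|=\sum_e\ell_e$. Standing assumption: $\mathcal G$ has no vertices of degree 2 (they are removed by merging the two incident edges); $\emptyset\ne\mathsf V_{\mathrm D}\subset\{v\in\mathsf V:\deg(v)=1\}$; $\mathcal G\setminus\mathsf V_{\mathrm D}$ is connected. $\mathsf V_{\mathrm N}=\mathsf V\setminus\mathsf V_{\mathrm D}$. Heat content: $\Delta^{\mathcal G;\mathsf V_{\mathrm D}}$ is the Laplacian on $L^2(\mathcal G)=\bigoplus_e L^2(0,\ell_e)$ with Dirichlet conditions on $\mathsf V_{\mathrm D}$ and continuity and Kirchhoff conditions on $\mathsf V_{\mathrm N}$, i.e. $-\Delta^{\mathcal G;\mathsf V_{\mathrm D}}$ is the self-adjoint operator associated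 with the form $a(u)=\int_{\mathcal G}|u'|^2\,dx$ on $H^1_0(\mathcal G;\mathsf V_{\mathrm D})=\{u\in\bigoplus_e H^1(0,\ell_e): u$ continuous at every vertex, $u(v)=0$ for $v\in\mathsf V_{\mathrm D}\}$. $p_t^{\mathcal G;\mathsf V_{\mathrm D}}(x,y)$ is the integral kernel of $e^{t\Delta^{\mathcal G;\mathsf V_{\mathrm D}}}$ (heat kernel) and $\mathcal Q_t(\mathcal G;\mathsf V_{\mathrm D})=\int_{\mathcal G}\int_{\mathcal G}p_t^{\mathcal G;\mathsf V_{\mathrm D}}(x,y)\,dx\,dy$, $t>0$. The constant in $\mathcal O$ may depend on $\mathcal G$ and $\mathsf V_{\mathrm D}$. *)

(* Defs.v *)
(* MathComp-Analysis *)
From HB Require Import structures.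
From mathcomp Require Import all_boot all_order all_algebra generic_quotient.
From mathcomp Require Import all_classical all_reals all_analysis.
Import Order.TTheory GRing.Theory Num.Theory.
Import numFieldNormedType.Exports.

Set Implicit Arguments.
Unset Strict Implicit.
Unset Printing Implicit Defensive.

Local Open Scope classical_set_scope.
Local Open Scope ring_scope.

(* Each edge e is the interval [0, len e]; its end at 0 is attached to the
   vertex [ends e false] and its end at [len e] to [ends e true].  Since the
   vertices arise by gluing end points, each of them carries at least one end. *)
Record metric_graph (R : realType) := MetricGraph {
  edge : finType;
  vertex : finType;
  len : edge -> R;
  ends : edge -> bool -> vertex;
  len_gt0 : forall e, 0 < len e;
  ends_surj : forall v, exists e b, ends e b = v }.

Section MetricGraph.
Context {R : realType}.
Implicit Type G : metric_graph R.

Definition edge_itv G (e : edge G) : set R := `[0, len e]%classic.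

Definition end_pos G (e : edge G) (b : bool) : R := if b then len e else 0.

Definition deg G (v : vertex G) : nat :=
  #|[pred h : edge G * bool | ends h.1 h.2 == v]|.

Definition total_length G : R := \sum_(e : edge G) len e.

(* The default value [total_length G] bounds every edge length, so it does not
   affect the minimum as soon as G has an edge. *)
Definition min_length G : R := \big[Num.min/total_length G]_(e : edge G) len e.

(* G as a topological space: the disjoint union of the intervals, modulo the
   identification of all the ends attached to a common vertex. *)
Definition edge_points G := {e : edge G & edge_itv e}.

Definition vertex_at G (x : edge_points G) : option (vertex G) :=
  let: existT e s := x in
  if \val s == 0 then Some (ends e false)
  else if \val s == len e then Some (ends e true) else None.

Definition glued G (x y : edge_points G) : bool :=
  (x == y) || (vertex_at x != None) && (vertex_at x == vertex_at y).

Lemma glue_refl G : reflexive (@glued G).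
Proof. by move=> x; rewrite /glued eqxx. Qed.

Lemma glue_sym G : symmetric (@glued G).
Proof.
move=> x y; rewrite /glued (eq_sym x) (eq_sym (vertex_at x) (vertex_at y)).
congr (_ || _).
by case: (vertex_at y =P vertex_at x) => [->|_]; rewrite ?andbF.
Qed.

Lemma glue_trans G : transitive (@glued G).
Proof.
move=> y x z /predU1P[-> //|/andP[x0 /eqP xy]] /predU1P[<-|/andP[_ /eqP yz]].
  by rewrite /glued x0 xy eqxx orbT.
by rewrite /glued x0 xy yz eqxx orbT.
Qed.

Definition glue_equiv G :=
  EquivRel (@glued G) (@glue_refl G) (@glue_sym G) (@glue_trans G).

Definition graph_space G := quotient_topology {eq_quot (glue_equiv G)}%qT.

Definition space_minus G (VD : {set vertex G}) : set (graph_space G) :=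
  (\pi_(graph_space G)%qT : edge_points G -> graph_space G) @`
    [set x | forall v, vertex_at x = Some v -> v \notin VD].

Definition standing_assumption G (VD : {set vertex G}) : Prop :=
  [/\ forall v : vertex G, deg v <> 2%N,
      VD != finset.set0,
      forall v, v \in VD -> deg v = 1%N
    & connected (space_minus VD)].

(* A function on G is given edgewise; only its values on the intervals
   [edge_itv e] are relevant. *)
Definition gfun G := edge G -> R -> R.

Definition mu := @lebesgue_measure R.

Definition square_integrable (l : R) (f : R -> R) : Prop :=
  f \_ `[0, l]%classic \in Lfun mu 2%:E.

Definition L2 G (u : gfun G) : Prop :=
  forall e, square_integrable (len e) (u e).

Definition gintegral G (u : gfun G) : R :=
  \sum_(e : edge G) \int[mu]_(x in edge_itv e) u e x.

Definition L2dot G (u v : gfun G) : R := gintegral (fun e x => u e x * v e x).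

Definition L2norm G (u : gfun G) : R := Num.sqrt (L2dot u u).

Definition gae_eq G (u v : gfun G) : Prop :=
  forall e, ae_eq mu (edge_itv e) (u e) (v e).

(* Test functions: C^1 with compact support in the open interval ]0, l[. *)
Definition test_function (l : R) (phi : R -> R) : Prop :=
  [/\ forall x, derivable phi x 1,
      continuous (derive1 phi)
    & exists a b, [/\ 0 < a, b < l & forall x, x \notin `[a, b] -> phi x = 0]].

(* u is in H^1(0, l), with weak derivative du. *)
Definition inH1 (l : R) (u du : R -> R) : Prop :=
  [/\ square_integrable l u,
      square_integrable l du
    & forall phi, test_function l phi ->
        \int[mu]_(x in `[0, l]) (u x * derive1 phi x) =
        - \int[mu]_(x in `[0, l]) (du x * phi x)].

(* u is the continuous representative, on each closed edge, of an element of
   H^1_0(G; VD), and du is its edgewise weak derivative. *)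
Definition inH10 G (VD : {set vertex G}) (u du : gfun G) : Prop :=
  [/\ forall e, inH1 (len e) (u e) (du e),
      forall e, {within edge_itv e, continuous (u e)},
      forall e b e' b', ends e b = ends e' b' ->
        u e (end_pos e b) = u e' (end_pos e' b')
    & forall e b, ends e b \in VD -> u e (end_pos e b) = 0].

(* The class of u is in the domain of the Laplacian, which maps it to the class
   of f: the operator associated with the form a(w, v) = \int_G w' v' on
   H^1_0(G; VD) is the opposite of the Laplacian, hence the sign. *)
Definition laplacian G (VD : {set vertex G}) (u f : gfun G) : Prop :=
  exists w dw, [/\ gae_eq u w, inH10 VD w dw &
    forall v dv, inH10 VD v dv -> L2dot dw dv = - L2dot f v].

(* Strongly continuous semigroup on L^2(G); operators act on representatives
   and all identities are up to almost everywhere equality. *)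
Record C0_semigroup G (T : R -> gfun G -> gfun G) : Prop := {
  semigroup_L2 : forall t u, 0 <= t -> L2 u -> L2 (T t u);
  semigroup_linear : forall t a u v, 0 <= t -> L2 u -> L2 v ->
    gae_eq (T t (fun e x => a * u e x + v e x))
           (fun e x => a * T t u e x + T t v e x);
  semigroup_bounded : forall t, 0 <= t ->
    exists M, forall u, L2 u -> L2norm (T t u) <= M * L2norm u;
  semigroup_0 : forall u, L2 u -> gae_eq (T 0 u) u;
  semigroup_D : forall s t u, 0 <= s -> 0 <= t -> L2 u ->
    gae_eq (T (s + t) u) (T s (T t u));
  semigroup_cvg0 : forall u, L2 u ->
    L2norm (fun e x => T t u e x - u e x) @[t --> 0^'+] --> (0 : R) }.

Definition generator G (T : R -> gfun G -> gfun G) (u f : gfun G) : Prop :=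
  L2norm (fun e x => (T h u e x - u e x) / h - f e x) @[h --> 0^'+] --> (0 : R).

(* T t = exp (t Delta), the semigroup generated by the Laplacian. *)
Definition heat_semigroup G (VD : {set vertex G}) (T : R -> gfun G -> gfun G) :
    Prop :=
  C0_semigroup T /\
  forall u f, L2 u -> L2 f -> generator T u f <-> laplacian VD u f.

(* [K e x f y] is the value at the pair formed by the point x of the edge e and
   the point y of the edge f. *)
Definition gkernel G := edge G -> R -> edge G -> R -> R.

Definition integral_kernel G (S : gfun G -> gfun G) (K : gkernel G) : Prop :=
  (forall e f,
     measurable_fun (edge_itv e `*` edge_itv f) (fun z : R * R => K e z.1 f z.2)) /\
  forall u, L2 u -> forall e, {ae mu, forall x, edge_itv e x ->
    (forall f, mu.-integrable (edge_itv f) (fun y => (K e x f y * u f y)%:E)) /\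
    S u e x = gintegral (fun f y => K e x f y * u f y)}.

Definition heat_kernel G (VD : {set vertex G}) (p : R -> gkernel G) : Prop :=
  exists2 T, heat_semigroup VD T & forall t, 0 < t -> integral_kernel (T t) (p t).

Definition heat_content G (p : R -> gkernel G) (t : R) : R :=
  gintegral (fun f y => gintegral (fun e x => p t e x f y)).

End MetricGraph.

(* Main.v *)
From HB Require Import structures.
Require Import Defs.
From mathcomp Require Import all_boot all_order all_algebra.
From mathcomp Require Import all_classical all_reals all_analysis.
From mathcomp Require Import measurable_realfun gauss_integral.
From mathcomp Require Import ring lra.
Import Order.TTheory GRing.Theory Num.Theory.
Import numFieldNormedType.Exports.
Set Implicit Arguments.
Unset Strict Implicit.
Unset Printing Implicit Defensive.
Local Open Scope classical_set_scope.
Local Open Scope ring_scope.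

(** For small times a Dirichlet vertex acts on the heat flow started from the
    constant 1 as the end of a half-line: the loss at distance d is the
    half-line solution erfc (d / (2 sqrt t)) of [half_line].  At the other end
    of an edge of length l this loss is of size exp (- l^2 / (4 t)), so that
    everything that happens after the first passage through an edge is an error
    term.

    This is made precise by an explicit function, [profile] t = 1 - [waves]
    ([half_line] t).  From every Dirichlet end starts a half-line solution; at
    the vertex where it arrives it is scattered with the amplitudes dictated by
    continuity and by the Kirchhoff condition, and each scattered wave is
    multiplied by a cubic ([fade]) that removes it before it reaches the next
    vertex.  Hence [profile] t satisfies all vertex conditions exactly and lies
    in the domain of the Laplacian ([profile_laplacian]), it tends to 1 in L2 as
    t tends to 0 ([profile_cvg0]), and it solves the heat equation up to the
    terms in which a derivative falls on the fading factor
    ([profile_residual]).  These terms carry scattered waves only, and are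
    O(exp (- lmin^2 / (4 t))) uniformly on the graph ([fading_defect_le]).  The
    Laplacian being dissipative, the solution T_t 1 differs from [profile] t by
    O(t exp (- lmin^2 / (4 t))) in L2 ([evol_approx], [profile_approx]).  The
    integral of the profile is computed from the primitive [ierfc] of erfc: a
    Dirichlet end removes 2 sqrt t / sqrt pi, up to
    O(sqrt t exp (- lmin^2 / (4 t))) from the tails and the scattered waves
    ([integral_end_wave], [gintegral_profile]), and a Dirichlet vertex, having
    degree 1, carries exactly one end.

    The semigroup is given by its continuity at 0 and by its generator only;
    what is needed of it is derived from the fact that the Laplacian is
    symmetric and nonpositive, on a space of representatives with a positive
    semidefinite form.  Comparison estimates come from a differential
    inequality for the norm along curves with a right derivative
    ([dissipative_growth]), for which orbits have to be left continuous
    ([orbit_left_continuous]).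

    Finally the heat content integrates the kernel in its first variable before
    the second, whereas T_t 1 is the integral in the second variable.  Both
    agree because the kernel is symmetric almost everywhere
    ([kernel_total_integral]).  The symmetry of T_t is proved on limits of
    functions in the domain of the square of the Laplacian ([evol_sym]);
    indicator functions of measurable subsets of an edge are such limits
    ([heat_core_indic]), so that the kernel and its transpose have equal
    integrals over rectangles, hence are equal almost everywhere
    ([kernel_ae_eq]). *)

(** * Positive semidefinite forms and continuum induction *)

(** Definiteness is left out: functions equal almost everywhere are distinct
    vectors, and equations between vectors up to null sets are stated below as
    the vanishing of a norm. *)
Record inner_product (R : realType) (V : lmodType R) (dot : V -> V -> R) : Prop :=
  { dotC : forall u v, dot u v = dot v u;
    dotP : forall a u v w, dot (a *: u + v) w = a * dot u w + dot v w;
    dot_ge0 : forall u, 0 <= dot u u }.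

Definition nrm (R : realType) (V : lmodType R) (dot : V -> V -> R) (u : V) : R :=
  Num.sqrt (dot u u).

Section InnerProduct.
Context {R : realType} {V : lmodType R} {dot : V -> V -> R}.
Hypothesis ip : inner_product dot.
Local Notation nrm := (nrm dot).
Implicit Types (u v w : V) (a b : R).

Lemma dotDl u v w : dot (u + v) w = dot u w + dot v w.
Proof. by rewrite -[u in LHS]scale1r dotP// mul1r. Qed.

Lemma dot0l w : dot 0 w = 0.
Proof. by have := dotDl 0 0 w; rewrite addr0; lra. Qed.

Lemma dotZl a u w : dot (a *: u) w = a * dot u w.
Proof. by rewrite -[a *: u]addr0 dotP// dot0l addr0. Qed.

Lemma dotNl u w : dot (- u) w = - dot u w.
Proof. by rewrite -scaleN1r dotZl mulN1r. Qed.

Lemma dotBl u v w : dot (u - v) w = dot u w - dot v w.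
Proof. by rewrite dotDl dotNl. Qed.

Lemma dotDr u v w : dot w (u + v) = dot w u + dot w v.
Proof. by rewrite dotC// dotDl !(dotC ip w). Qed.

Lemma dotZr a u w : dot w (a *: u) = a * dot w u.
Proof. by rewrite dotC// dotZl (dotC ip w). Qed.

Lemma dotBr u v w : dot w (u - v) = dot w u - dot w v.
Proof. by rewrite dotC// dotBl !(dotC ip w). Qed.

Lemma nrm_ge0 u : 0 <= nrm u. Proof. exact: sqrtr_ge0. Qed.

Lemma sqr_nrm u : nrm u ^+ 2 = dot u u.
Proof. by rewrite sqr_sqrtr// dot_ge0. Qed.

Lemma nrmZ a u : nrm (a *: u) = `|a| * nrm u.
Proof.
by rewrite /nrm dotZl dotZr mulrA -expr2 sqrtrM ?sqr_ge0// sqrtr_sqr.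
Qed.

Lemma nrmN u : nrm (- u) = nrm u.
Proof. by rewrite -scaleN1r nrmZ normrN1 mul1r. Qed.

Lemma nrmBC u v : nrm (u - v) = nrm (v - u).
Proof. by rewrite -nrmN opprB. Qed.

Lemma nrm0 : nrm 0 = 0.
Proof. by rewrite /nrm dot0l sqrtr0. Qed.

Lemma cauchy_schwarz u v : `|dot u v| <= nrm u * nrm v.
Proof.
have key : dot u v ^+ 2 <= dot u u * dot v v.
  have q s : 0 <= dot u u + 2 * s * dot u v + s ^+ 2 * dot v v.
    have := dot_ge0 ip (s *: v + u).
    rewrite dotP// !dotDr !dotZr (dotC ip v u).
    by move=> h; rewrite [X in 0 <= X](_ : _ = s * (s * dot v v + dot u v) +
      (s * dot u v + dot u u)) //; ring.
  have [v0|v0] := eqVneq (dot v v) 0.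
    have [->|uv0] := eqVneq (dot u v) 0; first by rewrite v0 mulr0 expr0n.
    have := q (- (dot u u + 1) / (2 * dot u v)).
    rewrite v0 mulr0 addr0.
    rewrite (_ : 2 * _ * _ = - (dot u u + 1)); first by lra.
    by field.
  have vp : 0 < dot v v by rewrite lt_neqAle eq_sym v0 dot_ge0.
  have := q (- dot u v / dot v v).
  rewrite (_ : _ + _ + _ = dot u u - dot u v ^+ 2 / dot v v); last by field.
  by rewrite subr_ge0 ler_pdivrMr.
rewrite -sqrtr_sqr -sqrtrM ?dot_ge0//.
exact: ler_wsqrtr.
Qed.

Lemma ler_nrmD u v : nrm (u + v) <= nrm u + nrm v.
Proof.
rewrite -(@ler_pXn2r _ 2)// ?nnegrE ?nrm_ge0 ?addr_ge0 ?nrm_ge0//.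
rewrite sqrrD !sqr_nrm dotDl !dotDr (dotC ip v u) addrACA addrA.
have := le_trans (ler_norm _) (cauchy_schwarz u v).
by move: (nrm u * _) => c; lra.
Qed.

Lemma ler_nrmB u v : nrm (u - v) <= nrm u + nrm v.
Proof. by rewrite -(nrmN v) ler_nrmD. Qed.

Lemma ler_nrm_dist u v w : nrm (u - w) <= nrm (u - v) + nrm (v - w).
Proof. by rewrite (_ : u - w = (u - v) + (v - w)) ?ler_nrmD// addrA subrK. Qed.

Lemma ler_dist_nrm u v : nrm u <= nrm v + nrm (u - v).
Proof. by have := ler_nrmD v (u - v); rewrite addrC subrK. Qed.

Lemma nrm_congr u v : nrm (u - v) = 0 -> nrm u = nrm v.
Proof.
move=> uv; apply/eqP; rewrite eq_le.
have := ler_dist_nrm u v; have := ler_dist_nrm v u.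
by rewrite (nrmBC v) uv !addr0 => -> ->.
Qed.

Lemma dot_congrl u v w : nrm (u - v) = 0 -> dot u w = dot v w.
Proof.
move=> uv; apply/eqP; rewrite -subr_eq0 -dotBl -normr_le0.
by have := cauchy_schwarz (u - v) w; rewrite uv mul0r.
Qed.

Lemma dot_congrr u v w : nrm (u - v) = 0 -> dot w u = dot w v.
Proof. by move=> uv; rewrite !(dotC ip w) (dot_congrl _ uv). Qed.

End InnerProduct.

(** The least upper bound of the points up to which [P] holds is reached by
    the third hypothesis, and passed by the second one unless it is [b]. *)
Lemma real_induction (R : realType) (P : R -> Prop) (a b : R) : a <= b -> P a ->
  (forall s, a <= s < b -> P s -> \forall h \near 0^'+, P (s + h)) ->
  (forall s, a < s <= b -> (forall r, a <= r < s -> P r) -> P s) -> P b.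
Proof.
move=> ab Pa Pr Pl.
pose S := [set s | a <= s <= b /\ forall r, a <= r <= s -> P r].
have Sa : S a.
  split; first by rewrite lexx.
  by move=> r; rewrite -eq_le => /eqP <-.
have supS : has_sup S by split; [exists a|exists b => s [/andP[]]].
have as_ : a <= sup S by apply: ub_le_sup => //; case: supS.
have sb : sup S <= b by apply: ge_sup => [|s [/andP[]]//]; exists a.
have below r : a <= r < sup S -> P r.
  move=> /andP[ar /(sup_gt (proj1 supS)) []].
  move=> s [sS Ps] rs; apply: Ps.
  by rewrite ar ltW.
have Psup : P (sup S).
  have [<-//|neq] := eqVneq a (sup S).
  by apply: Pl => //; rewrite lt_neqAle neq as_ sb.
have [<-//|neq] := eqVneq (sup S) b.
have sltb : sup S < b by rewrite lt_neqAle neq.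
have : a <= sup S < b by rewrite as_.
move=> /Pr /(_ Psup) [e /= e0 Pe].
pose h := Num.min (e / 2) (b - sup S).
have h0 : 0 < h by rewrite lt_min divr_gt0//= subr_gt0.
have : S (sup S + h).
  split; first by rewrite -lerBrDl ge_min lexx orbT (le_trans as_)// lerDl ltW.
  move=> r /andP[ar rsh].
  have [rs|rs|->//] := ltgtP r (sup S); first by apply: below; rewrite ar.
  have -> : r = sup S + (r - sup S) by rewrite addrC subrK.
  apply: Pe; last by rewrite subr_gt0.
  rewrite /= sub0r normrN gtr0_norm ?subr_gt0// ltrBlDl.
  apply: (le_lt_trans rsh); rewrite ltrD2l.
  by rewrite gt_min ltr_pdivrMr// ltr_pMr// ltr1n.
move=> /(ub_le_sup (proj2 supS)); rewrite gerDl.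
by rewrite leNgt h0.
Qed.

(** * Growth of curves with a dissipative right derivative *)

Section RightDerivative.
Context {R : realType} {V : lmodType R} (dot : V -> V -> R).
Hypothesis ip : inner_product dot.
Local Notation nrm := (nrm dot).

Definition right_derivative (z : R -> V) (s : R) (g : V) : Prop :=
  nrm (h^-1 *: (z (s + h) - z s) - g) @[h --> 0^'+] --> (0 : R).

Lemma nrm_cvg0P (F : R -> V) :
  (nrm (F h) @[h --> 0^'+] --> (0 : R)) <->
  forall e : R, 0 < e -> \forall h \near 0^'+, nrm (F h) <= e.
Proof.
split=> [/cvgr0Pnorm_le F0 e e0|F0].
  by near=> h; have := near (F0 e e0) h; rewrite ger0_norm ?nrm_ge0//; apply.
apply/cvgr0Pnorm_le => e e0; near=> h; rewrite ger0_norm ?nrm_ge0//.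
by near: h; exact: F0.
Unshelve. all: by end_near. Qed.

(** Taking the inner product with [z s] in
    z (s + h) = z s + h g + o(h), the slope of the norm at [s] is at most
    [eps]; continuum induction propagates the bound from [a] to [b], the limit
    points being reached by left continuity. *)
Lemma dissipative_growth (z : R -> V) (a b eps : R) : a <= b -> 0 <= eps ->
  (forall s, a < s <= b -> forall e : R, 0 < e ->
     \forall h \near 0^'+, nrm (z (s - h) - z s) <= e) ->
  (forall s, a <= s < b ->
     exists2 g, right_derivative z s g & dot g (z s) <= eps * nrm (z s)) ->
  nrm (z b) <= nrm (z a) + eps * (b - a).
Proof.
move=> ab eps0 zl zr.
(* The slack d makes the bound B in the induction positive, which absorbs the
   quadratic term h^2 |g|^2 of |z s + h g|^2. *)
suff H (d : R) : 0 < d -> nrm (z b) <= nrm (z a) + d + (eps + d) * (b - a).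
  apply/ler_addgt0Pr => e e0.
  have := H (e / (1 + (b - a))); rewrite divr_gt0 ?ltr_wpDr ?subr_ge0//.
  move=> /(_ isT) /le_trans; apply.
  rewrite le_eqVlt; apply/orP; left; apply/eqP; field.
  by apply: lt0r_neq0; rewrite ltr_wpDr ?subr_ge0.
move=> d0.
apply: (@real_induction _ (fun s => nrm (z s) <=
  nrm (z a) + d + (eps + d) * (s - a)) a b) => //.
- by rewrite subrr mulr0 addr0 lerDl ltW.
- move=> s /andP[as_ sb].
  set B := nrm (z a) + d + _ => zB.
  have B0 : 0 < B.
    rewrite /B -addrA ltr_wpDl ?nrm_ge0// ltr_wpDr//.
    by apply: mulr_ge0; [rewrite addr_ge0// ltW|rewrite subr_ge0].
  have BE : B = nrm (z a) + d + (eps + d) * (s - a) by [].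
  clearbody B.
  have [|g /nrm_cvg0P dg gz] := zr s; first by rewrite as_.
  have gp : 0 < nrm g ^+ 2 + 1 by rewrite ltr_wpDl ?sqr_ge0.
  near=> h.
  have h0 : 0 < h by near: h; exact: nbhs_right_gt.
  have hd : nrm (h^-1 *: (z (s + h) - z s) - g) <= d / 2.
    by near: h; apply: dg; rewrite divr_gt0.
  have hg : h * nrm g ^+ 2 <= B * d.
    have : h <= B * d / (nrm g ^+ 2 + 1).
      near: h; apply: nbhs_right_le; apply: divr_gt0 => //; exact: mulr_gt0.
    rewrite ler_pdivlMr//; apply: le_trans.
    by rewrite ler_pM2l// lerDl.
  have -> : nrm (z a) + d + (eps + d) * (s + h - a) = B + h * eps + h * d.
    by rewrite BE; ring.
  have step : nrm (z (s + h)) <= nrm (z s + h *: g) + h * (d / 2).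
    apply: (le_trans (ler_dist_nrm ip _ (z s + h *: g))); rewrite lerD2l.
    have -> : z (s + h) - (z s + h *: g) =
        h *: (h^-1 *: (z (s + h) - z s) - g).
      by rewrite scalerBr scalerA divff ?gt_eqF// scale1r opprD addrA.
    by rewrite nrmZ// gtr0_norm// ler_pM2l.
  have main : nrm (z s + h *: g) <= B + h * eps + h * (d / 2).
    have rhs0 : 0 <= B + h * eps + h * (d / 2).
      have ? := ltW B0; have ? := ltW h0; have ? := ltW d0.
      by rewrite !addr_ge0 ?mulr_ge0 ?divr_ge0.
    rewrite -(@ler_pXn2r _ 2)// ?nnegrE ?nrm_ge0//.
    rewrite (sqr_nrm ip) (dotDl ip) !(dotDr ip) !(dotZl ip) !(dotZr ip).
    rewrite (dotC ip (z s)) -!(sqr_nrm ip).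
    have n0 := nrm_ge0 (dot := dot) (z s).
    have gz' : dot g (z s) <= eps * B.
      by apply: (le_trans gz); rewrite ler_wpM2l.
    have nB : nrm (z s) ^+ 2 <= B ^+ 2 by rewrite ler_pXn2r ?nnegrE// ltW.
    have h1 : h * dot g (z s) <= h * (eps * B) by rewrite ler_pM2l.
    have h2 : h * (h * nrm g ^+ 2) <= h * (B * d) by rewrite ler_pM2l.
    have h3 : 0 <= (h * eps + h * (d / 2)) ^+ 2 by exact: sqr_ge0.
    move: h1 h2 h3 nB; set X := nrm g ^+ 2; set Y := dot g _; set N := nrm _ ^+ 2.
    move=> h1 h2 h3 nB.
    have -> : (B + h * eps + h * (d / 2)) ^+ 2 = B ^+ 2 +
      2 * (h * (eps * B)) + h * (B * d) + (h * eps + h * (d / 2)) ^+ 2 by field.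
    by lra.
  apply: (le_trans step); apply: (le_trans (lerD main (lexx _))).
  by rewrite -addrA -mulrDr -splitr.
- move=> s /andP[as_ sb] IH.
  apply/ler_addgt0Pr => e e0.
  near (0:R)^'+ => h.
  have h0 : 0 < h by near: h; exact: nbhs_right_gt.
  have hs : h < s - a by near: h; apply: nbhs_right_lt; rewrite subr_gt0.
  have ze : nrm (z (s - h) - z s) <= e by near: h; apply: zl; rewrite ?as_.
  have := IH (s - h); rewrite ltrBlDr ltrDl h0.
  have -> : a <= s - h by rewrite lerBrDr addrC -lerBrDr ltW.
  move=> /(_ isT) zh.
  apply: (le_trans (ler_dist_nrm ip _ (z (s - h)))).
  rewrite nrmBC//; apply: lerD => //; apply: (le_trans zh).
  rewrite lerD2l ler_wpM2l ?addr_ge0// ?(ltW d0)//.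
  by rewrite lerD2r gerBl ltW.
Unshelve. all: by end_near. Qed.

End RightDerivative.

(** * Orbits of a semigroup are continuous *)

(** A strongly continuous semigroup of operators on representatives, with a
    symmetric and dissipative generator; [A u f] means that [f] represents the
    value of the generator at [u]. *)
Record symmetric_evolution (R : realType) (V : lmodType R) (dot : V -> V -> R)
    (T : R -> V -> V) (A : V -> V -> Prop) : Prop := {
  evol_linear : forall t a u v, 0 <= t ->
    nrm dot (T t (a *: u + v) - (a *: T t u + T t v)) = 0;
  evol_bounded : forall t, 0 <= t ->
    exists M, forall u, nrm dot (T t u) <= M * nrm dot u;
  evol_0 : forall u, nrm dot (T 0 u - u) = 0;
  evol_D : forall s t u, 0 <= s -> 0 <= t ->
    nrm dot (T (s + t) u - T s (T t u)) = 0;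
  evol_cvg0 : forall u, nrm dot (T t u - u) @[t --> 0^'+] --> (0 : R);
  evol_gen : forall u f,
    nrm dot (h^-1 *: (T h u - u) - f) @[h --> 0^'+] --> (0 : R) <-> A u f;
  gen_le0 : forall u f, A u f -> dot f u <= 0;
  gen_sym : forall u f v g, A u f -> A v g -> dot f v = dot u g }.

Section Evolution.
Context {R : realType} {V : lmodType R} {dot : V -> V -> R}.
Hypothesis ip : inner_product dot.
Context {T : R -> V -> V} {A : V -> V -> Prop}.
Hypothesis ev : symmetric_evolution dot T A.
Local Notation nrm := (nrm dot).
Local Notation rderivative := (right_derivative dot).
Implicit Types (u v w f g : V) (t s : R).

Lemma nrm_congrB u v w : nrm (u - v) = 0 -> nrm (u - w) = nrm (v - w).
Proof.
move=> uv; apply: (nrm_congr ip).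
by rewrite opprB addrA subrK.
Qed.

Lemma nrm_congrBr u v w : nrm (u - v) = 0 -> nrm (w - u) = nrm (w - v).
Proof. by move=> uv; rewrite !(nrmBC ip w) (nrm_congrB _ uv). Qed.

Lemma evolB t u v : 0 <= t -> nrm (T t (u - v) - (T t u - T t v)) = 0.
Proof.
move=> t0; have := evol_linear ev (-1) v u t0.
by rewrite !scaleN1r (addrC (- v)) (addrC (- T t v)).
Qed.

Lemma evol_dist t u v : 0 <= t -> nrm (T t u - T t v) = nrm (T t (u - v)).
Proof. by move=> /evolB -/(_ u v) /(nrm_congr ip). Qed.

Lemma evol0 t : 0 <= t -> nrm (T t 0) = 0.
Proof.
by move=> t0; rewrite -(subrr (0 : V)) -evol_dist// subrr nrm0.
Qed.

Lemma evolZ t a u : 0 <= t -> nrm (T t (a *: u) - a *: T t u) = 0.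
Proof.
move=> t0; have := evol_linear ev a u 0 t0; rewrite addr0.
move=> /nrm_congrB ->; rewrite addrC addKr; exact: evol0.
Qed.

Lemma evol_bound t : 0 <= t ->
  exists2 M, 0 < M & forall u, nrm (T t u) <= M * nrm u.
Proof.
move=> /(evol_bounded ev)[M TM]; exists (`|M| + 1) => [|u].
  by rewrite ltr_wpDl.
apply: (le_trans (TM u)); rewrite ler_wpM2r ?nrm_ge0//.
by apply: (le_trans (ler_norm M)); rewrite lerDl.
Qed.

Lemma orbit_shift s t u v : 0 <= s -> 0 <= t ->
  nrm (T (s + t) u - T s v) = nrm (T s (T t u - v)).
Proof. by move=> s0 t0; rewrite (nrm_congrB _ (evol_D ev u s0 t0)) evol_dist. Qed.

Lemma orbit_right_continuous t u (e : R) : 0 <= t -> 0 < e ->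
  \forall h \near 0^'+, nrm (T (t + h) u - T t u) <= e.
Proof.
move=> t0 e0; have [M M0 TM] := evol_bound t0.
have /nrm_cvg0P Tu := evol_cvg0 ev u.
near=> h; have h0 : 0 <= h by near: h; exact: nbhs_right_ge.
rewrite orbit_shift//; apply: (le_trans (TM _)).
rewrite -ler_pdivlMl// mulrC; near: h; apply: Tu.
by rewrite divr_gt0.
Unshelve. all: by end_near. Qed.

(** The points where the oscillation of a right continuous function is small
    form a dense open set, so by Baire there are points of continuity. *)
Lemma orbit_continuity_point u s : 0 < s -> exists2 c, 0 < c < s &
  forall e : R, 0 < e -> \forall t \near c, nrm (T t u - T c u) <= e.
Proof.
move=> s0.
(* The negative half-line is put into every F n (the condition is void there),
   so that F n is dense in the whole line. *)
pose F (n : nat) : set R^o := [set c | exists2 d : R, 0 < d & forall t t',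
  `|t - c| < d -> `|t' - c| < d -> 0 < t -> 0 < t' ->
  nrm (T t u - T t' u) <= n.+1%:R^-1].
have : dense (\bigcap_i F i).
  apply: Baire => n; split.
    rewrite openE => c [d d0 Fd]; exists (d / 2) => /=; first by rewrite divr_gt0.
    move=> c' /= cc'; exists (d / 2); first by rewrite divr_gt0.
    have tri t : `|t - c'| < d / 2 -> `|t - c| < d.
      move=> tc'; rewrite (splitr d).
      apply: (le_lt_trans (ler_distD c' _ _)); apply: ltrD => //.
      by rewrite distrC.
    by move=> t t' /tri ? /tri ?; exact: Fd.
  move=> O [x Ox] oO.
  suff [y Oy Fy] : exists2 y, O y & F n y by exists y.
  have [x0|x0] := ltP x 0.
    exists x => //; exists (- x); first by rewrite oppr_gt0.
    move=> t t'; rewrite ltr_norml => /andP[_] + _ t0.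
    by rewrite ltrBlDr addNr => /(lt_trans t0); rewrite ltxx.
  have [r /= r0 Or] : nbhs x O by apply: open_nbhs_nbhs; split.
  have e0 : 0 < (n.+1%:R^-1 / 2 : R) by rewrite divr_gt0.
  have [d /= d0 xd] := orbit_right_continuous u x0 e0.
  pose m := Num.min r d.
  have m0 : 0 < m by rewrite lt_min r0.
  have near_x t : `|t - (x + m / 2)| < m / 2 -> 0 < t - x < m.
    by rewrite ltr_norml; move: m0 => /= ? /andP[? ?]; apply/andP; split; lra.
  exists (x + m / 2).
    apply: Or => /=; rewrite opprD addrA subrr sub0r normrN gtr0_norm ?divr_gt0//.
    rewrite ltr_pdivrMr//; apply: (@le_lt_trans _ _ (r * 1)).
      by rewrite mulr1 ge_min lexx.
    by rewrite ltr_pM2l// ltr1n.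
  exists (m / 2); first by rewrite divr_gt0.
  move=> t t' /near_x/andP[tx txm] /near_x/andP[t'x t'xm] _ _.
  have b y : 0 < y - x -> y - x < m -> nrm (T y u - T x u) <= n.+1%:R^-1 / 2.
    move=> yx yxm; have -> : y = x + (y - x) by rewrite addrC subrK.
    apply: xd => //=; rewrite sub0r normrN gtr0_norm//.
    by apply: (lt_le_trans yxm); rewrite ge_min lexx orbT.
  apply: (le_trans (ler_nrm_dist ip _ (T x u) _)); rewrite (splitr n.+1%:R^-1).
  by apply: lerD; [exact: b|rewrite nrmBC//; exact: b].
have oI : open (`]0, s[%classic : set R^o) by exact: interval_open.
move=> /(_ `]0, s[%classic) [|//|c [/= cs Fc]].
  by exists (s / 2) => /=; rewrite in_itv/=; apply/andP; split; lra.
move: cs; rewrite in_itv/= => c0s; exists c => // e e0.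
have [n ne] : exists n, (n.+1%:R^-1 : R) < e.
  have [n _ /(_ n (leqnn n)) /= ne] := near_infty_natSinv_lt (PosNum e0).
  by exists n.
have [d d0 Fd] := Fc n I.
have c0 : 0 < c by case/andP: c0s.
near=> t; apply: ltW; apply: le_lt_trans ne.
apply: Fd => //; last by near: t; exact: lt_nbhsr.
- by rewrite subrr normr0.
Unshelve. all: by end_near. Qed.

(** Continuity at one point [c] of [0, s] is transported to [s] by the bounded
    operator [T (s - c)]. *)
Lemma orbit_left_continuous s u (e : R) : 0 < s -> 0 < e ->
  \forall h \near 0^'+, nrm (T (s - h) u - T s u) <= e.
Proof.
move=> s0 e0; have [c /andP[c0 cs] cont] := orbit_continuity_point u s0.
have r0 : 0 <= s - c by rewrite subr_ge0 ltW.
have [M M0 TM] := evol_bound r0.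
have /nbhs_ballP[d /= d0 cd] : \forall t \near c, nrm (T t u - T c u) <= e / M.
  by apply: cont; rewrite divr_gt0.
near=> h; have h0 : 0 < h by near: h; exact: nbhs_right_gt.
have hc : h < c by near: h; exact: nbhs_right_lt.
have hd : h < d by near: h; exact: nbhs_right_lt.
have ch : 0 <= c - h by rewrite subr_ge0 ltW.
have E1 : nrm (T (s - h) u - T (s - c) (T (c - h) u)) = 0.
  by have := evol_D ev u r0 ch; rewrite addrA subrK.
have E2 : nrm (T s u - T (s - c) (T c u)) = 0.
  by have := evol_D ev u r0 (ltW c0); rewrite subrK.
rewrite (nrm_congrB _ E1) (nrm_congrBr _ E2) evol_dist//.
apply: (le_trans (TM _)); rewrite -ler_pdivlMl// mulrC.
by apply: cd; rewrite /ball /= opprB addrC subrK gtr0_norm.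
Unshelve. all: by end_near. Qed.

End Evolution.

(** * Contraction, symmetry and comparison with approximate solutions *)

Lemma subrACA (U : zmodType) (x y z t : U) : (x - y) - (z - t) = (x - z) - (y - t).
Proof. by rewrite !opprD !opprK addrACA. Qed.

Section Comparison.
Context {R : realType} {V : lmodType R} {dot : V -> V -> R}.
Hypothesis ip : inner_product dot.
Context {T : R -> V -> V} {A : V -> V -> Prop}.
Hypothesis ev : symmetric_evolution dot T A.
Local Notation nrm := (nrm dot).
Local Notation rderivative := (right_derivative dot).
Implicit Types (u v w f g : V) (t s : R).

Lemma nrm_cvg0_le (F G : R -> V) (M : R) : 0 < M ->
  (\forall h \near 0^'+, nrm (F h) <= M * nrm (G h)) ->
  nrm (G h) @[h --> 0^'+] --> (0 : R) -> nrm (F h) @[h --> 0^'+] --> (0 : R).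
Proof.
move=> M0 FG /nrm_cvg0P G0; apply/nrm_cvg0P => e e0.
near=> h; apply: (@le_trans _ _ (M * nrm (G h))); first by near: h.
rewrite -ler_pdivlMl// mulrC; near: h; apply: G0; exact: divr_gt0.
Unshelve. all: by end_near. Qed.

Lemma nrm_cvg0D (F G : R -> V) :
  nrm (F h) @[h --> 0^'+] --> (0 : R) -> nrm (G h) @[h --> 0^'+] --> (0 : R) ->
  nrm (F h + G h) @[h --> 0^'+] --> (0 : R).
Proof.
move=> /nrm_cvg0P F0 /nrm_cvg0P G0; apply/nrm_cvg0P => e e0; near=> h.
apply: (le_trans (ler_nrmD ip _ _)); rewrite (splitr e); apply: lerD.
  by near: h; apply: F0; rewrite divr_gt0.
by near: h; apply: G0; rewrite divr_gt0.
Unshelve. all: by end_near. Qed.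

Lemma right_derivativeB (z1 z2 : R -> V) s g1 g2 :
  rderivative z1 s g1 -> rderivative z2 s g2 ->
  rderivative (fun r => z1 r - z2 r) s (g1 - g2).
Proof.
move=> d1 d2; rewrite /right_derivative.
have {}d2 : nrm (- (h^-1 *: (z2 (s + h) - z2 s) - g2)) @[h --> 0^'+] --> (0 : R).
  by under eq_fun do rewrite nrmN//.
have := nrm_cvg0D d1 d2; apply: cvg_trans; apply: near_eq_cvg.
near=> h; congr (nrm _).
by rewrite subrACA -scalerBr subrACA.
Unshelve. all: by end_near. Qed.

Lemma gen_linear a u f v g : A u f -> A v g -> A (a *: u + v) (a *: f + g).
Proof.
move=> /(evol_gen ev) uf /(evol_gen ev) vg; apply/(evol_gen ev).
have M0 : 0 < `|a| + 1 by rewrite ltr_wpDl.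
have {}uf : nrm (a *: (h^-1 *: (T h u - u) - f)) @[h --> 0^'+] --> (0 : R).
  apply: nrm_cvg0_le M0 _ uf; near=> h; rewrite nrmZ//.
  by rewrite ler_wpM2r ?nrm_ge0// lerDl.
have := nrm_cvg0D uf vg; apply: cvg_trans; apply: near_eq_cvg.
near=> h; have h0 : 0 <= h by near: h; exact: nbhs_right_ge.
apply: nrm_congr => //.
set X := (X in nrm X).
have -> : X = - (h^-1 *: (T h (a *: u + v) - (a *: T h u + T h v))).
  rewrite /X scalerBr scalerA mulrC -scalerA (scalerBr a).
  rewrite [X in X - _]addrACA -opprD subrACA subrr subr0 -scalerDr -[LHS]scalerBr.
  rewrite -[RHS]scalerN opprB; congr (_ *: _).
  by rewrite [a *: _ - _ + _]addrACA -opprD addrA subrK opprB.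
by rewrite nrmN// nrmZ// (evol_linear ev)// mulr0.
Unshelve. all: by end_near. Qed.

(** [T t] commutes with [T h], so it carries difference quotients of the orbit
    of [u] at 0 to those at [t]: the domain of the generator is invariant. *)
Lemma difference_quotient_evol t h u f : 0 <= t -> 0 <= h ->
  nrm (h^-1 *: (T h (T t u) - T t u) - T t f) =
  nrm (T t (h^-1 *: (T h u - u) - f)).
Proof.
move=> t0 h0; rewrite -(evol_dist ip ev)//; apply: (nrm_congrB ip).
have E := evolZ ip ev h^-1 (T h u - u) t0.
rewrite (nrm_congrBr ip _ E).
rewrite -scalerBr nrmZ//.
apply/eqP; rewrite mulf_eq0; apply/orP; right; apply/eqP.
rewrite (nrm_congrBr ip _ (evolB ev _ _ t0)).
rewrite opprB addrA subrK.
have := evol_D ev u h0 t0; rewrite (addrC h) => /(nrm_congrB ip) <-.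
by rewrite (evol_D ev).
Qed.

Lemma gen_evol t u f : 0 <= t -> A u f -> A (T t u) (T t f).
Proof.
move=> t0 /(evol_gen ev) uf; apply/(evol_gen ev).
have [M M0 TM] := evol_bound ev t0.
apply: nrm_cvg0_le M0 _ uf; near=> h.
have h0 : 0 <= h by near: h; exact: nbhs_right_ge.
by rewrite difference_quotient_evol.
Unshelve. all: by end_near. Qed.

Lemma gen_orbit t u f : 0 <= t -> A u f -> rderivative (T ^~ u) t (T t f).
Proof.
move=> t0 /(gen_evol t0)/(evol_gen ev).
apply: cvg_trans; apply: near_eq_cvg; near=> h.
have h0 : 0 <= h by near: h; exact: nbhs_right_ge.
apply: nrm_congr => //; rewrite opprB addrA subrK -scalerBr nrmZ//.
rewrite opprB addrA subrK (nrmBC ip) (addrC t).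
by rewrite (evol_D ev)// mulr0.
Unshelve. all: by end_near. Qed.

(** Along the orbit the derivative of the square of the norm is
    2 <A (T s u), T s u> <= 0. *)
Lemma evol_contract_gen t u f : 0 <= t -> A u f -> nrm (T t u) <= nrm u.
Proof.
move=> t0 uf.
have := @dissipative_growth _ _ _ ip (T ^~ u) 0 t 0 t0 (lexx 0).
rewrite mul0r addr0 (nrm_congr ip (evol_0 ev u)); apply.
  by move=> s /andP[s0 _] e e0; exact: (orbit_left_continuous ip ev).
move=> s /andP[s0 _]; exists (T s f); first exact: gen_orbit.
by rewrite mul0r (gen_le0 ev)//; exact: gen_evol.
Qed.

(** The closure of the domain of the generator: contraction passes to limits
    of vectors of the domain. *)
Definition gen_closure u : Prop :=
  forall e : R, 0 < e -> exists v f, A v f /\ nrm (u - v) <= e.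

Lemma evol_contract t u : 0 <= t -> gen_closure u -> nrm (T t u) <= nrm u.
Proof.
move=> t0 clu; have [M M0 TM] := evol_bound ev t0.
apply/ler_addgt0Pr => e e0.
have e1 : 0 < e / (1 + M) by rewrite divr_gt0// addr_gt0.
have [v [f [vf uv]]] := clu _ e1.
apply: (le_trans (ler_dist_nrm ip _ (T t v))).
rewrite (evol_dist ip ev)//.
have h1 := evol_contract_gen t0 vf.
have h2 := ler_dist_nrm ip v u; rewrite (nrmBC ip) in h2.
have h3 : nrm (T t (u - v)) <= M * (e / (1 + M)).
  by apply: (le_trans (TM _)); rewrite ler_pM2l.
have -> : nrm u + e = nrm u + e / (1 + M) + M * (e / (1 + M)).
  by field; apply: lt0r_neq0; exact: addr_gt0.
by lra.
Qed.

Lemma gen_closure_gen u f : A u f -> gen_closure u.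
Proof. by move=> uf e e0; exists u, f; rewrite subrr nrm0// ltW. Qed.

Lemma gen_closureB u v : gen_closure u -> gen_closure v -> gen_closure (u - v).
Proof.
move=> clu clv e e0; have e2 : 0 < e / 2 by rewrite divr_gt0.
have [u' [f [uf uu]]] := clu _ e2; have [v' [g [vg vv]]] := clv _ e2.
exists (-1 *: v' + u'), (-1 *: g + f); split; first exact: gen_linear.
rewrite scaleN1r opprD opprK addrA.
have -> : u - v + v' - u' = (u - u') - (v - v').
  by rewrite subrACA opprB addrA.
by apply: (le_trans (ler_nrmB ip _ _)); lra.
Qed.

Lemma gen_closure_lim u : (forall e : R, 0 < e ->
  exists2 v, gen_closure v & nrm (u - v) <= e) -> gen_closure u.
Proof.
move=> H e e0; have e2 : 0 < e / 2 by rewrite divr_gt0.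
have [v clv uv] := H _ e2; have [w [f [wf vw]]] := clv _ e2.
exists w, f; split=> //; apply: (le_trans (ler_nrm_dist ip _ v _)).
by rewrite (splitr e) lerD.
Qed.

Lemma gen_closure_evol t u : 0 <= t -> gen_closure u -> gen_closure (T t u).
Proof.
move=> t0 clu e e0; have [M M0 TM] := evol_bound ev t0.
have [v [f [vf uv]]] := clu (e / M) (divr_gt0 e0 M0).
exists (T t v), (T t f); split; first exact: gen_evol.
rewrite (evol_dist ip ev)//; apply: (le_trans (TM _)).
by rewrite -ler_pdivlMl// mulrC.
Qed.

Lemma gen_closureZ a u : gen_closure u -> gen_closure (a *: u).
Proof.
move=> clu e e0; have a0 : 0 < `|a| + 1 by rewrite ltr_wpDl.
have [v [f [vf uv]]] := clu _ (divr_gt0 e0 a0).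
exists (a *: v), (a *: f); split.
  by have := gen_linear (a - 1) vf vf; rewrite !scalerBl !scale1r !subrK.
rewrite -scalerBr nrmZ//; apply: (@le_trans _ _ ((`|a| + 1) * nrm (u - v))).
  by rewrite ler_wpM2r ?nrm_ge0// lerDl.
by rewrite -ler_pdivlMl// mulrC.
Qed.

(** Between consecutive times the pairing of [T s u] with [T (t - s) v] changes
    by the remainders of two difference quotients, which the contractions make
    uniformly small; so the pairing does not depend on [s]. *)
Lemma evol_sym_gen t u f v g : 0 <= t -> A u f -> A v g ->
  gen_closure f -> gen_closure g -> dot (T t u) v = dot u (T t v).
Proof.
move=> t0 uf vg clf clg.
have [->|tn0] := eqVneq t 0.
  by rewrite (dot_congrl ip _ (evol_0 ev u)) (dot_congrr ip _ (evol_0 ev v)).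
have tp : 0 < t by rewrite lt_neqAle eq_sym tn0.
apply/eqP; rewrite -subr_eq0 -normr_le0; apply/ler_addgt0Pr => e e0; rewrite add0r.
pose K := nrm v + nrm u + 1.
have K0 : 0 < K by rewrite ltr_wpDl// addr_ge0// nrm_ge0.
pose eta := e / (t * K).
have eta0 : 0 < eta by rewrite divr_gt0// mulr_gt0.
have [n] : exists n : nat, nrm ((t / n.+1%:R)^-1 *: (T (t / n.+1%:R) u - u) - f)
    <= eta /\ nrm ((t / n.+1%:R)^-1 *: (T (t / n.+1%:R) v - v) - g) <= eta.
  have /(evol_gen ev)/nrm_cvg0P/(_ _ eta0)[d1 /= d10 D1] := uf.
  have /(evol_gen ev)/nrm_cvg0P/(_ _ eta0)[d2 /= d20 D2] := vg.
  have d0 : 0 < Num.min d1 d2 / t by rewrite divr_gt0// lt_min d10.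
  have [n _ /(_ n (leqnn n)) /= nd] := near_infty_natSinv_lt (PosNum d0).
  exists n; have h0 : 0 < t / n.+1%:R by rewrite divr_gt0.
  have : t / n.+1%:R < Num.min d1 d2 by rewrite mulrC -ltr_pdivlMr.
  rewrite lt_min => /andP[h1 h2].
  by split; [apply: D1|apply: D2] => //=; rewrite sub0r normrN gtr0_norm.
set h := t / _ => -[uh vh].
have h0 : 0 < h by rewrite divr_gt0.
have h0' := ltW h0.
have tE : t = n.+1%:R * h by rewrite /h mulrC divfK.
have remainder k x y : A x y -> gen_closure y -> nrm (h^-1 *: (T h x - x) - y) <= eta ->
    nrm (T h (T (k%:R * h) x) - T (k%:R * h) x - h *: T (k%:R * h) y) <= h * eta.
  move=> xy cly xh; have kh0 : 0 <= k%:R * h by rewrite mulr_ge0.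
  have -> : T h (T (k%:R * h) x) - T (k%:R * h) x - h *: T (k%:R * h) y =
      h *: (h^-1 *: (T h (T (k%:R * h) x) - T (k%:R * h) x) - T (k%:R * h) y).
    by rewrite scalerBr scalerA divff ?gt_eqF// scale1r.
  rewrite nrmZ// gtr0_norm// ler_pM2l// difference_quotient_evol//.
  apply: le_trans xh; apply: evol_contract => //.
  apply: gen_closureB => //; apply: gen_closureZ.
  have clx := gen_closure_gen xy.
  by apply: gen_closureB => //; exact: gen_closure_evol.
pose F k := dot (T (k%:R * h) u) (T ((n.+1 - k)%:R * h) v).
have step k : (k <= n)%N -> `|F k.+1 - F k| <= h * eta * K.
  move=> kn; pose a := T (k%:R * h) u; pose b := T ((n - k)%:R * h) v.
  have kh0 : 0 <= k%:R * h by rewrite mulr_ge0.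
  have kh0' : 0 <= (n - k)%:R * h by rewrite mulr_ge0.
  have -> : F k.+1 = dot (T h a) b.
    rewrite /F subSS; apply: (dot_congrl ip).
    by rewrite -natr1 mulrDl mul1r (addrC (k%:R * h)) (evol_D ev).
  have -> : F k = dot a (T h b).
    rewrite /F subSn//; apply: (dot_congrr ip).
    by rewrite -natr1 mulrDl mul1r (addrC ((n - k)%:R * h)) (evol_D ev).
  have -> : dot (T h a) b - dot a (T h b) =
      dot (T h a - a - h *: T (k%:R * h) f) b -
      dot a (T h b - b - h *: T ((n - k)%:R * h) g).
    rewrite !(dotBl ip) !(dotBr ip) (dotZl ip) (dotZr ip).
    rewrite (gen_sym ev (gen_evol kh0 uf) (gen_evol kh0' vg)) -/a -/b.
    by ring.
  have ca : nrm a <= nrm u by exact: evol_contract_gen uf.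
  have cb : nrm b <= nrm v by exact: evol_contract_gen vg.
  apply: (le_trans (ler_normB _ _)).
  have he : 0 <= h * eta by rewrite mulr_ge0// ltW.
  apply: (@le_trans _ _ (h * eta * nrm v + h * eta * nrm u)); last first.
    by rewrite -mulrDr ler_wpM2l// lerDl.
  apply: lerD; apply: (le_trans (cauchy_schwarz ip _ _)).
    by apply: ler_pM => //; rewrite ?nrm_ge0//; exact: remainder.
  by rewrite mulrC; apply: ler_pM => //; rewrite ?nrm_ge0//; exact: remainder.
have F0n k : (k <= n.+1)%N -> `|F k - F 0%N| <= k%:R * (h * eta * K).
  elim: k => [_|k IH kn]; first by rewrite subrr normr0 mul0r.
  rewrite -natr1 mulrDl mul1r -(subrKA (F k)) addrC.
  apply: (le_trans (ler_normD _ _)); apply: lerD; last exact: step.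
  by apply: IH; exact: ltnW.
have := F0n n.+1 (leqnn _).
rewrite /F subnn subn0 !mul0r -tE.
rewrite (dot_congrl ip _ (evol_0 ev u)) (dot_congrr ip _ (evol_0 ev v)).
move=> /le_trans; apply.
rewrite mulrA mulrA -tE /eta le_eqVlt; apply/orP; left; apply/eqP.
by field; rewrite tn0/= gt_eqF.
Qed.

Lemma evol_sym_lim t u v : 0 <= t -> (forall e : R, 0 < e ->
    exists2 u', dot (T t u') v = dot u' (T t v) & nrm (u - u') <= e) ->
  dot (T t u) v = dot u (T t v).
Proof.
move=> t0 H; have [M M0 TM] := evol_bound ev t0.
apply/eqP; rewrite -subr_eq0 -normr_le0; apply/ler_addgt0Pr => e e0; rewrite add0r.
pose K := M * nrm v + nrm (T t v) + 1.
have K0 : 0 < K by rewrite ltr_wpDl// addr_ge0// ?mulr_ge0// ?nrm_ge0// ltW.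
have [u' u'E uu'] := H _ (divr_gt0 e0 K0).
have -> : dot (T t u) v - dot u (T t v) =
    dot (T t u - T t u') v - dot (u - u') (T t v).
  by rewrite !(dotBl ip) u'E; ring.
apply: (le_trans (ler_normB _ _)).
have -> : e = e / K * K by rewrite divfK// gt_eqF.
apply: (@le_trans _ _ (nrm (u - u') * K)); last by rewrite ler_wpM2r// ltW.
apply: (@le_trans _ _ (nrm (u - u') * (M * nrm v + nrm (T t v)))); last first.
  by rewrite ler_wpM2l ?nrm_ge0// lerDl.
rewrite mulrDr; apply: lerD; apply: (le_trans (cauchy_schwarz ip _ _)) => //.
rewrite mulrA (mulrC _ M) ler_wpM2r ?nrm_ge0// (evol_dist ip ev)//.
Qed.

(** Limits of vectors in the domain whose image is a limit of vectors in the
    domain: on these images too the semigroup is contracting, as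
    [evol_sym_gen] requires for the remainders. *)
Definition evol_core u : Prop := forall e : R, 0 < e ->
  exists u' f, [/\ A u' f, gen_closure f & nrm (u - u') <= e].

Lemma evol_sym t u v : 0 <= t -> evol_core u -> evol_core v ->
  dot (T t u) v = dot u (T t v).
Proof.
move=> t0 cu cv; apply: evol_sym_lim => // e /cu[u' [f [uf clf uu']]].
exists u' => //; rewrite (dotC ip) (dotC ip u').
apply/esym; apply: evol_sym_lim => // d /cv[v' [g [vg clg vv']]].
by exists v' => //; exact: evol_sym_gen vg uf clg clf.
Qed.

Lemma evol_core_lim u : (forall e : R, 0 < e ->
  exists2 v, evol_core v & nrm (u - v) <= e) -> evol_core u.
Proof.
move=> H e e0; have e2 : 0 < e / 2 by rewrite divr_gt0.
have [v cv uv] := H _ e2; have [w [f [wf clf vw]]] := cv _ e2.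
exists w, f; split=> //; apply: (le_trans (ler_nrm_dist ip _ v _)).
by rewrite (splitr e) lerD.
Qed.

Lemma gen_closureD u v : gen_closure u -> gen_closure v -> gen_closure (u + v).
Proof.
move=> clu clv; rewrite -[v]opprK; apply: gen_closureB => //.
by rewrite -scaleN1r; exact: gen_closureZ.
Qed.

Lemma evol_core_linear a u v :
  evol_core u -> evol_core v -> evol_core (a *: u + v).
Proof.
move=> cu cv e e0; have a0 : 0 < `|a| + 1 by rewrite ltr_wpDl.
have e2 : 0 < e / 2 by rewrite divr_gt0.
have [u' [f [uf clf uu']]] := cu _ (divr_gt0 e2 a0).
have [v' [g [vg clg vv']]] := cv _ e2.
exists (a *: u' + v'), (a *: f + g); split.
- exact: gen_linear.
- by apply: gen_closureD => //; exact: gen_closureZ.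
rewrite opprD addrACA -scalerBr; apply: (le_trans (ler_nrmD ip _ _)).
rewrite (splitr e); apply: lerD => //; rewrite nrmZ//.
apply: (@le_trans _ _ ((`|a| + 1) * nrm (u - u'))).
  by rewrite ler_wpM2r ?nrm_ge0// lerDl.
by rewrite -ler_pdivlMl// mulrC.
Qed.

(** The error z(s) = T_(s - s0) (w s0) - w s solves z' = A z + (A w - w'), and
    [A] is dissipative, so it grows at most at rate [eps]; then s0 tends to 0. *)
Lemma evol_approx (w l w' : R -> V) (w0 : V) t (eps : R) : 0 < t -> 0 <= eps ->
  (forall s, 0 < s <= t -> A (w s) (l s)) ->
  (forall s, 0 < s < t -> rderivative w s (w' s)) ->
  (forall s, 0 < s <= t -> forall e : R, 0 < e ->
     \forall h \near 0^'+, nrm (w (s - h) - w s) <= e) ->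
  (forall s, 0 < s < t -> nrm (w' s - l s) <= eps) ->
  nrm (w s - w0) @[s --> 0^'+] --> (0 : R) ->
  nrm (T t w0 - w t) <= eps * t.
Proof.
move=> t0 eps0 Aw dw lw resid /nrm_cvg0P w0P.
have clw s : 0 < s <= t -> gen_closure (w s) by move=> /Aw/gen_closure_gen.
have clw0 : gen_closure w0.
  apply: gen_closure_lim => e e0; near (0 : R)^'+ => s.
  have st : 0 < s <= t.
    by apply/andP; split; near: s; [exact: nbhs_right_gt|exact: nbhs_right_le].
  by exists (w s); [exact: clw|rewrite (nrmBC ip); near: s; exact: w0P].
have growth s0 : 0 < s0 < t -> nrm (T (t - s0) (w s0) - w t) <= eps * t.
  move=> /andP[s00 s0t].
  have := @dissipative_growth _ _ _ ip (fun s => T (s - s0) (w s0) - w s)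
    s0 t eps (ltW s0t) eps0.
  rewrite subrr (evol_0 ev) add0r => H.
  apply: (@le_trans _ _ (eps * (t - s0))); last first.
    by rewrite ler_wpM2l// gerBl ltW.
  apply: H => [s /andP[s0s st] e e0|s /andP[s0s st]].
    have e2 : 0 < e / 2 by rewrite divr_gt0.
    have ss : 0 < s - s0 by rewrite subr_gt0.
    have s0' : 0 < s <= t by rewrite (lt_trans s00 s0s).
    have H1 := orbit_left_continuous ip ev (w s0) ss e2.
    have H2 := lw s s0' _ e2.
    near=> h; rewrite subrACA (addrAC s); apply: (le_trans (ler_nrmB ip _ _)).
    by rewrite (splitr e); apply: lerD; near: h.
  have s0' : 0 < s by exact: lt_le_trans s00 s0s.
  have ss : 0 <= s - s0 by rewrite subr_ge0.
  have s00' : 0 < s0 <= t by rewrite s00 ltW.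
  exists (T (s - s0) (l s0) - w' s).
    apply: (@right_derivativeB (fun s => T (s - s0) (w s0))); last first.
      by apply: dw; rewrite s0'.
    have := gen_orbit ss (Aw _ s00'); rewrite /right_derivative.
    by under eq_fun do rewrite addrAC.
  have E : T (s - s0) (l s0) - w' s = (T (s - s0) (l s0) - l s) - (w' s - l s).
    by rewrite opprB addrA subrK.
  rewrite E (dotBl ip) -[leRHS]add0r; apply: lerD.
    have st' : 0 < s <= t by rewrite s0' ltW.
    apply: (gen_le0 ev).
    have := gen_linear (-1) (Aw s st') (gen_evol ss (Aw _ s00')).
    by rewrite !scaleN1r (addrC (- w s)) (addrC (- l s)).
  rewrite -(dotNl ip); apply: (le_trans (ler_norm _)).
  apply: (le_trans (cauchy_schwarz ip _ _)); rewrite ler_wpM2r ?nrm_ge0//.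
  by rewrite nrmN//; apply: resid; rewrite s0'.
apply/ler_addgt0Pr => e e0.
have e2 : 0 < e / 2 by rewrite divr_gt0.
have Tw0 := (nrm_cvg0P _ _).1 (evol_cvg0 ev w0) _ e2.
have ww0 := w0P _ e2.
near (0 : R)^'+ => s.
have s0 : 0 < s by near: s; exact: nbhs_right_gt.
have st : s < t by near: s; exact: nbhs_right_lt.
have ts : 0 <= t - s by rewrite subr_ge0 ltW.
apply: (le_trans (ler_nrm_dist ip _ (T (t - s) (w s)) _)).
rewrite addrC; apply: lerD; first by apply: growth; rewrite s0.
have := evol_D ev w0 ts (ltW s0); rewrite subrK => E.
rewrite (nrm_congrB ip _ E) (evol_dist ip ev)//.
apply: (le_trans (evol_contract ts _)).
  apply: gen_closureB; first exact: gen_closure_evol (ltW s0) clw0.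
  by apply: clw; rewrite s0 ltW.
apply: (le_trans (ler_nrm_dist ip _ w0 _)); rewrite (splitr e) (nrmBC ip w0).
by apply: lerD; near: s.
Unshelve. all: by end_near. Qed.

End Comparison.

(** * Square integrable functions on the graph *)

Section EdgeIntegrals.
Context {R : realType}.
Local Notation mu := (@lebesgue_measure R).
Implicit Types (l a : R) (f g : R -> R).

Lemma square_integrableP l f : square_integrable l f <->
  measurable_fun `[0, l] f /\ mu.-integrable `[0, l] (EFin \o (fun x => f x ^+ 2)).
Proof.
have mI : measurable (`[0, l]%classic : set R) by [].
have E : (fun x => (f \_ `[0, l]) x ^+ 2) = (fun x => f x ^+ 2) \_ `[0, l].
  by apply/funext => x; rewrite !patchE; case: ifP => // _; rewrite expr0n.
split=> [|[mf if2]].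
  rewrite /square_integrable => f2; split.
    apply/(measurable_restrictT f mI); move: f2.
    by rewrite inE => /andP[]; rewrite inE.
  have := Lfun2_integrable_sqr f2; rewrite E -restrict_EFin.
  by move=> /(integrable_restrict mu mI measurableT _).2; rewrite setTI.
rewrite /square_integrable inE; apply/andP; split.
  by rewrite inE/=; apply/(measurable_restrictT f mI).
rewrite inE/= /finite_norm unlock /=; apply: poweR_lty.
have : mu.-integrable setT (EFin \o (fun x => (f \_ `[0, l]) x ^+ 2)).
  rewrite E -restrict_EFin; apply: (integrable_restrict mu mI measurableT _).1.
  by rewrite setTI.
move=> /integrableP[_]; apply: le_lt_trans; rewrite le_eqVlt; apply/orP; left.
apply/eqP; apply: eq_integral => x _ /=.
by rewrite normrX powR_mulrn.
Qed.

Lemma square_integrable_mul l f g : square_integrable l f ->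
  square_integrable l g -> mu.-integrable `[0, l] (EFin \o (fun x => f x * g x)).
Proof.
have mI : measurable (`[0, l]%classic : set R) by [].
move=> f2 g2; have /Lfun1_integrable := Lfun2_mul_Lfun1 f2 g2.
rewrite (_ : (f \_ `[0, l]) \* (g \_ `[0, l]) = (fun x => f x * g x) \_ `[0, l]).
  rewrite -restrict_EFin => /(integrable_restrict mu mI measurableT _).2.
  by rewrite setTI.
by apply/funext => x /=; rewrite !patchE; case: ifP => // _; rewrite mulr0.
Qed.

Lemma segment_measure_lty l : (mu `[0%R, l]%classic < +oo)%E.
Proof. by rewrite lebesgue_measure_itv /=; case: ifPn => // _; exact: ltry. Qed.

Lemma square_integrable_bounded l f (M : R) : measurable_fun `[0, l] f ->
  (forall x, `[0, l]%classic x -> `|f x| <= M) -> square_integrable l f.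
Proof.
have mI : measurable (`[0, l]%classic : set R) by [].
move=> mf fM; apply/square_integrableP; split=> //.
apply: measurable_bounded_integrable => //.
- exact: segment_measure_lty.
- exact: measurable_funX.
exists (M ^+ 2); split; first exact: num_real.
move=> y My x /= xl; apply: le_trans (ltW My).
have := fM x xl; rewrite normrX => H.
by rewrite ler_pXn2r// nnegrE// (le_trans _ H).
Qed.

Lemma continuous_square_integrable l f : {within `[0, l], continuous f} ->
  square_integrable l f.
Proof.
move=> cf; apply/square_integrableP; split.
  exact: subspace_continuous_measurable_fun.
apply: continuous_compact_integrable; first exact: segment_compact.
rewrite (_ : (fun x => f x ^+ 2) = (fun x => f x * f x)).
  by move=> x; apply: continuousM; exact: cf.
by apply/funext => x; rewrite expr2.
Qed.

Lemma square_integrable_linear l a f g : square_integrable l f ->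
  square_integrable l g -> square_integrable l (fun x => a * f x + g x).
Proof.
rewrite /square_integrable => f2 g2.
have p1 : (1 <= 2%:E :> \bar R)%E by rewrite lee1n.
have := (Lfun_submod_closed mu p1).2 a _ _ f2 g2.
rewrite (_ : a *: (f \_ `[0, l]) + g \_ `[0, l] =
  (fun x => a * f x + g x) \_ `[0, l])//.
apply/funext => x; rewrite !fctE !patchE; case: ifP => // _.
by rewrite addr0; exact: mulr0.
Qed.

Lemma square_integrable0 l : square_integrable l (fun=> 0).
Proof. by apply: continuous_square_integrable => x; exact: cvg_cst. Qed.

End EdgeIntegrals.

Section L2space.
Context {R : realType}.
Variable G : metric_graph R.
Local Notation mu := (@lebesgue_measure R).

Definition L2pred : {pred gfun G} := [pred u | `[< L2 u >]].

Lemma L2pred_submod_closed : submod_closed L2pred.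
Proof.
split; first by apply/asboolP => e; exact: square_integrable0.
move=> a u v /asboolP u2 /asboolP v2; apply/asboolP => e.
exact: square_integrable_linear.
Qed.

HB.instance Definition _ := GRing.isSubmodClosed.Build R (gfun G) L2pred
  L2pred_submod_closed.

(** Representatives, not classes, form the module to which the abstract results
    are applied, since the operators act on representatives. *)
Record L2fun := MkL2fun { l2val :> gfun G; l2valP : l2val \in L2pred }.

HB.instance Definition _ := [isSub for l2val].
HB.instance Definition _ := [Choice of L2fun by <:].
HB.instance Definition _ := [SubChoice_isSubLmodule of L2fun by <:].

End L2space.

(** * The heat semigroup on square integrable functions *)

Section L2inner.
Context {R : realType}.
Variable G : metric_graph R.
Local Notation mu := (@lebesgue_measure R).
Implicit Types u v w f : gfun G.

Lemma L2_mul_integrable u v e : L2 u -> L2 v ->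
  mu.-integrable (edge_itv e) (EFin \o (fun x => u e x * v e x)).
Proof. by move=> u2 v2; exact: square_integrable_mul. Qed.

Lemma L2dotC u v : L2dot u v = L2dot v u.
Proof.
rewrite /L2dot /gintegral; apply: eq_bigr => e _.
by apply: eq_Rintegral => x _; rewrite mulrC.
Qed.

Lemma L2dot_linear a u v w : L2 u -> L2 v -> L2 w ->
  L2dot (fun e x => a * u e x + v e x) w = a * L2dot u w + L2dot v w.
Proof.
move=> u2 v2 w2; rewrite /L2dot /gintegral mulr_sumr -big_split/=.
apply: eq_bigr => e _.
have uw := L2_mul_integrable e u2 w2; have vw := L2_mul_integrable e v2 w2.
have mI : measurable (edge_itv e : set (measurableTypeR R)).
  exact: measurable_itv.
have auw := integrableZl mI a uw.
rewrite -(RintegralZl a mI uw) -(RintegralD mI auw vw).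
by apply: eq_Rintegral => x _; rewrite mulrDl mulrA.
Qed.

Lemma L2dot_ge0 u : 0 <= L2dot u u.
Proof.
rewrite /L2dot /gintegral; apply: sumr_ge0 => e _.
by apply: Rintegral_ge0 => x _; rewrite -expr2 sqr_ge0.
Qed.

Lemma L2dot_ae_eq u v w : L2 u -> L2 v -> L2 w -> gae_eq u v ->
  L2dot u w = L2dot v w.
Proof.
move=> u2 v2 w2 uv; rewrite /L2dot /gintegral; apply: eq_bigr => e _.
rewrite /Rintegral; congr fine.
have mI : measurable (edge_itv e : set (measurableTypeR R)).
  exact: measurable_itv.
apply: ae_eq_integral; first exact: mI.
- by have /integrableP[] := L2_mul_integrable e u2 w2.
- by have /integrableP[] := L2_mul_integrable e v2 w2.
have := uv e; apply: filterS => x /= H xe; by rewrite H.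
Qed.

Definition toL2 u (u2 : L2 u) : L2fun G := @MkL2fun _ G u (asboolT u2).

Lemma L2fun_L2 (u : L2fun G) : L2 u.
Proof. exact/asboolP/(l2valP u). Qed.

Definition gdot (u v : L2fun G) : R := L2dot u v.

Lemma gdot_inner : inner_product gdot.
Proof.
split=> [u v|a u v w|u]; rewrite /gdot.
- exact: L2dotC.
- by rewrite -L2dot_linear//; exact: L2fun_L2.
- exact: L2dot_ge0.
Qed.

Lemma gae_eq_nrm (u v : L2fun G) : gae_eq u v -> nrm gdot (u - v) = 0.
Proof.
move=> uv; have u2 := L2fun_L2 u; have v2 := L2fun_L2 v.
rewrite /nrm (dotBl gdot_inner) !(dotBr gdot_inner) /gdot.
rewrite !(L2dot_ae_eq u2 v2) //.
by rewrite (L2dotC v u) (L2dot_ae_eq u2 v2 v2 uv) subrr sqrtr0.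
Qed.

Lemma L2norm_nrm (u : gfun G) (v : L2fun G) : u = v -> L2norm u = nrm gdot v.
Proof. by move=> ->. Qed.

Section HeatSemigroup.
Variables (VD : {set vertex G}) (T : R -> gfun G -> gfun G).
Hypothesis hT : heat_semigroup VD T.

(** For t < 0 the function [T t u] may fail to be square integrable, and then
    [u] is taken as a default. *)
Definition L2evol (t : R) (u : L2fun G) : L2fun G := insubd u (T t u).

Lemma L2evolE t (u : L2fun G) : 0 <= t -> L2evol t u = T t u :> gfun G.
Proof.
move=> t0; rewrite /L2evol val_insubd.
have -> : T t u \in @L2pred _ G; last by [].
apply/asboolP; exact: (semigroup_L2 hT.1 t0 (L2fun_L2 u)).
Qed.

Lemma inH10_L2 w dw : inH10 VD w dw -> L2 w /\ L2 dw.
Proof. by move=> [H _ _ _]; split=> e; have [] := H e. Qed.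

Lemma laplacian_le0 u f : L2 u -> L2 f -> laplacian VD u f -> L2dot f u <= 0.
Proof.
move=> u2 f2 [w [dw [uw wdw H]]].
have [w2 dw2] := inH10_L2 wdw.
have := H _ _ wdw; rewrite (L2dotC f) -(L2dot_ae_eq u2 w2 f2 uw) L2dotC => E.
by rewrite -oppr_ge0 -E L2dot_ge0.
Qed.

(** Both sides are the opposite of the form a(w, z) evaluated at the
    representatives w, z of [u], [v] in the form domain. *)
Lemma laplacian_sym u f v g : L2 u -> L2 f -> L2 v -> L2 g ->
  laplacian VD u f -> laplacian VD v g -> L2dot f v = L2dot u g.
Proof.
move=> u2 f2 v2 g2 [w [dw [uw wdw H]]] [z [dz [vz zdz H']]].
have [w2 dw2] := inH10_L2 wdw; have [z2 dz2] := inH10_L2 zdz.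
apply: oppr_inj; rewrite (L2dotC f) (L2dot_ae_eq v2 z2 f2 vz) L2dotC -(H _ _ zdz).
by rewrite (L2dot_ae_eq u2 w2 g2 uw) (L2dotC w) -(H' _ _ wdw) L2dotC.
Qed.

Lemma heat_evolution : symmetric_evolution gdot L2evol
  (fun u f : L2fun G => laplacian VD u f).
Proof.
have [sg gen] := hT.
split.
- move=> t a u v t0; apply: gae_eq_nrm => e.
  rewrite /= !L2evolE//.
  exact: (semigroup_linear sg a t0 (L2fun_L2 u) (L2fun_L2 v) e).
- move=> t t0; have [M TM] := semigroup_bounded sg t0; exists M => u.
  have := TM _ (L2fun_L2 u).
  by rewrite (L2norm_nrm (esym (L2evolE u t0))) (L2norm_nrm (erefl (l2val u))).
- move=> u; apply: gae_eq_nrm => e; rewrite L2evolE//.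
  exact: (semigroup_0 sg (L2fun_L2 u) e).
- move=> s t u s0 t0; apply: gae_eq_nrm => e.
  rewrite !L2evolE ?addr_ge0//.
  exact: (semigroup_D sg s0 t0 (L2fun_L2 u) e).
- move=> u; have := semigroup_cvg0 sg (L2fun_L2 u).
  apply: cvg_trans; apply: near_eq_cvg; near=> t.
  have t0 : 0 <= t by near: t; exact: nbhs_right_ge.
  apply: L2norm_nrm; rewrite /=; apply/funext => e; apply/funext => x.
  by rewrite -(L2evolE u t0).
- move=> u f; rewrite -(gen _ _ (L2fun_L2 u) (L2fun_L2 f)) /generator.
  have E : \forall h \near 0^'+, nrm gdot (h^-1 *: (L2evol h u - u) - f) =
      L2norm (fun e x => (T h (l2val u) e x - l2val u e x) / h - l2val f e x).
    near=> h; have h0 : 0 <= h by near: h; exact: nbhs_right_ge.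
    apply/esym/L2norm_nrm; apply/funext => e; apply/funext => x.
    by rewrite -(L2evolE u h0) mulrC.
  split; apply: cvg_trans; apply: near_eq_cvg; first exact: E.
  by move: E; apply: filterS => h ->.
- move=> u f; apply: laplacian_le0; exact: L2fun_L2.
- move=> u f v g; apply: laplacian_sym; exact: L2fun_L2.
Unshelve. all: by end_near. Qed.

End HeatSemigroup.
End L2inner.

(** * One-sided powers, cut-offs and approximate identities *)

Section Calculus.
Context {R : realType}.
Local Notation mu := (@lebesgue_measure R).
Implicit Types (f g F : R -> R) (x y a b l : R).

Lemma derive_continuous F f : (forall x, is_derive x (1 : R) F (f x)) ->
  continuous F.
Proof.
move=> dF x; apply: differentiable_continuous; apply/derivable1_diffP.
by have [] := dF x.
Qed.

Lemma segment_continuous_integrable a b f : {within `[a, b], continuous f} ->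
  mu.-integrable `[a, b] (EFin \o f).
Proof.
by move=> cf; apply: continuous_compact_integrable => //; exact: segment_compact.
Qed.

Lemma continuous_integrable a b f : continuous f ->
  mu.-integrable `[a, b] (EFin \o f).
Proof.
by move=> cf; apply: segment_continuous_integrable; exact: continuous_subspaceT.
Qed.

Lemma Rintegral_derive a b F f : a < b ->
  (forall x, is_derive x (1 : R) F (f x)) -> continuous f ->
  \int[mu]_(x in `[a, b]) f x = F b - F a.
Proof.
move=> ab dF cf; have cF := derive_continuous dF.
rewrite /Rintegral (@continuous_FTC2 _ f F)//.
- exact: continuous_subspaceT.
- split.
  + by move=> x _; have [] := dF x.
  + by apply: cvg_at_right_filter; exact: cF.
  + by apply: cvg_at_left_filter; exact: cF.
- by move=> x _; rewrite derive1E; have [_ ->] := dF x.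
Qed.

Lemma is_derive_exprn n x f (df : R) : is_derive x (1 : R) f df ->
  is_derive x (1 : R) (fun z => f z ^+ n) (n%:R * f x ^+ n.-1 * df).
Proof.
move=> dfx; have := @is_deriveX R R f n x (1 : R) df dfx.
rewrite (_ : f ^+ n = fun z => f z ^+ n)//; apply/funext => z.
by elim: n => // n IH; rewrite !exprS -IH.
Qed.

(** The m-th power of the positive part: of class C^(m-1), and composed with
    polynomials it yields cut-offs and compactly supported splines. *)
Definition pospow (m : nat) (y : R) : R := Num.max y 0 ^+ m.

Lemma pospow_gt0 m y : 0 <= y -> pospow m y = y ^+ m.
Proof. by move=> y0; rewrite /pospow max_l. Qed.

Lemma pospow_le0 m y : y <= 0 -> pospow m.+1 y = 0.
Proof. by move=> y0; rewrite /pospow max_r// expr0n. Qed.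

Lemma pospow_ge0 m y : 0 <= pospow m y.
Proof. by rewrite exprn_ge0// le_max lexx orbT. Qed.

Lemma is_derive_pospow m y :
  is_derive y (1 : R) (pospow m.+2) (m.+2%:R * pospow m.+1 y).
Proof.
have [y0|y0|->] := ltgtP y 0.
- rewrite pospow_le0 ?ltW// mulr0.
  apply: (@near_eq_is_derive _ _ _ (cst 0)).
  near=> z; rewrite /= pospow_le0// ltW//; near: z; exact: lt_nbhsl.
- have D : is_derive y (1 : R) (fun z : R => z ^+ m.+2) (m.+2%:R * pospow m.+1 y).
    have := is_derive_exprn m.+2 (is_derive_id y (1 : R)).
    by rewrite pospow_gt0 ?ltW// mulr1.
  apply: near_eq_is_derive D.
  near=> z; rewrite pospow_gt0// ltW//; near: z; exact: lt_nbhsr.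
- rewrite pospow_le0// mulr0.
  suff H : (fun h : R => h^-1 *: ((pospow m.+2 \o shift 0) (h *: 1) - pospow m.+2 0))
      @ 0^' --> (0 : R).
    apply: DeriveDef; first by apply/cvg_ex; exists 0.
    exact/cvg_lim.
  apply/cvgr0Pnorm_le => e e0; near=> h.
  have h0 : h != 0 by near: h; exact: nbhs_dnbhs_neq.
  have he : `|h| <= e.
    near: h; apply: nbhs_dnbhs; near=> h.
    near: h; apply: (@nbhs0_le R R); exact: e0.
  have h1 : `|h| <= 1 by near: h; apply: nbhs_dnbhs; apply: (@nbhs0_le R R).
  rewrite /= addr0 (pospow_le0 _ (lexx 0)) subr0 normrZ normfV.
  rewrite ler_pdivrMl ?normr_gt0// -[h *: 1]/(h * 1) mulr1.
  rewrite ger0_norm ?pospow_ge0// /pospow.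
  have hm : Num.max h 0 <= `|h| by rewrite ge_max ler_norm normr_ge0.
  have hm0 : 0 <= Num.max h 0 by rewrite le_max lexx orbT.
  rewrite exprS; apply: ler_pM => //; rewrite ?exprn_ge0//.
  apply: le_trans he; rewrite exprS -[leRHS]mulr1.
  apply: ler_pM => //; rewrite ?exprn_ge0//.
  by rewrite exprn_ile1// (le_trans hm).
Unshelve. all: by end_near. Qed.

Lemma continuous_pospow m : continuous (pospow m.+1).
Proof.
move=> y.
have c : {for y, continuous (id \max cst (0 : R))}.
  by apply: continuous_max; [exact: cvg_id|exact: cvg_cst].
exact: (continuous_comp c (@exprn_continuous R m.+1 _)).
Qed.

(** A C^1 function vanishing on x <= 1/(n+1) and equal to 1 on 2/(n+1) <= x. *)
Definition cutoff (n : nat) x : R := 1 - pospow 2 (1 - pospow 2 (n.+1%:R * x - 1)).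

Definition dcutoff (n : nat) x : R :=
  4 * n.+1%:R * pospow 1 (1 - pospow 2 (n.+1%:R * x - 1)) * pospow 1 (n.+1%:R * x - 1).

Lemma is_derive_cutoff n x : is_derive x (1 : R) (cutoff n) (dcutoff n x).
Proof.
have d1 : is_derive x (1 : R) (fun x => n.+1%:R * x - 1) n.+1%:R.
  have := is_deriveB (is_deriveZ n.+1%:R (is_derive_id x (1 : R)))
    (is_derive_cst (1 : R) x 1).
  by rewrite subr0 -[_ *: 1]/(_ * 1) mulr1.
have d2 := is_deriveB (is_derive_cst (1 : R) x 1)
  (is_derive1_comp (is_derive_pospow 0 _) d1).
have d3 := is_deriveB (is_derive_cst (1 : R) x 1)
  (is_derive1_comp (is_derive_pospow 0 _) d2).
apply: (is_derive_eq d3); rewrite /dcutoff /= /cst.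
by rewrite -[(cst 1 - _) x]/(1 - pospow 2 (n.+1%:R * x - 1)); ring.
Qed.

Lemma continuous_dcutoff n : continuous (dcutoff n).
Proof.
have c1 : continuous (fun x : R => n.+1%:R * x - 1).
  by move=> x; apply: cvgB; [apply: cvgMr; exact: cvg_id|exact: cvg_cst].
move=> x; apply: cvgM.
  apply: cvgMr.
  apply: (continuous_comp (f := fun x => 1 - pospow 2 (n.+1%:R * x - 1))
    (g := pospow 1)); last exact: continuous_pospow.
  apply: cvgB; first exact: cvg_cst.
  by apply: (continuous_comp (c1 x)); exact: continuous_pospow.
by apply: (continuous_comp (c1 x)); exact: continuous_pospow.
Qed.

Lemma dcutoff_ge0 n x : 0 <= dcutoff n x.
Proof. by rewrite !mulr_ge0 ?pospow_ge0. Qed.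

Lemma cutoff_eq0 n x : x <= n.+1%:R^-1 -> cutoff n x = 0.
Proof.
move=> xn; have h : n.+1%:R * x - 1 <= 0.
  by rewrite subr_le0 -ler_pdivlMl// mulr1.
by rewrite /cutoff (pospow_le0 1 h) subr0 pospow_gt0// expr1n subrr.
Qed.

Lemma cutoff_eq1 n x : 2 * n.+1%:R^-1 <= x -> cutoff n x = 1.
Proof.
move=> xn; rewrite /cutoff (@pospow_le0 1) ?subr0//.
have h : 1 <= n.+1%:R * x - 1.
  by rewrite lerBrDr -ler_pdivrMl// mulrC -[1 + 1]/2.
rewrite subr_le0 pospow_gt0; last by apply: le_trans h.
by rewrite exprn_ege1.
Qed.

Lemma dcutoff_eq0 n x : 2 * n.+1%:R^-1 <= x -> dcutoff n x = 0.
Proof.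
move=> xn; rewrite /dcutoff (@pospow_le0 0) ?mulr0 ?mul0r//.
have h : 1 <= n.+1%:R * x - 1.
  by rewrite lerBrDr -ler_pdivrMl// mulrC -[1 + 1]/2.
rewrite subr_le0 pospow_gt0; last by apply: le_trans h.
by rewrite exprn_ege1.
Qed.

Lemma cutoff_itv n x : 0 <= cutoff n x <= 1.
Proof.
rewrite /cutoff gerBl pospow_ge0 andbT subr_ge0.
rewrite /pospow exprn_ile1 ?le_max ?lexx ?orbT// ge_max ler01 andbT.
by rewrite gerBl exprn_ge0// le_max lexx orbT.
Qed.

(** The weights have mass 1 and live, eventually, where [g] is close to [g c]. *)
Lemma approximate_identity l g c (d : nat -> R -> R) : 0 <= c <= l ->
  {within `[0, l], continuous g} -> (forall n, continuous (d n)) ->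
  (forall n x, 0 <= d n x) ->
  (\forall n \near \oo, \int[mu]_(x in `[0, l]) d n x = 1) ->
  (forall r : R, 0 < r -> \forall n \near \oo, forall x, 0 <= x <= l ->
     r <= `|x - c| -> d n x = 0) ->
  \int[mu]_(x in `[0, l]) (g x * d n x) @[n --> \oo] --> g c.
Proof.
move=> cl cg cd d0 d1 dc.
apply/cvgrPdist_le => e e0.
have /cvgrPdist_le /(_ e e0) : g x @[x --> within `[0, l]%classic (nbhs c)] --> g c.
  by move/subspace_continuousP : cg; apply.
rewrite near_withinE => /nbhs_ballP[r /= r0 gr].
have mI : measurable (`[0, l]%classic : set (measurableTypeR R)).
  exact: measurable_itv.
have cst_int (k : R) n : mu.-integrable `[0, l] (EFin \o (fun x => k * d n x)).
  by apply: continuous_integrable => x; apply: cvgMr; exact: cd.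
have gd_int n : mu.-integrable `[0, l] (EFin \o (fun x => g x * d n x)).
  apply: segment_continuous_integrable => x; apply: cvgM; first exact: cg.
  by apply: continuous_subspaceT; exact: cd.
have d_int n : mu.-integrable `[0, l] (EFin \o (fun x => d n x)).
  exact: continuous_integrable.
near=> n.
have dn1 : \int[mu]_(x in `[0, l]) d n x = 1 by near: n.
have -> : g c = \int[mu]_(x in `[0, l]) (g c * d n x).
  by rewrite RintegralZl// dn1 mulr1.
rewrite -RintegralB//.
apply: (le_trans (le_normr_Rintegral _ _)) => //.
  exact: (integrableB mI (cst_int _ _) (gd_int _)).
have -> : e = \int[mu]_(x in `[0, l]) (e * d n x).
  by rewrite RintegralZl// dn1 mulr1.
apply: le_Rintegral => //.
  by apply: integrable_norm; exact: (integrableB mI (cst_int _ _) (gd_int _)).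
move=> x /=; rewrite in_itv/= => xl.
rewrite -mulrBl normrM (ger0_norm (d0 n x)).
have [xc|xc] := ltP `|x - c| r.
  by rewrite ler_wpM2r//; apply: gr; [rewrite /ball /= distrC|rewrite /= in_itv].
have -> : d n x = 0; last by rewrite !mulr0.
by move: x xl xc; near: n; exact: dc.
Unshelve. all: by end_near. Qed.

End Calculus.

(** * Integration by parts for weak derivatives *)

Section WeakIntegrationByParts.
Context {R : realType}.
Local Notation mu := (@lebesgue_measure R).
Implicit Types (f g h psi : R -> R) (x y a b l : R).

Lemma ae_interior l (P : R -> Prop) : (forall x, 0 < x < l -> P x) ->
  {ae mu, forall x, `[0, l]%classic x -> P x}.
Proof.
move=> HP; exists [set 0; l]; split.
- by apply: measurableU; exact: measurable_set1.
- apply: countable_lebesgue_measure0; apply: finite_set_countable.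
  exact: finite_set2.
move=> x /= /existsNP -[]; rewrite in_itv/= => /andP[x0 xl] nP.
apply: contrapT => /not_orP[/eqP xn0 /eqP xnl]; apply: nP; apply: HP.
by rewrite !lt_neqAle x0 xl xnl eq_sym xn0.
Qed.

Lemma dominated_Rintegral l (f_ : nat -> R -> R) f g :
  (forall n, measurable_fun `[0, l] (f_ n)) -> measurable_fun `[0, l] f ->
  mu.-integrable `[0, l] (EFin \o g) ->
  (forall x, 0 < x < l -> f_ n x @[n --> \oo] --> f x) ->
  (forall n x, 0 < x < l -> `|f_ n x| <= g x) ->
  \int[mu]_(x in `[0, l]) f_ n x @[n --> \oo] --> \int[mu]_(x in `[0, l]) f x.
Proof.
move=> mf_ mf ig cf dom.
have mI : measurable (`[0, l]%classic : set (measurableTypeR R)).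
  exact: measurable_itv.
have h1 n : measurable_fun `[0, l] (EFin \o f_ n) by exact/measurable_EFinP.
have h2 : measurable_fun `[0, l] (EFin \o f) by exact/measurable_EFinP.
have h3 : {ae mu, forall x, `[0, l]%classic x ->
    (EFin \o f_ n) x @[n --> \oo] --> (EFin \o f) x}.
  apply: ae_interior => x xl; apply: cvg_EFin; last exact: cf.
  exact: nearW.
have h4 : {ae mu, forall x (n : nat), `[0, l]%classic x ->
    (`|(EFin \o f_ n) x| <= (EFin \o g) x)%E}.
  have := @ae_interior l (fun x => forall n, `|f_ n x| <= g x)
    (fun x xl n => dom n x xl).
  apply: filterS; first exact: (ae_filter_ringOfSetsType mu).
  move=> x H n xl /=; rewrite lee_fin; exact: H.
have [fi _ lim] := dominated_convergence mI h1 h2 h3 ig h4.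
apply: fine_cvg; rewrite fineK; first exact: lim.
exact: integrable_fin_num.
Qed.

(** Vanishes near 0 and near [l], and equals 1 away from both. *)
Definition bicutoff l n x : R := cutoff n x + cutoff n (l - x) - 1.

Definition dbicutoff l n x : R := dcutoff n x - dcutoff n (l - x).

Lemma is_derive_reflect l x : is_derive x (1 : R) (fun x => l - x) (- 1).
Proof.
have := is_deriveB (is_derive_cst l x (1 : R)) (is_derive_id x (1 : R)).
by rewrite sub0r.
Qed.

Lemma continuous_reflect l : continuous (fun x : R => l - x).
Proof. exact: (derive_continuous (is_derive_reflect l)). Qed.

Lemma is_derive_bicutoff l n x :
  is_derive x (1 : R) (bicutoff l n) (dbicutoff l n x).
Proof.
have d2 := @is_derive1_comp R (cutoff n) (fun x => l - x) x _ _
    (is_derive_cutoff n (l - x)) (is_derive_reflect l x).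
have H : is_derive x (1 : R) (bicutoff l n) _ :=
  is_deriveB (is_deriveD (is_derive_cutoff n x) d2) (is_derive_cst (1 : R) x 1).
by apply: (is_derive_eq H); rewrite subr0 mulrN1.
Qed.

Lemma continuous_dbicutoff l n : continuous (dbicutoff l n).
Proof.
move=> x; apply: cvgB; first exact: continuous_dcutoff.
apply: (continuous_comp (@continuous_reflect l x)); exact: continuous_dcutoff.
Qed.

Lemma near_inv_le (e : R) : 0 < e -> \forall n \near \oo, 2 * n.+1%:R^-1 <= e.
Proof.
move=> e0; have e2 : 0 < e / 2 by rewrite divr_gt0.
have [N _ HN] := near_infty_natSinv_lt (PosNum e2); exists N => // n /= Nn.
have : n.+1%:R^-1 < e / 2 := HN n Nn.
by rewrite ltr_pdivlMr// mulrC => /ltW.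
Qed.

Lemma bicutoff_mid l n x : 2 * n.+1%:R^-1 <= x -> 2 * n.+1%:R^-1 <= l - x ->
  bicutoff l n x = 1.
Proof. by move=> h1 h2; rewrite /bicutoff !cutoff_eq1// addrK. Qed.

Lemma bicutoff_norm l n x : `|bicutoff l n x| <= 1.
Proof.
rewrite /bicutoff; have /andP[? ?] := cutoff_itv n x.
have /andP[? ?] := cutoff_itv n (l - x).
by rewrite ler_norml; apply/andP; split; lra.
Qed.

Lemma integral_bicutoff l h : 0 < l -> mu.-integrable `[0, l] (EFin \o h) ->
  \int[mu]_(x in `[0, l]) (h x * bicutoff l n x) @[n --> \oo] -->
  \int[mu]_(x in `[0, l]) h x.
Proof.
move=> l0 ih; have mh : measurable_fun `[0, l] h.
  by move/integrableP : ih => -[/measurable_EFinP].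
apply: (@dominated_Rintegral _ _ _ (fun x => `|h x|)) => //.
- move=> n; apply: measurable_funM => //; apply: measurable_funTS.
  apply: continuous_measurable_fun.
  exact: (derive_continuous (is_derive_bicutoff l n)).
- exact: (integrable_norm ih).
- move=> x /andP[x0 xl].
  have lx : 0 < l - x by rewrite subr_gt0.
  apply: cvg_near_cst; near=> n; rewrite bicutoff_mid ?mulr1//.
    by near: n; exact: near_inv_le.
  by near: n; exact: near_inv_le.
- move=> n x _; rewrite normrM -[leRHS]mulr1 ler_wpM2l// bicutoff_norm//.
Unshelve. all: by end_near. Qed.

(** Testing the weak derivative against psi cut off near both ends; the
    derivative of the cut-off concentrates at the ends and produces, in the
    limit, the boundary terms. *)
Lemma weak_integration_by_parts l v dv psi psi' : 0 < l -> inH1 l v dv ->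
  {within `[0, l], continuous v} ->
  (forall x, is_derive x (1 : R) psi (psi' x)) -> continuous psi' ->
  \int[mu]_(x in `[0, l]) (v x * psi' x) =
  v l * psi l - v 0 * psi 0 - \int[mu]_(x in `[0, l]) (dv x * psi x).
Proof.
move=> l0 [v2 dv2 weak] cv dpsi cpsi'.
have mI : measurable (`[0, l]%classic : set (measurableTypeR R)).
  exact: measurable_itv.
have cpsi := derive_continuous dpsi.
have w_ f : continuous f -> {within `[0, l], continuous f}.
  exact: continuous_subspaceT.
have psi2 := continuous_square_integrable (w_ _ cpsi).
have psi'2 := continuous_square_integrable (w_ _ cpsi').
have i1 := square_integrable_mul v2 psi'2.
have i2 := square_integrable_mul dv2 psi2.
have cg : {within `[0, l], continuous (fun x => v x * psi x)}.
  by move=> x; apply: cvgM; [exact: cv|exact: (w_ _ cpsi)].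
have cr n : continuous (fun x => dcutoff n (l - x)).
  move=> x; apply: (continuous_comp (@continuous_reflect l x)).
  exact: continuous_dcutoff.
have i3 n : mu.-integrable `[0, l] (EFin \o (fun x => v x * psi x * dcutoff n x)).
  apply: segment_continuous_integrable => x; apply: cvgM; first exact: cg.
  by apply: w_; exact: continuous_dcutoff.
have i4 n : mu.-integrable `[0, l]
    (EFin \o (fun x => v x * psi x * dcutoff n (l - x))).
  apply: segment_continuous_integrable => x; apply: cvgM; first exact: cg.
  exact: (w_ _ (cr n)).
have dcut1 n : 2 * n.+1%:R^-1 <= l ->
    \int[mu]_(x in `[0, l]) dcutoff n x = 1.
  move=> nl; rewrite (Rintegral_derive l0 (@is_derive_cutoff R n)).
    by rewrite cutoff_eq1// cutoff_eq0 ?subr0.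
  exact: continuous_dcutoff.
have dcutr1 n : 2 * n.+1%:R^-1 <= l ->
    \int[mu]_(x in `[0, l]) dcutoff n (l - x) = 1.
  move=> nl.
  have d x : is_derive x (1 : R) (fun x => - cutoff n (l - x)) (dcutoff n (l - x)).
    have H := is_deriveN (@is_derive1_comp R (cutoff n) (fun x => l - x) x _ _
      (is_derive_cutoff n (l - x)) (is_derive_reflect l x)).
    by apply: (is_derive_eq H); rewrite mulrN1 opprK.
  rewrite (Rintegral_derive l0 d (cr n)).
  by rewrite subrr subr0 (cutoff_eq1 nl) cutoff_eq0// oppr0 sub0r opprK.
have L1 : \int[mu]_(x in `[0, l]) (v x * psi x * dcutoff n x) @[n --> \oo]
    --> v 0 * psi 0.
  apply: (@approximate_identity _ l (fun x => v x * psi x) 0) => //.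
  - by rewrite lexx ltW.
  - exact: continuous_dcutoff.
  - exact: dcutoff_ge0.
  - by near=> n; apply: dcut1; near: n; exact: near_inv_le.
  - move=> r r0; near=> n => x /andP[x0 _]; rewrite subr0 ger0_norm// => rx.
    by apply: dcutoff_eq0; apply: le_trans rx; near: n; exact: near_inv_le.
have L2 : \int[mu]_(x in `[0, l]) (v x * psi x * dcutoff n (l - x)) @[n --> \oo]
    --> v l * psi l.
  apply: (@approximate_identity _ l (fun x => v x * psi x) l
    (fun n x => dcutoff n (l - x))) => //.
  - by rewrite lexx ltW.
  - by move=> n x; exact: dcutoff_ge0.
  - by near=> n; apply: dcutr1; near: n; exact: near_inv_le.
  - move=> r r0; near=> n => x /andP[_ xl]; rewrite distrC ger0_norm ?subr_ge0// => rx.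
    by apply: dcutoff_eq0; apply: le_trans rx; near: n; exact: near_inv_le.
have L3 := integral_bicutoff l0 i1.
have L4 := integral_bicutoff l0 i2.
have E : \forall n \near \oo,
    (\int[mu]_(x in `[0, l]) (v x * psi x * dcutoff n x)) -
    (\int[mu]_(x in `[0, l]) (v x * psi x * dcutoff n (l - x))) =
    - (\int[mu]_(x in `[0, l]) (dv x * psi x * bicutoff l n x)) -
    \int[mu]_(x in `[0, l]) (v x * psi' x * bicutoff l n x).
  near=> n.
  have nl : 2 * n.+1%:R^-1 <= l / 2 by near: n; apply: near_inv_le; rewrite divr_gt0.
  have n0 : 0 < n.+1%:R^-1 :> R by rewrite invr_gt0.
  pose phi x := psi x * bicutoff l n x.
  pose dphi x := psi x * dbicutoff l n x + bicutoff l n x * psi' x.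
  have dphiP x : is_derive x (1 : R) phi (dphi x).
    by have := is_deriveM (dpsi x) (is_derive_bicutoff l n x).
  have cbi : continuous (bicutoff l n).
    exact: (derive_continuous (is_derive_bicutoff l n)).
  have cdphi : continuous dphi.
    move=> x; apply: cvgD; apply: cvgM; first exact: cpsi.
    - exact: continuous_dbicutoff.
    - exact: cbi.
    - exact: cpsi'.
  have dphiE : derive1 phi = dphi.
    by apply/funext => x; rewrite derive1E; have [_ ->] := dphiP x.
  have tphi : test_function l phi.
    split; [by move=> x; have [] := dphiP x|by rewrite dphiE|].
    exists n.+1%:R^-1, (l - n.+1%:R^-1); split => //.
      by rewrite gtrBl.
    have key (z : R) : z < n.+1%:R^-1 -> 2 * n.+1%:R^-1 <= l - z.
      by move: nl n0; set N := n.+1%:R^-1 => nl n0 zN; lra.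
    move=> x; rewrite in_itv/= negb_and -!ltNge => /orP[xn|xn].
      rewrite /phi /bicutoff cutoff_eq0 ?ltW// cutoff_eq1 ?add0r ?subrr ?mulr0//.
      exact: key.
    have xn' : l - x < n.+1%:R^-1 by rewrite ltrBlDl -ltrBlDr.
    have := key _ xn'; rewrite subKr => xn2.
    by rewrite /phi /bicutoff cutoff_eq1// cutoff_eq0 ?ltW// addr0 subrr mulr0.
  have W : \int[mu]_(x in `[0, l]) (v x * dphi x) =
      - \int[mu]_(x in `[0, l]) (dv x * phi x).
    by have := weak _ tphi; rewrite dphiE.
  have -> : \int[mu]_(x in `[0, l]) (dv x * psi x * bicutoff l n x) =
      \int[mu]_(x in `[0, l]) (dv x * phi x).
    by apply: eq_Rintegral => x _; rewrite mulrA.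
  rewrite -W.
  have i5 : mu.-integrable `[0, l] (EFin \o (fun x => v x * psi' x * bicutoff l n x)).
    have c2 : square_integrable l (fun x => psi' x * bicutoff l n x).
      by apply: continuous_square_integrable; apply: w_ => x; apply: cvgM;
        [exact: cpsi'|exact: cbi].
    have := square_integrable_mul v2 c2.
    by under [X in EFin \o X]eq_fun do rewrite mulrA.
  rewrite -RintegralB//.
  apply/eqP; rewrite eq_sym subr_eq; apply/eqP.
  rewrite -RintegralD//; last exact: (integrableB mI (i3 n) (i4 n)).
  by apply: eq_Rintegral => x _; rewrite /dphi /dbicutoff; ring.
have R1 : v 0 * psi 0 - v l * psi l =
    - (\int[mu]_(x in `[0, l]) (dv x * psi x)) - \int[mu]_(x in `[0, l]) (v x * psi' x).
  pose F n := (\int[mu]_(x in `[0, l]) (v x * psi x * dcutoff n x)) -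
    (\int[mu]_(x in `[0, l]) (v x * psi x * dcutoff n (l - x))).
  have A1 : F n @[n --> \oo] --> v 0 * psi 0 - v l * psi l by exact: cvgB L1 L2.
  have A2 : F n @[n --> \oo] --> - (\int[mu]_(x in `[0, l]) (dv x * psi x)) -
      (\int[mu]_(x in `[0, l]) (v x * psi' x)).
    apply: cvg_trans (cvgB (cvgN L4) L3); apply: near_eq_cvg.
    by move: E; apply: filterS => n E; rewrite /F E.
  by rewrite -(cvg_lim (@Rhausdorff R) A1) -(cvg_lim (@Rhausdorff R) A2).
by lra.
Unshelve. all: by end_near. Qed.

End WeakIntegrationByParts.

(** * Smooth functions in the domain of the Laplacian *)

Section SmoothDomain.
Context {R : realType}.
Variables (G : metric_graph R) (VD : {set vertex G}).
Local Notation mu := (@lebesgue_measure R).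

Lemma test_function_end l phi : test_function l phi -> phi 0 = 0 /\ phi l = 0 :> R.
Proof.
move=> [_ _ [a [b [a0 bl phi0]]]]; split; apply: phi0; rewrite in_itv/= negb_and -!ltNge.
  by rewrite a0.
by rewrite bl orbT.
Qed.

Lemma smooth_inH1 l (u ux : R -> R) : 0 < l ->
  (forall x, is_derive x (1 : R) u (ux x)) -> continuous ux -> inH1 l u ux.
Proof.
move=> l0 du cux; have cu := derive_continuous du.
have w_ (f : R -> R) : continuous f -> {within `[0, l], continuous f}.
  exact: continuous_subspaceT.
have u2 := continuous_square_integrable (w_ _ cu).
have ux2 := continuous_square_integrable (w_ _ cux).
split=> // phi tphi; have [phi0 phil] := test_function_end tphi.
case: tphi => dphi cphi _.
have dphi' x : is_derive x (1 : R) phi (derive1 phi x).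
  by rewrite derive1E; exact: derivableP.
have cphi0 := derive_continuous dphi'.
have dP x : is_derive x (1 : R) (fun x => u x * phi x)
    (u x * derive1 phi x + ux x * phi x).
  have H : is_derive x (1 : R) (fun x => u x * phi x) _ :=
    is_deriveM (du x) (dphi' x).
  by apply: (is_derive_eq H); congr (_ + _); rewrite mulrC.
have cI (f g : R -> R) : continuous f -> continuous g ->
    mu.-integrable `[0, l] (EFin \o (fun x => f x * g x)).
  move=> cf cg; apply: segment_continuous_integrable; apply: w_ => x.
  by apply: cvgM; [exact: cf|exact: cg].
have := Rintegral_derive l0 dP; rewrite phi0 phil !mulr0 subrr => H.
apply/eqP; rewrite -addr_eq0; apply/eqP; rewrite -[RHS]H.
  by rewrite -RintegralD//; exact: cI.
by move=> x; apply: cvgD; apply: cvgM;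
  [exact: cu|exact: cphi|exact: cux|exact: cphi0].
Qed.

Definition inward_derivative (ux : gfun G) (e : edge G) (b : bool) : R :=
  if b then - ux e (len e) else ux e 0.

Lemma sum_ends (f : edge G -> bool -> R) :
  \sum_(e : edge G) (f e true + f e false) = \sum_(h : edge G * bool) f h.1 h.2.
Proof.
rewrite -(pair_bigA _ (fun e b => f e b)) /=; apply: eq_bigr => e _.
by rewrite big_bool.
Qed.

(** Grouping the ends by the vertex that carries them, the value of [z] factors
    out, and either this value or the sum of the derivatives is 0. *)
Lemma kirchhoff_boundary (z ux : gfun G) :
  (forall e b e' b', ends e b = ends e' b' ->
    z e (end_pos e b) = z e' (end_pos e' b')) ->
  (forall e b, ends e b \in VD -> z e (end_pos e b) = 0) ->
  (forall v, v \notin VD ->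
    \sum_(h : edge G * bool | ends h.1 h.2 == v) inward_derivative ux h.1 h.2 = 0) ->
  \sum_(e : edge G) (z e (len e) * ux e (len e) - z e 0 * ux e 0) = 0.
Proof.
move=> zc z0 K; apply: oppr_inj; rewrite oppr0 -sumrN.
pose f e b := z e (end_pos e b) * inward_derivative ux e b.
rewrite (eq_bigr (fun e => f e true + f e false)); last first.
  by move=> e _; rewrite /f /inward_derivative /=; ring.
rewrite (sum_ends f) (partition_big (fun h => ends h.1 h.2) predT)//=.
apply: big1 => v _; have [vD|vN] := boolP (v \in VD).
  by apply: big1 => -[e b] /= /eqP ev; rewrite /f z0 ?mul0r// ev.
have [e0 [b0 e0v]] := ends_surj v.
rewrite (eq_bigr (fun h => z e0 (end_pos e0 b0) *
  inward_derivative ux h.1 h.2)); last first.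
  by move=> [e b] /= /eqP ev; rewrite /f (zc e b e0 b0)// ev.
by rewrite -mulr_sumr K// mulr0.
Qed.

(** Integration by parts against a function of the form domain leaves boundary
    terms, which [kirchhoff_boundary] cancels. *)
Lemma laplacian_smooth (u ux uxx : gfun G) :
  (forall e x, is_derive x (1 : R) (u e) (ux e x)) ->
  (forall e x, is_derive x (1 : R) (ux e) (uxx e x)) ->
  (forall e, continuous (uxx e)) ->
  (forall e b e' b', ends e b = ends e' b' ->
    u e (end_pos e b) = u e' (end_pos e' b')) ->
  (forall e b, ends e b \in VD -> u e (end_pos e b) = 0) ->
  (forall v, v \notin VD ->
    \sum_(h : edge G * bool | ends h.1 h.2 == v) inward_derivative ux h.1 h.2 = 0) ->
  laplacian VD u uxx.
Proof.
move=> du dux cuxx uc u0 K.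
have cux e : continuous (ux e) by exact: derive_continuous (dux e).
have cu e : continuous (u e) by exact: derive_continuous (du e).
exists u, ux; split.
- by move=> e; apply: aeW.
- split=> // e; last by apply: continuous_subspaceT; exact: cu.
  by apply: smooth_inH1 => //; exact: len_gt0.
move=> z dz [zH zcont zc z0].
have B := kirchhoff_boundary zc z0 K.
rewrite (L2dotC uxx) -[RHS]add0r -B /L2dot /gintegral -sumrB.
apply: eq_bigr => e _.
have E : \int[mu]_(x in `[0, len e]) (z e x * uxx e x) =
  z e (len e) * ux e (len e) - z e 0 * ux e 0 -
  \int[mu]_(x in `[0, len e]) (dz e x * ux e x).
  exact: (weak_integration_by_parts (len_gt0 e) (zH e) (zcont e) (dux e) (cuxx e)).
have E' : \int[mu]_(x in `[0, len e]) (ux e x * dz e x) =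
   z e (len e) * ux e (len e) - z e 0 * ux e 0 -
  \int[mu]_(x in `[0, len e]) (z e x * uxx e x).
  rewrite E subKr; apply: eq_Rintegral => x _; exact: mulrC.
exact: E'.
Qed.

End SmoothDomain.

(** * Splines supported in one edge *)

Section Splines.
Context {R : realType}.
Variable G : metric_graph R.
Local Notation mu := (@lebesgue_measure R).
Implicit Types (f g : R -> R) (p q : {poly R}) (x y a l : R).

Lemma pospowS m y : pospow m.+2 y = y * pospow m.+1 y.
Proof.
have [y0|y0] := leP 0 y; first by rewrite !pospow_gt0// exprS.
by rewrite !pospow_le0 ?mulr0// ltW.
Qed.

(** The functions p q_+^m with p variable form a class stable under derivation,
    each derivative lowering m by 1. *)
Definition spline q p m x : R := p.[x] * pospow m q.[x].

Definition dspline q p m : {poly R} := p^`() * q + m%:R *: (p * q^`()).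

Lemma is_derive_spline q p m x :
  is_derive x (1 : R) (spline q p m.+2) (spline q (dspline q p m.+2) m.+1 x).
Proof.
have d1 := is_derive1_comp (is_derive_pospow m q.[x]) (is_derive_poly q x).
have H : is_derive x (1 : R) (spline q p m.+2) _ := is_deriveM (is_derive_poly p x) d1.
apply: (is_derive_eq H); rewrite /spline /dspline /= pospowS !hornerE.
rewrite -[_ *: (_ * _)]/(_ * (_ * _)) -[_ *: p^`().[x]]/(_ * _) /=.
by ring.
Qed.

Lemma continuous_spline q p m : continuous (spline q p m.+1).
Proof.
move=> x; apply: cvgM; first exact: continuous_horner.
by apply: (continuous_comp (@continuous_horner R q x)); exact: continuous_pospow.
Qed.

Definition single (e0 : edge G) f : gfun G :=
  fun e x => if e == e0 then f x else 0.

Lemma single_L2 e0 f : square_integrable (len e0) f -> L2 (single e0 f).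
Proof.
move=> f2 e; rewrite /single; case: eqP => [->//|_]; exact: square_integrable0.
Qed.

Definition single_fun (e0 : edge G) f (f2 : square_integrable (len e0) f) :
  L2fun G := toL2 (single_L2 f2).

Lemma L2dot_single e0 f (u : gfun G) :
  L2dot (single e0 f) u = \int[mu]_(x in `[0, len e0]) (f x * u e0 x).
Proof.
rewrite /L2dot /gintegral (bigD1 e0)//= big1 ?addr0; last first.
  move=> e ee0; have E : \int[mu]_(x in edge_itv e) (0 : R) = 0.
    by rewrite Rintegral_cst ?mul0r//; exact: measurable_itv.
  rewrite -[RHS]E; apply: eq_Rintegral => x _.
  by rewrite /single (negbTE ee0) mul0r.
by apply: eq_Rintegral => x _; rewrite /single eqxx.
Qed.

Lemma nrm_single e0 f g (f2 : square_integrable (len e0) f)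
    (g2 : square_integrable (len e0) g) :
  nrm (@gdot R G) (single_fun f2 - single_fun g2) =
  Num.sqrt (\int[mu]_(x in `[0, len e0]) (f x - g x) ^+ 2).
Proof.
rewrite /nrm; congr Num.sqrt.
have -> : gdot (single_fun f2 - single_fun g2) (single_fun f2 - single_fun g2) =
    L2dot (single e0 (fun x => f x - g x)) (single e0 (fun x => f x - g x)).
  rewrite /gdot; congr L2dot; apply/funext => e; apply/funext => x;
  by rewrite /= /single !fctE; case: ifP => // _; rewrite subrr.
by rewrite L2dot_single; apply: eq_Rintegral => x _; rewrite /single eqxx expr2.
Qed.

Variable VD : {set vertex G}.

(** The spline and its derivative vanish at both ends of the edge, which makes
    every vertex condition trivial. *)
Lemma single_spline_laplacian e0 q p m : q.[0] <= 0 -> q.[len e0] <= 0 ->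
  laplacian VD (single e0 (spline q p m.+3))
    (single e0 (spline q (dspline q (dspline q p m.+3) m.+2) m.+1)).
Proof.
move=> q0 ql.
have b0 p' k : spline q p' k.+1 0 = 0 by rewrite /spline pospow_le0 ?mulr0.
have bl p' k : spline q p' k.+1 (len e0) = 0 by rewrite /spline pospow_le0 ?mulr0.
have send p' k e b : single e0 (spline q p' k.+1) e (end_pos e b) = 0.
  by rewrite /single; case: eqP => // ->; case: b; rewrite /end_pos ?b0 ?bl.
apply: (@laplacian_smooth _ _ _ _ (single e0 (spline q (dspline q p m.+3) m.+2))).
- move=> e x; rewrite /single; case: eqP => _; first exact: is_derive_spline.
  exact: is_derive_cst.
- move=> e x; rewrite /single; case: eqP => _; first exact: is_derive_spline.
  exact: is_derive_cst.
- move=> e; rewrite /single; case: eqP => _; first exact: continuous_spline.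
  by move=> x; exact: cvg_cst.
- by move=> e b e' b' _; rewrite !send.
- by move=> e b _; rewrite send.
- move=> v _; apply: big1 => -[e b] _ /=; rewrite /inward_derivative.
  have := send (dspline q p m.+3) m.+1 e b; rewrite /end_pos.
  by case: b => ->; rewrite ?oppr0.
Qed.

(** The cofactor of q_+^5 in 1 - (1 - q_+^5)^n; for q <= 1 these functions
    increase to the indicator of 0 < q. *)
Definition plateau q n : {poly R} := \sum_(i < n) (1 - q ^+ 5) ^+ i.

Lemma plateauE q n x :
  spline q (plateau q n) 5 x = 1 - (1 - pospow 5 q.[x]) ^+ n.
Proof.
rewrite /spline; have [q0|q0] := leP 0 q.[x]; last first.
  by rewrite pospow_le0 ?ltW// mulr0 subr0 expr1n subrr.
rewrite pospow_gt0//.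
have E : (plateau q n).[x] = \sum_(i < n) (1 - q.[x] ^+ 5) ^+ i.
  rewrite /plateau horner_sum; apply: eq_bigr => i _.
  by rewrite !hornerE.
rewrite E; have := subrX1 (1 - q.[x] ^+ 5) n; move: (\sum_(i < n) _) => S.
by move=> H; rewrite -[RHS]opprK opprB H; ring.
Qed.

End Splines.

(** * Indicator functions are limits of splines *)

Section Density.
Context {R : realType}.
Variables (G : metric_graph R) (VD : {set vertex G}) (T : R -> gfun G -> gfun G).
Hypothesis hT : heat_semigroup VD T.
Local Notation mu := (@lebesgue_measure R).
Let ip := gdot_inner G.
Let ev := heat_evolution hT.
Implicit Types (f g : R -> R) (p q : {poly R}) (x y a b l : R).

Definition heat_core (u : L2fun G) : Prop :=
  evol_core (dot := @gdot R G) (A := fun u f : L2fun G => laplacian VD u f) u.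

Lemma spline_square_integrable l q p m : square_integrable l (spline q p m.+1).
Proof.
apply: continuous_square_integrable; apply: continuous_subspaceT.
exact: continuous_spline.
Qed.

(** The exponent 5 leaves room for two applications of the Laplacian, each of
    which consumes two derivatives, so that the image of the spline is again in
    the domain. *)
Lemma heat_core_plateau e0 q n : q.[0] <= 0 -> q.[len e0] <= 0 ->
  heat_core (single_fun (spline_square_integrable (len e0) q (plateau q n) 4)).
Proof.
move=> q0 ql e e_gt0.
pose f2 p m := spline_square_integrable (len e0) q p m.
exists (single_fun (f2 (plateau q n) 4%N)).
exists (single_fun (f2 (dspline q (dspline q (plateau q n) 5) 4) 2%N)); split.
- exact: single_spline_laplacian.
- apply: (@gen_closure_gen _ _ _ ip _ _
    (single_fun (f2 (dspline q (dspline q (dspline q (dspline q (plateau q n) 5) 4) 3) 2) 0%N))).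
  exact: single_spline_laplacian.
- by rewrite subrr nrm0// ltW.
Qed.

Lemma heat_core_lim e0 (f_ : nat -> R -> R) f (M : R)
    (f_2 : forall n, square_integrable (len e0) (f_ n))
    (f2 : square_integrable (len e0) f) :
  (forall n x, 0 < x < len e0 -> `|f x - f_ n x| <= M) ->
  (forall x, 0 < x < len e0 -> f_ n x @[n --> \oo] --> f x) ->
  (forall n, heat_core (single_fun (f_2 n))) -> heat_core (single_fun f2).
Proof.
move=> dom cf core; apply: (evol_core_lim ip) => e e0'.
have mfn n : measurable_fun `[0, len e0] (fun x => f x - f_ n x).
  have [mf _] := (square_integrableP _ _).1 f2.
  have [mfn _] := (square_integrableP _ _).1 (f_2 n).
  exact: measurable_funB.
have lim : \int[mu]_(x in `[0, len e0]) (f x - f_ n x) ^+ 2 @[n --> \oo] -->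
    \int[mu]_(x in `[0, len e0]) (0 : R).
  apply: (@dominated_Rintegral _ _ _ _ (fun=> M ^+ 2)) => //.
  - by move=> n; apply: measurable_funX.
  - by apply: continuous_integrable => x; exact: cvg_cst.
  - move=> x xl; rewrite (_ : (fun n => _) = (fun n => (f x - f_ n x) * (f x - f_ n x))).
      rewrite -[X in _ --> X](mulr0 (0 : R)).
      have H : f x - f_ n x @[n --> \oo] --> (0 : R).
        by rewrite -(subrr (f x)); apply: cvgB; [exact: cvg_cst|exact: cf].
      exact: (cvgM H H).
    by apply/funext => n; rewrite expr2.
  - move=> n x xl; have := dom n x xl; rewrite normrX => H.
    by rewrite ler_pXn2r// nnegrE// (le_trans _ H).
rewrite Rintegral_cst ?mul0r in lim; last exact: measurable_itv.
have [N _ HN] := (cvgr0Pnorm_le _).1 lim (e ^+ 2) (exprn_gt0 2 e0').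
exists (single_fun (f_2 N)); first exact: core.
rewrite nrm_single; have -> : e = Num.sqrt (e ^+ 2).
  by rewrite sqrtr_sqr ger0_norm// ltW.
apply: ler_wsqrtr.
by have := HN N (leqnn N); apply: le_trans; exact: ler_norm.
Qed.

Lemma heat_core_eq e0 f g (f2 : square_integrable (len e0) f)
    (g2 : square_integrable (len e0) g) :
  (forall x, 0 < x < len e0 -> f x = g x) ->
  heat_core (single_fun f2) -> heat_core (single_fun g2).
Proof.
move=> fg cf; apply: (@heat_core_lim _ (fun=> f) _ 0 (fun=> f2)) => //.
- by move=> _ x /fg ->; rewrite subrr normr0.
- by move=> x /fg ->; exact: cvg_cst.
Qed.

Lemma indic_square_integrable l (A : set R) :
  measurable (A : set (measurableTypeR R)) -> square_integrable l \1_A.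
Proof.
move=> mA; apply: (@square_integrable_bounded _ _ _ 1).
  exact: measurable_indic.
by move=> x _; rewrite indicE; case: (x \in A); rewrite ?normr1 ?normr0.
Qed.

(** A parabola positive exactly on ]a, b[ and at most 1 gives plateaus that
    converge to the indicator function boundedly. *)
Lemma heat_core_interval e0 a b (h2 : square_integrable (len e0) \1_`]a, b[) :
  0 <= a -> a < b -> b <= len e0 -> heat_core (single_fun h2).
Proof.
move=> a0 ab bl.
pose c := (b - a)^-1 ^+ 2.
have c0 : 0 < c by rewrite exprn_gt0// invr_gt0 subr_gt0.
pose q : {poly R} := c *: (('X - a%:P) * (b%:P - 'X)).
have qE x : q.[x] = c * ((x - a) * (b - x)) by rewrite /q !hornerE.
have q0 : q.[0] <= 0.
  by rewrite qE pmulr_rle0// mulr_le0_ge0 ?subr_le0 ?subr0 ?(le_trans a0)// ltW.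
have ql : q.[len e0] <= 0.
  rewrite qE pmulr_rle0// mulr_ge0_le0 ?subr_le0 ?subr_ge0//.
  by rewrite (le_trans _ bl)// ltW.
have q1 x : q.[x] <= 1.
  rewrite qE /c exprVn ler_pdivrMl ?exprn_gt0 ?subr_gt0// mulr1.
  by have := sqr_ge0 (x - a); have := sqr_ge0 (b - x); nra.
pose z x := pospow 5 q.[x].
have z01 x : 0 <= 1 - z x <= 1.
  rewrite gerBl pospow_ge0 andbT subr_ge0 /z /pospow exprn_ile1//.
    by rewrite le_max lexx orbT.
  by rewrite ge_max q1 ler01.
have P01 n x : 0 <= spline q (plateau q n) 5 x <= 1.
  have /andP[z0 z1] := z01 x.
  rewrite plateauE gerBl exprn_ge0// andbT subr_ge0.
  by rewrite exprn_ile1.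
apply: (@heat_core_lim _ (fun n => spline q (plateau q n) 5) _ 1
  (fun n => spline_square_integrable _ _ _ _)).
- move=> n x _; rewrite indicE; have /andP[? ?] := P01 n x.
  by case: (x \in _); rewrite ler_norml; apply/andP; split; rewrite /=; lra.
- move=> x _; rewrite (_ : (fun n => _) = (fun n => 1 - (1 - z x) ^+ n)); last first.
    by apply/funext => n; rewrite plateauE.
  rewrite indicE; have [xab|xab] := boolP (x \in `]a, b[%classic).
    have zp : 0 < z x.
      have qp : 0 < q.[x].
        move: xab; rewrite inE/= in_itv/= => /andP[ax xb].
        by rewrite qE mulr_gt0// mulr_gt0// subr_gt0.
      by rewrite /z pospow_gt0 ?ltW// exprn_gt0.
    rewrite -[X in _ --> X](subr0 1); apply: cvgB; first exact: cvg_cst.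
    apply: cvg_expr; have /andP[z0 _] := z01 x; rewrite ger0_norm//.
    by rewrite gtrBl.
  have -> : z x = 0.
    rewrite /z pospow_le0// qE pmulr_rle0//.
    move: xab; rewrite notin_setE/= in_itv/= => /negP.
    rewrite negb_and -!leNgt => /orP[xa|bx].
      by rewrite mulr_le0_ge0 ?subr_le0 ?subr_ge0// (le_trans xa)// ltW.
    by rewrite mulr_ge0_le0 ?subr_le0 ?subr_ge0// (le_trans _ bx)// ltW.
  under eq_fun do rewrite subr0 expr1n subrr.
  exact: cvg_cst.
- by move=> n; exact: heat_core_plateau.
Qed.

Lemma heat_core0 e0 (z2 : square_integrable (len e0) (fun=> 0 : R)) :
  heat_core (single_fun z2).
Proof.
apply: (@heat_core_eq _ _ _ (spline_square_integrable (len e0) 0 (plateau 0 0) 4)).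
  by move=> x _; rewrite plateauE expr0 subrr.
by apply: heat_core_plateau; rewrite horner0.
Qed.

Lemma heat_core_ray e0 a (h2 : square_integrable (len e0) \1_`]a, +oo[) :
  heat_core (single_fun h2).
Proof.
pose a' := Num.max a 0.
have [al|la] := ltP a' (len e0).
  have m : measurable (`]a', len e0[%classic : set (measurableTypeR R)).
    exact: measurable_itv.
  apply: (@heat_core_eq _ _ _ (indic_square_integrable (len e0) m)).
    move=> x /andP[x0 xl]; rewrite !indicE; congr (_%:R); congr nat_of_bool.
    by apply/idP/idP; rewrite !inE/= !in_itv/= andbT gt_max x0 xl !andbT.
  apply: heat_core_interval => //.
  by rewrite le_max lexx orbT.
have z2 := square_integrable0 (len e0).
apply: (@heat_core_eq _ _ _ z2) => [x /andP[x0 xl]|]; last exact: heat_core0.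
rewrite indicE memNset//= in_itv/= andbT => ax; move: la.
rewrite leNgt => /negP; apply; rewrite gt_max (lt_trans ax xl).
exact: len_gt0.
Qed.

Lemma heat_core_linear e0 a f g h (f2 : square_integrable (len e0) f)
    (g2 : square_integrable (len e0) g) (h2 : square_integrable (len e0) h) :
  (forall x, h x = a * f x + g x) ->
  heat_core (single_fun f2) -> heat_core (single_fun g2) ->
  heat_core (single_fun h2).
Proof.
move=> hE cf cg; rewrite /heat_core.
have -> : single_fun h2 = a *: single_fun f2 + single_fun g2.
  apply/val_inj; apply/funext => e; apply/funext => x /=.
  rewrite !fctE /single; case: eqP => _; first exact: hE.
  by rewrite addr0; exact/esym/mulr0.
exact: (@evol_core_linear _ _ _ ip _ _ ev a _ _ cf cg).
Qed.

(** The sets whose indicator function is in the core form a Dynkin system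
    containing the rays, which generate the Borel sets. *)
Lemma heat_core_indic e0 (A : set R) (mA : measurable (A : set (measurableTypeR R))) :
  heat_core (single_fun (indic_square_integrable (len e0) mA)).
Proof.
pose P (B : set (measurableTypeR R)) := forall mB : measurable B,
  heat_core (single_fun (indic_square_integrable (len e0) mB)).
suff : P A by apply.
have mE : @measurable _ (measurableTypeR R) = <<s @RGenOInfty.G R >>.
  exact: RGenOInfty.measurableE.
have PT : P setT.
  move=> mT; have m : measurable (`](-1), +oo[%classic : set (measurableTypeR R)).
    exact: measurable_itv.
  apply: (@heat_core_eq _ _ _ (indic_square_integrable (len e0) m)).
    move=> x /andP[x0 _]; rewrite !indicE !mem_set//= in_itv/= andbT.
    by rewrite (lt_trans _ x0).
  exact: heat_core_ray.
apply: (dynkin_induction (G := @RGenOInfty.G R) (P := P)) => //.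
- move=> B C [a ->] [b ->]; exists (Num.max a b).
  by apply/seteqP; split=> x /=; rewrite !in_itv/= !andbT gt_max => /andP.
- by move=> _ [a ->] mB; exact: heat_core_ray.
- move=> B mB PB mCB.
  have mT : measurable (setT : set (measurableTypeR R)) by exact: measurableT.
  apply: (@heat_core_linear e0 (-1) _ _ _ _ _ _ _ (PB mB) (PT mT)) => x.
  rewrite !indicE in_setC in_setT.
  by case: (x \in B); rewrite /= mulN1r ?addNr ?oppr0 ?add0r.
- move=> F mF tF PF mU.
  pose S n : set R := \big[setU/set0]_(k < n) F k.
  have mS n : measurable (S n : set (measurableTypeR R)).
    by apply: bigsetU_measurable => k _; exact: mF.
  apply: (@heat_core_lim _ (fun n => \1_(S n)) _ 1
    (fun n => indic_square_integrable _ (mS n))).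
  + move=> n x _; rewrite !indicE.
    by do 2 case: (x \in _); rewrite ?subrr ?subr0 ?sub0r ?normrN ?normr1 ?normr0.
  + move=> x _; rewrite indicE; have [xF|xF] := boolP (x \in _).
      move: xF; rewrite inE => -[k _ Fkx].
      apply: cvg_near_cst; exists k.+1 => // n /= kn.
      rewrite indicE mem_set// /S -bigcup_mkord; exists k => //.
    apply: cvg_near_cst; near=> n.
    rewrite indicE memNset// /S -bigcup_mkord => -[k _ Fkx].
    by move: xF; rewrite notin_setE; apply; exists k.
  + elim=> [|n IH].
      have z2 := square_integrable0 (len e0).
      apply: (@heat_core_eq _ _ _ z2) => [x _|]; last exact: heat_core0.
      by rewrite indicE /S big_ord0 memNset.
    apply: (@heat_core_linear e0 1 _ _ _ _ _ _ _ (PF n (mF n)) IH) => x.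
    rewrite mul1r !indicE /S big_ord_recr/= in_setU.
    have [xS|xS] := boolP (x \in \big[setU/set0]_(k < n) F k); last by rewrite addr0.
    rewrite /= memNset ?add0r// => Fnx; move: xS.
    rewrite inE -bigcup_mkord => -[k /= kn Fkx].
    have kE : k = n by apply: (tF k n I I); exists x.
    by rewrite kE ltnn in kn.
- by rewrite -mE.
Unshelve. all: by end_near. Qed.

End Density.

(** * Kernels with equal integrals over rectangles *)

(** The kernels are integrable along almost every section, which does not make
    them integrable on the product.  Fubini's theorem is therefore applied on
    the rectangles [A_ n `*` B_ n] made of points whose sections have norm at
    most n; they exhaust almost all of [D1 `*` D2]. *)
Section KernelSymmetry.
Local Open Scope ereal_scope.
Context d1 d2 (T1 : measurableType d1) (T2 : measurableType d2) (R : realType).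
Variable m1 : {sigma_finite_measure set T1 -> \bar R}.
Variable m2 : {sigma_finite_measure set T2 -> \bar R}.
Variables (D1 : set T1) (D2 : set T2).
Hypotheses (mD1 : measurable D1) (mD2 : measurable D2).
Hypotheses (D1oo : m1 D1 < +oo) (D2oo : m2 D2 < +oo).
Variables k1 k2 : T1 * T2 -> \bar R.
Hypotheses (mk1 : measurable_fun setT k1) (mk2 : measurable_fun setT k2).
Hypotheses (fk1 : forall z, k1 z \is a fin_num) (fk2 : forall z, k2 z \is a fin_num).
Hypothesis k10 : forall z, ~ (D1 `*` D2) z -> k1 z = 0.
Hypothesis k20 : forall z, ~ (D1 `*` D2) z -> k2 z = 0.
Hypothesis ik1 : {ae m1, forall x, m2.-integrable setT (fun y => k1 (x, y))}.
Hypothesis ik2 : {ae m2, forall y, m1.-integrable setT (fun x => k2 (x, y))}.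
Hypothesis k12 : forall A B, measurable A -> measurable B ->
  A `<=` D1 -> B `<=` D2 ->
  \int[m1]_(x in A) \int[m2]_(y in B) k1 (x, y) =
  \int[m2]_(y in B) \int[m1]_(x in A) k2 (x, y).

Let subX (A A' : set T1) (B B' : set T2) : A `<=` A' -> B `<=` B' ->
  A `*` B `<=` A' `*` B'.
Proof. by move=> AA BB [x y] [/= ? ?]; split; [exact: AA|exact: BB]. Qed.

Let F1 x := \int[m2]_y `|k1 (x, y)|.
Let F2 y := \int[m1]_x `|k2 (x, y)|.

Let mF1 : measurable_fun setT F1.
Proof.
apply: (@measurable_fun_fubini_tonelli_F _ _ _ _ _ m2 (abse \o k1)) => //=.
exact: measurableT_comp.
Qed.

Let mF2 : measurable_fun setT F2.
Proof.
apply: (@measurable_fun_fubini_tonelli_G _ _ _ _ _ m1 (abse \o k2)) => //=.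
exact: measurableT_comp.
Qed.

Let A_ (n : nat) := D1 `&` [set x | F1 x <= n%:R%:E].
Let B_ (n : nat) := D2 `&` [set y | F2 y <= n%:R%:E].

Let mA n : measurable (A_ n).
Proof.
apply: measurableI => //; rewrite -[X in measurable X]setTI.
exact: emeasurable_fun_le.
Qed.

Let mB n : measurable (B_ n).
Proof.
apply: measurableI => //; rewrite -[X in measurable X]setTI.
exact: emeasurable_fun_le.
Qed.

Let ik1C n : (m1 \x m2).-integrable (A_ n `*` B_ n) k1.
Proof.
rewrite -[A_ n `*` B_ n]setTI.
have mC : measurable (A_ n `*` B_ n) by exact: measurableX.
apply: (integrable_restrict _ mC measurableT _).2.
apply/integrable12ltyP; first exact: (measurable_restrictT _ mC).1 (measurable_funTS mk1).
apply: (@le_lt_trans _ _ (\int[m1]_(x in A_ n) n%:R%:E)).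
  rewrite [leRHS]integral_mkcond; apply: ge0_le_integral => //.
  - by move=> x _; apply: integral_ge0.
  - apply: (@measurable_fun_fubini_tonelli_F _ _ _ _ _ m2
      (abse \o (k1 \_ (A_ n `*` B_ n)))) => //=.
    apply: measurableT_comp => //.
    exact: (measurable_restrictT _ mC).1 (measurable_funTS mk1).
  - by apply/(measurable_restrictT _ (mA n)); exact: measurable_cst.
  move=> x _; rewrite patchE; case: ifPn => [|xA].
    rewrite inE => -[D1x F1x]; apply: le_trans F1x.
    apply: ge0_le_integral => //.
    - apply: measurableT_comp => //; apply: measurableT_comp => //.
      exact: (measurable_restrictT _ mC).1 (measurable_funTS mk1).
    - apply: measurableT_comp => //; exact: measurableT_comp.
    by move=> y _; rewrite patchE; case: ifPn => // _; rewrite abse0.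
  rewrite integral0_eq// => y _; rewrite patchE memNset ?abse0// => -[/= Ax _].
  by move: xA; rewrite notin_setE; apply.
rewrite integral_cst//; apply: lte_mul_pinfty => //.
apply: le_lt_trans D1oo; apply: le_measure; rewrite ?inE//.
exact: subIsetl.
Qed.

Let ik2C n : (m1 \x m2).-integrable (A_ n `*` B_ n) k2.
Proof.
rewrite -[A_ n `*` B_ n]setTI.
have mC : measurable (A_ n `*` B_ n) by exact: measurableX.
apply: (integrable_restrict _ mC measurableT _).2.
apply/integrable21ltyP; first exact: (measurable_restrictT _ mC).1 (measurable_funTS mk2).
apply: (@le_lt_trans _ _ (\int[m2]_(x in B_ n) n%:R%:E)).
  rewrite [leRHS]integral_mkcond; apply: ge0_le_integral => //.
  - by move=> x _; apply: integral_ge0.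
  - apply: (@measurable_fun_fubini_tonelli_G _ _ _ _ _ m1
      (abse \o (k2 \_ (A_ n `*` B_ n)))) => //=.
    apply: measurableT_comp => //.
    exact: (measurable_restrictT _ mC).1 (measurable_funTS mk2).
  - by apply/(measurable_restrictT _ (mB n)); exact: measurable_cst.
  move=> y _; rewrite patchE; case: ifPn => [|yB].
    rewrite inE => -[D2y F2y]; apply: le_trans F2y.
    apply: ge0_le_integral => //.
    - apply: measurableT_comp => //; apply: measurableT_comp => //.
      exact: (measurable_restrictT _ mC).1 (measurable_funTS mk2).
    - apply: measurableT_comp => //; exact: measurableT_comp.
    by move=> x _; rewrite patchE; case: ifPn => // _; rewrite abse0.
  rewrite integral0_eq// => x _; rewrite patchE memNset ?abse0// => -[/= _ By].
  by move: yB; rewrite notin_setE; apply.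
rewrite integral_cst//; apply: lte_mul_pinfty => //.
apply: le_lt_trans D2oo; apply: le_measure; rewrite ?inE//.
exact: subIsetl.
Qed.

Let integral_rectangle1 n A B : measurable A -> measurable B ->
  A `<=` A_ n -> B `<=` B_ n ->
  \int[m1 \x m2]_(z in A `*` B) k1 z =
  \int[m1]_(x in A) \int[m2]_(y in B) k1 (x, y).
Proof.
move=> mA' mB' AA BB; have mAB : measurable (A `*` B) by exact: measurableX.
have mC : measurable (A_ n `*` B_ n) by exact: measurableX.
have i1 : (m1 \x m2).-integrable setT (k1 \_ (A `*` B)).
  apply: (integrable_restrict _ mAB measurableT _).1; rewrite setTI.
  by apply: integrableS (ik1C n) => //; exact: subX.
rewrite integral_mkcond -(integral12_prod_meas1 i1) [RHS]integral_mkcond.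
apply: eq_integral => x _; rewrite patchE; case: ifPn => xA.
  rewrite /fubini_F [RHS]integral_mkcond; apply: eq_integral => y _.
  rewrite !patchE; move: xA; rewrite inE => xA; congr (if _ then _ else _).
  by apply/idP/idP; rewrite !inE => // -[].
apply: integral0_eq => y _; rewrite patchE memNset// => -[/= xA' _].
by move: xA; rewrite notin_setE; apply.
Qed.

Let integral_rectangle2 n A B : measurable A -> measurable B ->
  A `<=` A_ n -> B `<=` B_ n ->
  \int[m1 \x m2]_(z in A `*` B) k2 z =
  \int[m2]_(y in B) \int[m1]_(x in A) k2 (x, y).
Proof.
move=> mA' mB' AA BB; have mAB : measurable (A `*` B) by exact: measurableX.
have mC : measurable (A_ n `*` B_ n) by exact: measurableX.
have i1 : (m1 \x m2).-integrable setT (k2 \_ (A `*` B)).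
  apply: (integrable_restrict _ mAB measurableT _).1; rewrite setTI.
  by apply: integrableS (ik2C n) => //; exact: subX.
rewrite integral_mkcond -(integral21_prod_meas1 i1) [RHS]integral_mkcond.
apply: eq_integral => y _; rewrite patchE; case: ifPn => yB.
  rewrite /fubini_G [RHS]integral_mkcond; apply: eq_integral => x _.
  rewrite !patchE; move: yB; rewrite inE => yB; congr (if _ then _ else _).
  by apply/idP/idP; rewrite !inE => // -[].
apply: integral0_eq => x _; rewrite patchE memNset// => -[/= _ yB'].
by move: yB; rewrite notin_setE; apply.
Qed.

Let h z := k1 z - k2 z.

Let mh : measurable_fun setT h. Proof. exact: emeasurable_funB. Qed.

Let ihC n : (m1 \x m2).-integrable (A_ n `*` B_ n) h.
Proof. by apply: integrableB => //; exact: measurableX. Qed.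

(** A Dynkin argument extends the hypothesis from rectangles to measurable
    sets. *)
Let integral_h n E : measurable E -> \int[m1 \x m2]_(z in E `&` (A_ n `*` B_ n)) h z = 0.
Proof.
have mC : measurable (A_ n `*` B_ n) by exact: measurableX.
have rect A B : measurable A -> measurable B ->
    \int[m1 \x m2]_(z in (A `*` B) `&` (A_ n `*` B_ n)) h z = 0.
  move=> mA' mB'; rewrite -setXI.
  have mA1 : measurable (A `&` A_ n) by exact: measurableI.
  have mB1 : measurable (B `&` B_ n) by exact: measurableI.
  have mAB : measurable ((A `&` A_ n) `*` (B `&` B_ n)) by exact: measurableX.
  have sub : (A `&` A_ n) `*` (B `&` B_ n) `<=` A_ n `*` B_ n.
    by apply: subX; exact: subIsetr.
  have i1 : (m1 \x m2).-integrable ((A `&` A_ n) `*` (B `&` B_ n)) k1.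
    exact: integrableS (ik1C n).
  have i2 : (m1 \x m2).-integrable ((A `&` A_ n) `*` (B `&` B_ n)) k2.
    exact: integrableS (ik2C n).
  have R1 := integral_rectangle1 mA1 mB1 (@subIsetr _ _ _) (@subIsetr _ _ _).
  have R2 := integral_rectangle2 mA1 mB1 (@subIsetr _ _ _) (@subIsetr _ _ _).
  rewrite integralB// R1 R2 -k12//; [|by move=> x [_ []]|by move=> x [_ []]].
  by rewrite subee// -R1; exact: integrable_fin_num.
rewrite measurable_prod_measurableType.
apply: (dynkin_induction (P := fun E =>
  \int[m1 \x m2]_(z in E `&` (A_ n `*` B_ n)) h z = 0)).
- exact: measurable_prod_measurableType.
- move=> _ _ [A mA' [B mB' <-]] [A' mA'' [B' mB'' <-]].
  by exists (A `&` A'); [exact: measurableI|exists (B `&` B');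
    [exact: measurableI|rewrite setXI]].
- by rewrite -setXTT; apply: rect.
- by move=> _ [A mA' [B mB' <-]]; exact: rect.
- move=> E' mE' PE'.
  have iC : \int[m1 \x m2]_(z in A_ n `*` B_ n) h z = 0.
    by rewrite -[A_ n `*` B_ n]setTI -setXTT; exact: rect.
  have mE1 : measurable (E' `&` (A_ n `*` B_ n)) by exact: measurableI.
  have mE2 : measurable (~` E' `&` (A_ n `*` B_ n)).
    by apply: measurableI => //; exact: measurableC.
  have := @integral_setU _ _ _ (m1 \x m2) _ _ h mE1 mE2.
  rewrite -setIUl setUv setTI iC PE' add0e => <- //.
  + exact: measurable_funTS.
  + by rewrite disj_set2E setIACA setICr !set0I.
- move=> F mF tF PF; rewrite setI_bigcupl integral_bigcup.
  + by rewrite eseries0.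
  + exact: trivIset_setIr.
  + by move=> k; exact: measurableI.
  apply: integrableS (ihC n) => //.
    by apply: bigcupT_measurable => k; exact: measurableI.
  by apply: bigcup_sub => k _; exact: subIsetr.
Qed.

(** On every [A_ n `*` B_ n] the difference of the kernels has integral 0 over
    all measurable subsets. *)
Lemma kernel_ae_eq : {ae m2, forall y, {ae m1, forall x, k1 (x, y) = k2 (x, y)}}.
Proof.
have step n : {ae m2, forall y, {ae m1, forall x,
    (h \_ (A_ n `*` B_ n)) (x, y) = 0}}.
  have mC : measurable (A_ n `*` B_ n) by exact: measurableX.
  have mhC : measurable_fun setT (h \_ (A_ n `*` B_ n)).
    exact: (measurable_restrictT _ mC).1 (measurable_funTS mh).
  have h0 : ae_eq (m1 \x m2) (A_ n `*` B_ n) h (cst 0).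
    apply: (integral_ae_eq mC (ihC n)) => [|E EC mE].
      exact: measurable_cst.
    rewrite integral0 -(@integral_h n E mE); congr integral.
    by rewrite setIidl.
  have : \int[m1 \x m2]_(z in A_ n `*` B_ n) `|h z| = 0.
    by apply/ae_eq_integral_abs => //; exact: measurable_funTS.
  rewrite integral_mkcond.
  have -> : (fun z => `|h z|) \_ (A_ n `*` B_ n) =
      abse \o (h \_ (A_ n `*` B_ n)).
    by apply/funext => z; rewrite /= !patchE; case: ifP => // _; rewrite abse0.
  have mah : measurable_fun setT (abse \o (h \_ (A_ n `*` B_ n))).
    exact: measurableT_comp.
  rewrite fubini_tonelli2//; last by move=> z; exact: abse_ge0.
  move=> H.
  have mG : measurable_fun setT (fubini_G m1 (abse \o (h \_ (A_ n `*` B_ n)))).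
    by apply: measurable_fun_fubini_tonelli_G => //= z; exact: abse_ge0.
  have : ae_eq m2 setT (fubini_G m1 (abse \o (h \_ (A_ n `*` B_ n)))) (cst 0).
    apply/ae_eq_integral_abs => //; rewrite -[RHS]H.
    apply: eq_integral => y _; rewrite gee0_abs//.
    by apply: integral_ge0 => x _; exact: abse_ge0.
  apply: filterS => y /= /(_ I) Hy.
  have : ae_eq m1 setT (fun x => (h \_ (A_ n `*` B_ n)) (x, y)) (cst 0).
    apply/ae_eq_integral_abs => //.
    by apply: measurableT_comp => //; exact: pair2_measurable.
  by apply: filterS => x /= /(_ I).
have stepA : {ae m2, forall y, forall n, {ae m1, forall x,
    (h \_ (A_ n `*` B_ n)) (x, y) = 0}} by exact: ae_foralln.
move: stepA ik2; apply: filterS2 => y Hy iy.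
have Hy' : {ae m1, forall x, forall n, (h \_ (A_ n `*` B_ n)) (x, y) = 0}.
  exact: ae_foralln.
move: Hy' ik1; apply: filterS2 => x Hx ix.
have [[D1x D2y]|nD] := pselect ((D1 `*` D2) (x, y)); last by rewrite k10// k20.
have f1 : F1 x < +oo by move/integrableP : ix => [].
have f2 : F2 y < +oo by move/integrableP : iy => [].
have p1 : 0 <= F1 x by exact: integral_ge0.
have p2 : 0 <= F2 y by exact: integral_ge0.
pose n := maxn (Num.truncn (fine (F1 x))).+1 (Num.truncn (fine (F2 y))).+1.
have n1 : F1 x <= n%:R%:E.
  rewrite -[F1 x]fineK ?ge0_fin_numE// lee_fin ltW//.
  apply: (lt_le_trans (truncnS_gt _)); rewrite ler_nat leq_maxl//.
have n2 : F2 y <= n%:R%:E.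
  rewrite -[F2 y]fineK ?ge0_fin_numE// lee_fin ltW//.
  apply: (lt_le_trans (truncnS_gt _)); rewrite ler_nat leq_maxr//.
have := Hx n; rewrite patchE mem_set; last by split.
rewrite /h -(fineK (fk1 (x, y))) -(fineK (fk2 (x, y))) -EFinB => -[/eqP].
by rewrite subr_eq0 => /eqP ->.
Qed.

Lemma kernel_section_integral :
  {ae m2, forall y, \int[m1]_x k1 (x, y) = \int[m1]_x k2 (x, y)}.
Proof.
move: kernel_ae_eq; apply: filterS => y Hy; apply: ae_eq_integral => //.
- by apply: measurableT_comp => //; exact: pair2_measurable.
- by apply: measurableT_comp => //; exact: pair2_measurable.
- by move: Hy; apply: filterS => x.
Qed.

End KernelSymmetry.

(** * The heat content as the integral of the solution started from 1 *)

(** Fubini-Tonelli for the positive and the negative part separately. *)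
Lemma measurable_section_integral d1 d2 (T1 : measurableType d1)
    (T2 : measurableType d2) (R : realType)
    (m2 : {sigma_finite_measure set T2 -> \bar R}) (k : T1 * T2 -> \bar R) :
  measurable_fun setT k -> measurable_fun setT (fun x => (\int[m2]_y k (x, y))%E).
Proof.
move=> mk.
rewrite (_ : (fun x => _) = (fun x => (\int[m2]_y (k^\+ (x, y))
  - \int[m2]_y (k^\- (x, y)))%E)).
  apply: emeasurable_funB.
    by apply: (@measurable_fun_fubini_tonelli_F _ _ _ _ _ m2 k^\+%E);
      [exact: measurable_funepos|move=> z; exact: funepos_ge0].
  by apply: (@measurable_fun_fubini_tonelli_F _ _ _ _ _ m2 k^\-%E);
    [exact: measurable_funeneg|move=> z; exact: funeneg_ge0].
apply/funext => x; rewrite integralE.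
by congr (_ - _)%E; apply: eq_integral => y _; rewrite ?funeposE ?funenegE.
Qed.

Lemma ae_imply (R : realType) (P Q : R -> Prop) : (forall x, P x -> Q x) ->
  {ae @lebesgue_measure R, forall x, P x} -> {ae @lebesgue_measure R, forall x, Q x}.
Proof.
move=> PQ; apply: filterS => //.
exact: (ae_filter_ringOfSetsType (@lebesgue_measure R)).
Qed.

Lemma ae_imply2 (R : realType) (P1 P2 Q : R -> Prop) :
  (forall x, P1 x -> P2 x -> Q x) ->
  {ae @lebesgue_measure R, forall x, P1 x} ->
  {ae @lebesgue_measure R, forall x, P2 x} ->
  {ae @lebesgue_measure R, forall x, Q x}.
Proof.
move=> PQ; apply: filterS2 => //.
exact: (ae_filter_ringOfSetsType (@lebesgue_measure R)).
Qed.

Section KernelTotal.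
Context {R : realType}.
Variables (G : metric_graph R) (VD : {set vertex G}) (T : R -> gfun G -> gfun G).
Hypothesis hT : heat_semigroup VD T.
Local Notation mu := (@lebesgue_measure R).
Local Notation RT := (measurableTypeR R).

Lemma heat_sym_indic (t : R) (e f : edge G) (A B : set R)
    (mA : measurable (A : set RT)) (mB : measurable (B : set RT)) : 0 <= t ->
  L2dot (single e \1_A) (T t (single f \1_B)) =
  L2dot (single f \1_B) (T t (single e \1_A)).
Proof.
move=> t0.
have cA := heat_core_indic hT e mA; have cB := heat_core_indic hT f mB.
have := evol_sym (gdot_inner G) (heat_evolution hT) t0 cA cB.
rewrite /gdot L2dotC => H; rewrite [LHS]L2dotC.
have E (u : L2fun G) : L2evol T t u = T t u :> gfun G.
  exact: (L2evolE hT).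
by move: H; rewrite !E /= => ->; exact: L2dotC.
Qed.

Variables (t : R) (K : gkernel G).
Hypotheses (t0 : 0 <= t) (hK : integral_kernel (T t) K).

Let I (e : edge G) : set RT := edge_itv e.

Let mI e : measurable (I e). Proof. exact: measurable_itv. Qed.

Let k_ e f : RT * RT -> \bar R := (fun z => (K e z.1 f z.2)%:E) \_ (I e `*` I f).

Let mk e f : measurable_fun setT (k_ e f).
Proof.
apply/(measurable_restrictT _ (measurableX (mI e) (mI f))).
by apply/measurable_EFinP; exact: (hK.1 e f).
Qed.

Let single_L2_indic e (A : set R) (mA : measurable (A : set RT)) :
  @L2 R G (single e \1_A).
Proof. by apply: single_L2; exact: indic_square_integrable. Qed.

(** The integral of the kernel over A x B is the pairing of the indicator of A
    with the image of the indicator of B, so that the symmetry of the semigroup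
    on indicator functions is the hypothesis of [kernel_section_integral]. *)
Let kernel_pairing e f (A B : set RT) : measurable A -> measurable B ->
  A `<=` I e -> B `<=` I f ->
  (\int[mu]_(x in A) \int[mu]_(y in B) (K e x f y)%:E =
  (L2dot (single e \1_A) (T t (single f \1_B)))%:E)%E.
Proof.
move=> mA mB AI BI.
have uL2 := single_L2_indic f mB.
have TuL2 : L2 (T t (single f \1_B)) by exact: (semigroup_L2 hT.1).
have TU := hK.2 _ uL2 e.
have mAB : measurable (A `*` B) by exact: measurableX.
have mkAB : measurable_fun setT ((fun z : RT * RT => (K e z.1 f z.2)%:E) \_ (A `*` B)).
  apply/(measurable_restrictT _ mAB); apply/measurable_EFinP.
  apply: measurable_funS (hK.1 e f); first exact: (measurableX (mI e) (mI f)).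
  by move=> [x y] [/= /AI ? /BI ?].
have G1 : (\int[mu]_(x in A) \int[mu]_(y in B) (K e x f y)%:E =
    \int[mu]_(x in A) (T t (single f \1_B) e x)%:E)%E.
  apply: ae_eq_integral => //.
  - have := measurable_section_integral mu mkAB.
    move=> /(@measurable_funTS _ _ _ _ A); apply: eq_measurable_fun => x.
    rewrite inE => Ax; rewrite [RHS]integral_mkcond; apply: eq_integral => y _.
    rewrite !patchE; congr (if _ then _ else _).
    by apply/idP/idP; rewrite !inE => // -[].
  - apply/measurable_EFinP.
    have [m _] := (square_integrableP _ _).1 (TuL2 e).
    exact: measurable_funS m.
  move: TU; apply: ae_imply => x /= H Ax; have [ix ->] := H (AI _ Ax).
  rewrite /gintegral (bigD1 f)//= big1 ?addr0; last first.
    move=> f' ff'; have E0 : \int[mu]_(y in edge_itv f') (0 : R) = 0.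
      by rewrite Rintegral_cst ?mul0r//; exact: measurable_itv.
    rewrite -[RHS]E0; apply: eq_Rintegral => y _.
    by rewrite /single (negbTE ff') mulr0.
  have E1 : (\int[mu]_(y in I f) (K e x f y * single f \1_B f y)%:E =
      \int[mu]_(y in B) (K e x f y)%:E)%E.
    rewrite integral_mkcond [RHS]integral_mkcond; apply: eq_integral => y _.
    rewrite !patchE /single eqxx indicE.
    have [yB|yB] := boolP (y \in B).
      by rewrite mem_set ?mulr1//; apply: BI; move: yB; rewrite inE.
    by case: ifP => // _; rewrite mulr0.
  rewrite -E1 /Rintegral fineK//.
  by apply: integrable_fin_num; [exact: mI|exact: (ix f)].
rewrite G1 L2dot_single.
have sA := indic_square_integrable (len e) mA.
have i1 := square_integrable_mul sA (TuL2 e).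
rewrite /Rintegral fineK; last by apply: integrable_fin_num => //; exact: (mI e).
rewrite [LHS]integral_mkcond [RHS]integral_mkcond; apply: eq_integral => x _.
rewrite !patchE indicE.
have [xA|xA] := boolP (x \in A).
  by rewrite mem_set ?mul1r//; apply: AI; move: xA; rewrite inE.
by case: ifP => // _; rewrite mul0r.
Qed.

Let one_L2 : @L2 R G (fun _ _ => 1).
Proof.
move=> e; apply: continuous_square_integrable; apply: continuous_subspaceT => x.
exact: cvg_cst.
Qed.

Let kernel_integrable e f :
  {ae mu, forall x : RT, mu.-integrable setT (fun y => k_ e f (x, y))}.
Proof.
have := hK.2 _ one_L2 e; apply: ae_imply => x /= H.
have [xI|xI] := pselect (I e x); last first.
  rewrite (_ : (fun y => _) = cst 0%E); first exact: integrable0.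
  by apply/funext => y; rewrite /k_ patchE memNset// => -[].
have [/(_ f) ix _] := H xI.
rewrite (_ : (fun y => _) = (fun y => (K e x f y * 1)%:E) \_ (I f)).
  apply: (integrable_restrict mu (mI f) measurableT _).1.
  by rewrite setTI.
apply/funext => y; rewrite /k_ !patchE mulr1; congr (if _ then _ else _).
by apply/idP/idP; rewrite !inE => // -[].
Qed.

Let kernel_section e f : {ae mu, forall y : RT, I f y ->
  \int[mu]_(x in edge_itv e) K e x f y = \int[mu]_(x in edge_itv e) K f y e x}.
Proof.
pose k2 (z : RT * RT) := k_ f e (z.2, z.1).
have mk2 : measurable_fun setT k2.
  exact: (measurableT_comp (mk f e) (@measurable_swap _ _ RT RT)).
have lt e' : (mu (I e') < +oo)%E by exact: segment_measure_lty.
have fin e' f' z : k_ e' f' z \is a fin_num.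
  by rewrite /k_ patchE; case: ifP.
have := @kernel_section_integral _ _ RT RT R mu mu (I e) (I f) (mI e) (mI f)
  (lt e) (lt f) (k_ e f) k2 (mk e f) mk2 (fin e f) (fun z => fin f e _).
have z1 z : ~ (I e `*` I f) z -> k_ e f z = 0%E.
  by move=> nz; rewrite /k_ patchE memNset.
have z2 z : ~ (I e `*` I f) z -> k2 z = 0%E.
  by move=> nz; rewrite /k2 /k_ patchE memNset// => -[? ?]; apply: nz.
move=> /(_ z1 z2 (kernel_integrable e f) (kernel_integrable f e)) H.
have {}H := H _.
apply: ae_imply (H _) => [y Hy yI|A B mA mB AI BI].
  rewrite /Rintegral; congr fine.
  move: Hy; rewrite /k2 /k_ => Hy.
  transitivity (\int[mu]_x ((fun z : RT * RT => (K e z.1 f z.2)%:E) \_ (I e `*` I f)) (x, y))%E.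
    rewrite integral_mkcond; apply: eq_integral => x _; rewrite !patchE.
    congr (if _ then _ else _).
    by apply/idP/idP; rewrite !inE => // -[].
  rewrite Hy [RHS]integral_mkcond; apply: eq_integral => x _; rewrite !patchE.
  congr (if _ then _ else _).
  by apply/idP/idP; rewrite !inE => // -[].
transitivity (\int[mu]_(x in A) \int[mu]_(y in B) (K e x f y)%:E)%E.
  apply: eq_integral => x; rewrite inE => xA; apply: eq_integral => y.
  by rewrite inE => yB; rewrite /k_ patchE mem_set//; split; [exact: AI|exact: BI].
rewrite (kernel_pairing mA mB AI BI) (heat_sym_indic e f mA mB t0)
  -(kernel_pairing mB mA BI AI).
apply: eq_integral => y; rewrite inE => yB; apply: eq_integral => x.
by rewrite inE => xA; rewrite /k2 /k_ patchE mem_set//; split; [exact: BI|exact: AI].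
Qed.

(** By the symmetry of the kernel, for almost every y the inner integral over
    the first variable is the value of [T t 1] at y. *)
Lemma kernel_total_integral :
  gintegral (fun f y => gintegral (fun e x => K e x f y)) =
  gintegral (T t (fun _ _ => 1)).
Proof.
rewrite {1}/gintegral [RHS]/gintegral; apply: eq_bigr => f _.
have T1 : @L2 R G (T t (fun _ _ => 1)) by exact: (semigroup_L2 hT.1).
rewrite /Rintegral; congr fine; apply: ae_eq_integral.
- exact: mI.
- have mkf e : measurable_fun setT (fun y : RT => (\int[mu]_x k_ e f (x, y))%E).
    apply: (measurable_section_integral mu (k := fun z => k_ e f (z.2, z.1))).
    exact: (measurableT_comp (mk e f) (@measurable_swap _ _ RT RT)).
  apply/measurable_EFinP; rewrite /gintegral.
  apply: measurable_sum => e.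
  have : measurable_fun (I f) (fun y : RT => fine (\int[mu]_x k_ e f (x, y))%E).
    by apply: measurable_funTS; apply: measurableT_comp (mkf e);
      exact: fine_measurable.
  apply: eq_measurable_fun => y; rewrite inE => yI.
  rewrite /Rintegral; congr fine; rewrite [RHS]integral_mkcond.
  apply: eq_integral => x _; rewrite /k_ !patchE; congr (if _ then _ else _).
  by apply/idP/idP; rewrite !inE => // -[].
- by apply/measurable_EFinP; have [] := (square_integrableP _ _).1 (T1 f).
have A1 : {ae mu, forall y : RT, forall e, I f y ->
    \int[mu]_(x in edge_itv e) K e x f y = \int[mu]_(x in edge_itv e) K f y e x}.
  by apply: filter_forall => e; exact: kernel_section.
move: (hK.2 _ one_L2 f) A1; apply: ae_imply2 => y /= H1 H2 yI.
have [_ ->] := H1 yI; congr (_%:E); apply: eq_bigr => e _.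
by rewrite H2//; apply: eq_Rintegral => x _; rewrite mulr1.
Qed.

End KernelTotal.

(** * The complementary error function *)

Section Erfc.
Context {R : realType}.
Local Notation mu := (@lebesgue_measure R).
Implicit Types (x y z t : R).

Definition gauss_primitive z : R := \int[mu]_(y in `]-oo, z]) gauss_fun y.

Lemma is_derive_gauss_primitive z :
  is_derive z (1 : R) gauss_primitive (gauss_fun z).
Proof.
have i1 : mu.-integrable `]-oo, z + 1] (EFin \o @gauss_fun R).
  by apply: integrableS (@integrableT_gauss R) => //; exact: measurable_itv.
have zz : z < z + 1 by rewrite ltrDl.
have [] := @continuous_FTC1 R (@gauss_fun R) -oo%O z _ zz i1 (ltNyr z)
  (@continuous_gauss_fun R z).
by rewrite derive1E => dF F'; exact: DeriveDef.
Qed.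

Local Notation sqrtpi := (Num.sqrt (pi : R)).

Lemma sqrtpi_gt0 : 0 < sqrtpi. Proof. by rewrite sqrtr_gt0 pi_gt0. Qed.

Lemma sqrtpi_ge1 : 1 <= sqrtpi.
Proof.
rewrite -[leLHS]sqrtr1; apply: ler_wsqrtr.
by apply: (le_trans _ (pi_ge2 R)); rewrite ler1n.
Qed.

Definition erfc z : R := 1 - 2 / sqrtpi * (gauss_primitive z - gauss_primitive 0).

Lemma is_derive_erfc z : is_derive z (1 : R) erfc (- (2 / sqrtpi) * gauss_fun z).
Proof.
have H : is_derive z (1 : R) erfc _ :=
  is_deriveB (is_derive_cst (1 : R) z 1) (is_deriveZ (2 / sqrtpi)
  (is_deriveB (is_derive_gauss_primitive z)
     (is_derive_cst (gauss_primitive 0) z (1 : R)))).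
by apply: (is_derive_eq H); rewrite subr0 sub0r mulNr.
Qed.

Lemma erfc0 : erfc 0 = 1.
Proof. by rewrite /erfc subrr mulr0 subr0. Qed.

(** The Gauss integral, which fixes the constant 2 / sqrt pi. *)
Lemma cvg_erfc : erfc z @[z --> +oo] --> (0 : R).
Proof.
have c : gauss_integral_proof.integral0_gauss z @[z --> +oo] --> sqrtpi / 2.
  have : Num.sqrt (gauss_integral_proof.integral0_gauss z ^+ 2) @[z --> +oo]
      --> Num.sqrt ((pi : R) / 4).
    apply: continuous_cvg => //; first exact: sqrt_continuous.
    exact: gauss_integral_proof.cvg_integral0_gauss_sqr.
  rewrite sqrtrM ?pi_ge0// sqrtrV// (_ : 4 = 2 ^+ 2); last first.
    by rewrite expr2 -natrM.
  rewrite sqrtr_sqr ger0_norm//; apply: cvg_trans; apply: near_eq_cvg.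
  near=> z; rewrite sqrtr_sqr ger0_norm//.
  exact: gauss_integral_proof.integral0_gauss_ge0.
have H : 1 - 2 / sqrtpi * gauss_integral_proof.integral0_gauss z @[z --> +oo]
    --> 1 - 2 / sqrtpi * (sqrtpi / 2).
  by apply: cvgB; [exact: cvg_cst|apply: cvgMr].
have E0 : 1 - 2 / sqrtpi * (sqrtpi / 2) = 0.
  by field; rewrite gt_eqF// sqrtpi_gt0.
rewrite E0 in H; apply: cvg_trans H; apply: near_eq_cvg; near=> z.
have z0 : 0 < z by near: z; exact: nbhs_pinfty_gt.
rewrite /erfc -(Rintegral_derive z0 is_derive_gauss_primitive)//.
exact: continuous_gauss_fun.
Unshelve. all: by end_near. Qed.

Lemma mean_value (k k' : R -> R) (a b : R) : a < b ->
  (forall z, a <= z <= b -> is_derive z (1 : R) k (k' z)) ->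
  exists2 c, a < c < b & k b - k a = k' c * (b - a).
Proof.
move=> ab dk.
have [||c] := @MVT R k k' a b ab.
- by move=> z; rewrite in_itv/= => /andP[/ltW ? /ltW ?]; apply: dk; apply/andP.
- apply: derivable_within_continuous => z; rewrite in_itv/= => zab.
  by have [] := dk z zab.
by rewrite in_itv/= => ? ?; exists c.
Qed.

Lemma nonincreasing_derive (k k' : R -> R) (a b : R) : a <= b ->
  (forall z, a <= z <= b -> is_derive z (1 : R) k (k' z)) ->
  (forall z, a < z < b -> k' z <= 0) -> k b <= k a.
Proof.
rewrite le_eqVlt => /predU1P[->//|ab] dk k'0.
have [c cab E] := mean_value ab dk.
by rewrite -subr_le0 E pmulr_lle0 ?subr_gt0// k'0.
Qed.

Lemma decreasing_to0_ge0 (k k' : R -> R) (a : R) :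
  (forall z, a <= z -> is_derive z (1 : R) k (k' z)) ->
  (forall z, a <= z -> k' z <= 0) ->
  k z @[z --> +oo] --> (0 : R) -> 0 <= k a.
Proof.
move=> dk k'0 k0.
have H : \forall w \near +oo, k w <= k a.
  near=> w; have aw : a <= w by near: w; apply: nbhs_pinfty_ge; exact: num_real.
  apply: (nonincreasing_derive (k' := k')) => // z /andP[az _].
    exact: dk.
  by apply: k'0; exact: ltW.
rewrite -(cvg_lim (@Rhausdorff R) k0); apply: limr_le H.
by apply/cvg_ex; exists 0.
Unshelve. all: by end_near. Qed.

Lemma derive_erfc_le0 z : - (2 / sqrtpi) * gauss_fun z <= 0.
Proof.
rewrite mulNr oppr_le0; apply: mulr_ge0; last exact: gauss_fun_ge0.
by apply: divr_ge0 => //; exact: ltW sqrtpi_gt0.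
Qed.

Lemma erfc_ge0 z : 0 <= erfc z.
Proof.
apply: (@decreasing_to0_ge0 _ (fun z => - (2 / sqrtpi) * gauss_fun z)).
- by move=> w _; exact: is_derive_erfc.
- move=> w _; exact: derive_erfc_le0.
- exact: cvg_erfc.
Qed.

Lemma erfc_le y z : y <= z -> erfc z <= erfc y.
Proof.
move=> yz; apply: (@nonincreasing_derive erfc
    (fun z => - (2 / sqrtpi) * gauss_fun z) y z yz) => w _.
  exact: is_derive_erfc.
exact: derive_erfc_le0.
Qed.

Lemma is_derive_gauss z : is_derive z (1 : R) gauss_fun (- (2 * z) * gauss_fun z).
Proof.
have d1 : is_derive z (1 : R) (fun x => - x ^+ 2) (- (2 * z)).
  have H := is_deriveN (is_derive_exprn 2 (is_derive_id z (1 : R))).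
  by apply: (is_derive_eq H); rewrite expr1 mulr1.
have H := @is_derive1_comp R expR (fun x => - x ^+ 2) z _ _
  (is_derive_expR (- z ^+ 2)) d1.
by apply: (is_derive_eq H); rewrite mulrC.
Qed.

(** The primitive of erfc vanishing at +oo, up to sign. *)
Definition ierfc z : R := gauss_fun z / sqrtpi - z * erfc z.

Lemma is_derive_ierfc z : is_derive z (1 : R) ierfc (- erfc z).
Proof.
have d1 : is_derive z (1 : R) (fun z => gauss_fun z / sqrtpi)
    (- (2 * z) * gauss_fun z / sqrtpi).
  have H : is_derive z (1 : R) (fun z => gauss_fun z / sqrtpi) _ :=
    is_deriveM (is_derive_gauss z) (is_derive_cst (sqrtpi^-1) z (1 : R)).
  apply: (is_derive_eq H); rewrite scaler0 add0r /cst.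
  exact: mulrC.
have d2 : is_derive z (1 : R) (fun z => z * erfc z)
    (z * (- (2 / sqrtpi) * gauss_fun z) + erfc z).
  have H : is_derive z (1 : R) (fun z => z * erfc z) _ :=
    is_deriveM (is_derive_id z (1 : R)) (is_derive_erfc z).
  apply: (is_derive_eq H); congr (_ + _); exact: mulr1.
have H : is_derive z (1 : R) ierfc _ := is_deriveB d1 d2.
by apply: (is_derive_eq H); ring.
Qed.

Lemma ierfc0 : ierfc 0 = sqrtpi^-1.
Proof. by rewrite /ierfc mul0r subr0 /gauss_fun expr0n oppr0 expR0 mul1r. Qed.

(** The difference exp (- z^2) / (z sqrt pi) - erfc z has derivative
    - exp (- z^2) / (z^2 sqrt pi) and tends to 0 at infinity, so it is
    nonnegative. *)
Lemma mul_erfc_le z : 0 < z -> z * erfc z <= gauss_fun z / sqrtpi.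
Proof.
move=> z0.
pose k w : R := gauss_fun w / (sqrtpi * w) - erfc w.
suff k0 : 0 <= k z.
  have := mulr_ge0 (ltW z0) k0; rewrite /k mulrBr subr_ge0.
  rewrite (_ : z * (gauss_fun z / (sqrtpi * z)) = gauss_fun z / sqrtpi)//.
  by field; rewrite !gt_eqF// sqrtpi_gt0.
pose k' w : R := - (gauss_fun w / (sqrtpi * w ^+ 2)).
apply: (@decreasing_to0_ge0 _ k').
- move=> w zw; have w0 : w != 0 by rewrite gt_eqF// (lt_le_trans z0).
  have d0 : is_derive w (1 : R) (fun w => sqrtpi * w) sqrtpi.
    have H := is_deriveZ sqrtpi (is_derive_id w (1 : R)).
    by apply: (is_derive_eq H); exact: mulr1.
  have sw0 : sqrtpi * w != 0 by rewrite mulf_neq0// gt_eqF// sqrtpi_gt0.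
  have d1 := is_deriveV sw0 d0.
  have d2 := is_deriveB (is_deriveM (is_derive_gauss w) d1) (is_derive_erfc w).
  have H : is_derive w (1 : R) k _ := d2.
  apply: (is_derive_eq H); rewrite /k'.
  have sp := lt0r_neq0 sqrtpi_gt0.
  rewrite -![_ *: _]/(_ * _) /=.
  by field; rewrite sp w0.
- move=> w _; rewrite /k' oppr_le0; apply: divr_ge0; first exact: gauss_fun_ge0.
  by apply: mulr_ge0; [exact: sqrtr_ge0|exact: sqr_ge0].
- rewrite -[X in _ --> X](subr0 (0 : R)); apply: cvgB; last exact: cvg_erfc.
  apply: (@squeeze_cvgr _ _ _ _ (cst 0) gauss_fun).
  + near=> w; have w1 : 1 <= w by near: w; apply: nbhs_pinfty_ge; exact: num_real.
    have w0 : 0 < w by apply: lt_le_trans w1.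
    have sw : 0 < sqrtpi * w by rewrite mulr_gt0// sqrtpi_gt0.
    have sw1 : 1 <= sqrtpi * w.
      by rewrite -[leLHS]mulr1 ler_pM// sqrtpi_ge1.
    apply/andP; split.
      by apply: divr_ge0; [exact: gauss_fun_ge0|exact: ltW].
    by rewrite ler_pdivrMr// ler_peMr// gauss_fun_ge0.
  + exact: cvg_cst.
  + exact: cvg_gauss_fun.
Unshelve. all: by end_near. Qed.

Lemma ierfc_itv z : 0 <= z -> 0 <= ierfc z <= gauss_fun z / sqrtpi.
Proof.
rewrite le_eqVlt => /predU1P[<-|z0].
  by rewrite ierfc0 invr_ge0 ltW ?sqrtpi_gt0//= /gauss_fun expr0n oppr0 expR0 mul1r.
by rewrite /ierfc subr_ge0 mul_erfc_le//= gerBl mulr_ge0 ?erfc_ge0// ltW.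
Qed.

(** Up to 1 / sqrt pi the difference erfc - exp (- z^2) decreases from its value
    0 at the origin; beyond that point [mul_erfc_le] is stronger. *)
Lemma erfc_le_gauss z : 0 <= z -> erfc z <= gauss_fun z.
Proof.
move=> z0; have [zs|sz] := leP z (sqrtpi^-1).
  pose k w : R := erfc w - gauss_fun w.
  have k0 : k 0 = 0 by rewrite /k erfc0 /gauss_fun expr0n oppr0 expR0 subrr.
  have : k z <= k 0.
    apply: (@nonincreasing_derive k (fun w => - (2 / sqrtpi) * gauss_fun w -
        (- (2 * w) * gauss_fun w)) 0 z z0) => [w _|w /andP[_ wz]].
      exact: is_deriveB (is_derive_erfc w) (is_derive_gauss w).
    have -> : - (2 / sqrtpi) * gauss_fun w - - (2 * w) * gauss_fun w =
      - (2 * (sqrtpi^-1 - w) * gauss_fun w) by ring.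
    rewrite oppr_le0 mulr_ge0 ?gauss_fun_ge0// mulr_ge0// subr_ge0.
    by rewrite (le_trans (ltW wz)).
  by rewrite k0 subr_le0.
have zp : 0 < z by apply: lt_trans sz; rewrite invr_gt0 sqrtpi_gt0.
have := mul_erfc_le zp; rewrite ler_pdivlMr ?sqrtpi_gt0//.
apply: le_trans; rewrite mulrC mulrA ler_peMl ?erfc_ge0//.
by rewrite mulrC -ler_pdivrMr ?sqrtpi_gt0// div1r ltW.
Qed.

End Erfc.

(** * The half-line solution and its derivatives *)

Section HalfLine.
Context {R : realType}.
Local Notation sqrtpi := (Num.sqrt (pi : R)).
Implicit Types (x y z t s : R).

(** The solution of the heat equation on the half-line x > 0 with zero initial
    value and boundary value 1 at x = 0. *)
Definition half_line t x : R := erfc (x / (2 * Num.sqrt t)).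

Definition half_line_x t x : R :=
  - (gauss_fun (x / (2 * Num.sqrt t)) / (sqrtpi * Num.sqrt t)).

Definition half_line_xx t x : R :=
  x * gauss_fun (x / (2 * Num.sqrt t)) / (2 * sqrtpi * (Num.sqrt t * t)).

Lemma is_derive_scale (c x : R) : is_derive x (1 : R) (fun x => x / c) (c^-1).
Proof.
have H : is_derive x (1 : R) (fun x => x / c) _ :=
  is_deriveM (is_derive_id x (1 : R)) (is_derive_cst (c^-1) x (1 : R)).
apply: (is_derive_eq H); rewrite scaler0 add0r.
exact: mulr1.
Qed.

Lemma is_derive_half_line t x : 0 < t ->
  is_derive x (1 : R) (half_line t) (half_line_x t x).
Proof.
move=> t0; have r0 : Num.sqrt t != 0 by rewrite gt_eqF// sqrtr_gt0.
have sp := lt0r_neq0 (@sqrtpi_gt0 R).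
have H : is_derive x (1 : R) (half_line t) _ :=
  @is_derive1_comp R erfc (fun x => x / (2 * Num.sqrt t)) x _ _
    (is_derive_erfc _) (is_derive_scale _ x).
apply: (is_derive_eq H); rewrite /half_line_x.
by field; rewrite sp r0.
Qed.

Lemma is_derive_half_line_x t x : 0 < t ->
  is_derive x (1 : R) (half_line_x t) (half_line_xx t x).
Proof.
move=> t0; have r0 : Num.sqrt t != 0 by rewrite gt_eqF// sqrtr_gt0.
have tE : t = Num.sqrt t ^+ 2 by rewrite sqr_sqrtr// ltW.
have sp := lt0r_neq0 (@sqrtpi_gt0 R).
have H0 := @is_derive1_comp R (@gauss_fun R) (fun x => x / (2 * Num.sqrt t)) x _ _
    (is_derive_gauss _) (is_derive_scale _ x).
have H : is_derive x (1 : R) (half_line_x t) _ :=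
  is_deriveN (is_deriveM H0 (is_derive_cst ((sqrtpi * Num.sqrt t)^-1) x (1 : R))).
apply: (is_derive_eq H); rewrite scaler0 add0r /cst /half_line_xx.
rewrite -[_ *: _]/(_ * _) [in RHS](_ : Num.sqrt t * t = Num.sqrt t ^+ 3); last first.
  by rewrite {2}tE -exprS.
by field; rewrite sp r0.
Qed.

Lemma continuous_half_line t : continuous (half_line t).
Proof.
move=> x; apply: (continuous_comp (f := fun x => x / (2 * Num.sqrt t)) (g := @erfc R)).
  by apply: cvgMl; exact: cvg_id.
exact: (derive_continuous (fun z => is_derive_erfc z)).
Qed.

Lemma continuous_half_line_x t : continuous (half_line_x t).
Proof.
move=> x; apply: cvgN; apply: cvgMl.
apply: (continuous_comp (f := fun x => x / (2 * Num.sqrt t)) (g := @gauss_fun R)).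
  by apply: cvgMl; exact: cvg_id.
exact: continuous_gauss_fun.
Qed.

Lemma continuous_half_line_xx t : continuous (half_line_xx t).
Proof.
move=> x; apply: cvgMl; apply: cvgM; first exact: cvg_id.
apply: (continuous_comp (f := fun x => x / (2 * Num.sqrt t)) (g := @gauss_fun R)).
  by apply: cvgMl; exact: cvg_id.
exact: continuous_gauss_fun.
Qed.

Lemma is_derive_time_scale t x : 0 < t ->
  is_derive t (1 : R) (fun t => x / (2 * Num.sqrt t)) (- (x / (4 * (Num.sqrt t * t)))).
Proof.
move=> t0; have r0 : Num.sqrt t != 0 by rewrite gt_eqF// sqrtr_gt0.
have tE : t = Num.sqrt t ^+ 2 by rewrite sqr_sqrtr// ltW.
have d1 : is_derive t (1 : R) (fun t => 2 * Num.sqrt t) (Num.sqrt t)^-1.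
  have H : is_derive t (1 : R) (fun t => 2 * Num.sqrt t) _ :=
    is_deriveZ 2 (is_derive1_sqrt t0).
  apply: (is_derive_eq H); rewrite -![_ *: _]/(_ * _).
  by field.
have r2 : 2 * Num.sqrt t != 0 by rewrite mulf_neq0.
have H : is_derive t (1 : R) (fun t => x / (2 * Num.sqrt t)) _ :=
  is_deriveZ x (@is_deriveV R (fun t => 2 * Num.sqrt t) t _ 1 r2 d1).
apply: (is_derive_eq H); rewrite -![_ *: _]/(_ * _).
rewrite [in RHS](_ : Num.sqrt t * t = Num.sqrt t ^+ 3); last first.
  by rewrite {2}tE -exprS.
by field.
Qed.

(** The heat equation: the derivative in t is the second derivative in x. *)
Lemma is_derive_half_line_time t x : 0 < t ->
  is_derive t (1 : R) (half_line ^~ x) (half_line_xx t x).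
Proof.
move=> t0; have r0 : Num.sqrt t != 0 by rewrite gt_eqF// sqrtr_gt0.
have sp := lt0r_neq0 (@sqrtpi_gt0 R).
have H : is_derive t (1 : R) (half_line ^~ x) _ :=
  @is_derive1_comp R erfc (fun t => x / (2 * Num.sqrt t)) t _ _
    (is_derive_erfc _) (is_derive_time_scale x t0).
apply: (is_derive_eq H); rewrite /half_line_xx.
by field; rewrite sp r0 gt_eqF.
Qed.

Lemma is_derive_half_line_xx_time t x : 0 < t ->
  is_derive t (1 : R) (half_line_xx ^~ x)
    (half_line_xx t x * (x ^+ 2 / (4 * t ^+ 2) - 3 / (2 * t))).
Proof.
move=> t0; have r0 : Num.sqrt t != 0 by rewrite gt_eqF// sqrtr_gt0.
have tE : t = Num.sqrt t ^+ 2 by rewrite sqr_sqrtr// ltW.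
have t0' : t != 0 by rewrite gt_eqF.
have sp := lt0r_neq0 (@sqrtpi_gt0 R).
have d0 := @is_derive1_comp R (@gauss_fun R) (fun t => x / (2 * Num.sqrt t)) t _ _
    (is_derive_gauss _) (is_derive_time_scale x t0).
have d1 := is_deriveM (is_derive1_sqrt t0) (is_derive_id t (1 : R)).
have n0 : Num.sqrt t * t != 0 by rewrite mulf_neq0.
have d2 := @is_deriveV R (fun t => Num.sqrt t * t) t _ 1 n0 d1.
have H0 := is_deriveZ (x / (2 * sqrtpi)) (is_deriveM d0 d2).
have E : half_line_xx ^~ x = (x / (2 * sqrtpi)) \*: (((@gauss_fun R) \o
    (fun t => x / (2 * Num.sqrt t))) * (fun t => (Num.sqrt t * t)^-1)).
  apply/funext => u; rewrite /half_line_xx /= -[_ *: _]/(_ * _).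
  by rewrite fctE /=; move: (gauss_fun _) => g; rewrite [in LHS]invfM; ring.
rewrite [X in is_derive _ _ X _]E; apply: (is_derive_eq H0).
rewrite -![_ *: _]/(_ * _) /half_line_xx /=.
move: (gauss_fun _) => g.
move: tE r0; move: (Num.sqrt t) => r -> r0.
by field; rewrite sp r0.
Qed.

End HalfLine.

(** * Estimates and integrals of the half-line solution *)

Section HalfLineBounds.
Context {R : realType}.
Local Notation sqrtpi := (Num.sqrt (pi : R)).
Implicit Types (x y z t s X h a d l : R).

Lemma gauss_scaleE t y : 0 < t ->
  gauss_fun (y / (2 * Num.sqrt t)) = expR (- (y ^+ 2 / (4 * t))).
Proof.
move=> t0; rewrite /gauss_fun expr_div_n exprMn sqr_sqrtr; last exact: ltW.
by have -> : (2 : R) ^+ 2 = 4 by rewrite expr2 -natrM.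
Qed.

Lemma half_line_xx_le s t x X : 0 < s -> s <= t -> 0 <= x <= X ->
  `|half_line_xx t x| <= X / (Num.sqrt s * s).
Proof.
move=> s0 st /andP[x0 xX]; have t0 := lt_le_trans s0 st.
have rs0 : 0 < Num.sqrt s by rewrite sqrtr_gt0.
have rt0 : 0 < Num.sqrt t by rewrite sqrtr_gt0.
have rst : Num.sqrt s <= Num.sqrt t by rewrite ler_wsqrtr.
have den : Num.sqrt s * s <= 2 * sqrtpi * (Num.sqrt t * t).
  rewrite -[leLHS]mul1r; apply: ler_pM => //.
  - by rewrite mulr_ge0// ltW.
  - by have := @sqrtpi_ge1 R; lra.
  - by apply: ler_pM => //; exact: ltW.
have den0 : 0 < Num.sqrt s * s by rewrite mulr_gt0.
have den1 := lt_le_trans den0 den.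
rewrite /half_line_xx ger0_norm; last first.
  by apply: divr_ge0 (ltW den1); rewrite mulr_ge0 ?gauss_fun_ge0.
apply: ler_pM.
- by rewrite mulr_ge0 ?gauss_fun_ge0.
- by rewrite invr_ge0 ltW.
- by rewrite -[leRHS]mulr1 ler_pM ?gauss_fun_ge0 ?gauss_fun_le1.
- by rewrite lef_pV2 ?posrE.
Qed.

(** Two applications of the mean value theorem in t bound the error by h times
    a second time derivative, which is uniformly bounded for x in [0, X] and
    times after s. *)
Lemma half_line_quotient s X : 0 < s -> 0 <= X ->
  exists2 C : R, 0 <= C & forall x h, 0 <= x <= X -> 0 < h ->
  `|h^-1 * (half_line (s + h) x - half_line s x) - half_line_xx s x| <= C * h.
Proof.
move=> s0 X0; have rs0 : 0 < Num.sqrt s by rewrite sqrtr_gt0.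
have D0 : 0 <= X / (Num.sqrt s * s) by rewrite divr_ge0// mulr_ge0// ltW.
pose B := X ^+ 2 / (4 * s ^+ 2) + 3 / (2 * s).
have B0 : 0 <= B.
  by rewrite addr_ge0// divr_ge0 ?sqr_ge0// mulr_ge0 ?sqr_ge0// ltW.
exists (X / (Num.sqrt s * s) * B) => [|x h xX h0]; first exact: mulr_ge0.
have sh : s < s + h by rewrite ltrDl.
have [c /andP[sc ch] E1] := mean_value sh (fun z zs =>
  is_derive_half_line_time x (lt_le_trans s0 (proj1 (andP zs)))).
have [c' /andP[sc' cc'] E2] := mean_value sc (fun z zs =>
  is_derive_half_line_xx_time x (lt_le_trans s0 (proj1 (andP zs)))).
rewrite E1 addrAC subrr add0r [_ * h]mulrC mulKf ?gt_eqF// E2.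
have c'0 : 0 < c' := lt_trans s0 sc'.
have /andP[x0 xX'] := xX.
have b1 : `|half_line_xx c' x| <= X / (Num.sqrt s * s).
  by apply: half_line_xx_le => //; exact: ltW.
have b2 : `|x ^+ 2 / (4 * c' ^+ 2) - 3 / (2 * c')| <= B.
  apply: (le_trans (ler_normB _ _)).
  rewrite !ger0_norm; first last.
  - by rewrite divr_ge0 ?sqr_ge0// mulr_ge0 ?sqr_ge0.
  - by rewrite divr_ge0// mulr_ge0// ltW.
  have c's2 : s ^+ 2 <= c' ^+ 2 by rewrite ler_pXn2r ?nnegrE// ltW.
  have s2 : 0 < s ^+ 2 by rewrite exprn_gt0.
  have c'2 : 0 < c' ^+ 2 by rewrite exprn_gt0.
  apply: lerD; apply: ler_pM => //.
  - exact: sqr_ge0.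
  - by rewrite invr_ge0 mulr_ge0// ltW.
  - by rewrite ler_pXn2r// nnegrE.
  - by rewrite lef_pV2 ?posrE ?mulr_gt0// ler_pM2l.
  - by rewrite invr_ge0 mulr_ge0// ltW.
  - by rewrite lef_pV2 ?posrE ?mulr_gt0// ler_pM2l// ltW.
have b3 : `|c - s| <= h by rewrite gtr0_norm ?subr_gt0//; lra.
have b4 : `|c' - s| <= h by rewrite gtr0_norm ?subr_gt0//; lra.
rewrite 2!normrM; apply: ler_pM; [exact: mulr_ge0|exact: normr_ge0| |by []].
exact: ler_pM.
Qed.

(** The restriction h < s / 2 keeps the times away from the singular time 0. *)
Lemma half_line_backward s X : 0 < s -> 0 <= X ->
  exists2 C : R, 0 <= C & forall x h, 0 <= x <= X -> 0 < h < s / 2 ->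
  `|half_line (s - h) x - half_line s x| <= C * h.
Proof.
move=> s0 X0; have s20 : 0 < s / 2 by rewrite divr_gt0.
have rs0 : 0 < Num.sqrt (s / 2) by rewrite sqrtr_gt0.
exists (X / (Num.sqrt (s / 2) * (s / 2))) => [|x h xX /andP[h0 hs]].
  by rewrite divr_ge0// mulr_ge0// ltW.
have sh : s - h < s by rewrite gtrBl.
have s2 : s / 2 <= s - h by lra.
have [c /andP[sc ch] E1] := mean_value sh (fun z zs =>
  is_derive_half_line_time x (lt_le_trans s20 (le_trans s2 (proj1 (andP zs))))).
rewrite distrC E1 normrM subKr (gtr0_norm h0).
apply: ler_wpM2r; first exact: ltW.
by apply: half_line_xx_le => //; apply: le_trans s2 _; exact: ltW.
Qed.

Lemma half_line_ge0 t x : 0 <= half_line t x. Proof. exact: erfc_ge0. Qed.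

Lemma half_line_le t x y : x <= y -> half_line t y <= half_line t x.
Proof. by move=> xy; apply: erfc_le; rewrite ler_wpM2r// invr_ge0 mulr_ge0// sqrtr_ge0. Qed.

Lemma half_line_at0 t : half_line t 0 = 1.
Proof. by rewrite /half_line mul0r erfc0. Qed.

Lemma half_line_le1 t x : 0 <= x -> half_line t x <= 1.
Proof. by move=> x0; rewrite -(half_line_at0 t) half_line_le. Qed.

Lemma half_line_gauss t a y : 0 < t -> 0 <= a -> a <= y ->
  half_line t y <= expR (- (a ^+ 2 / (4 * t))).
Proof.
move=> t0 a0 ay; apply: (le_trans (half_line_le t ay)).
rewrite -gauss_scaleE//; apply: erfc_le_gauss.
by rewrite divr_ge0// mulr_ge0// sqrtr_ge0.
Qed.

(** The factor [d] compensates the singular t^(-1/2), because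
    y exp (- y^2 / 4) <= 1. *)
Lemma half_line_x_gauss t a d : 0 < t -> 0 <= a -> 0 <= d ->
  d * `|half_line_x t (a + d)| <= expR (- (a ^+ 2 / (4 * t))).
Proof.
move=> t0 a0 d0; have rt0 : 0 < Num.sqrt t by rewrite sqrtr_gt0.
rewrite /half_line_x normrN ger0_norm; last first.
  by rewrite divr_ge0 ?gauss_fun_ge0// mulr_ge0 ?sqrtr_ge0.
rewrite gauss_scaleE//.
have e1 : expR (- ((a + d) ^+ 2 / (4 * t))) <=
    expR (- (a ^+ 2 / (4 * t))) * expR (- (d ^+ 2 / (4 * t))).
  rewrite -expRD ler_expR -opprD lerN2 -mulrDl ler_wpM2r//.
    by rewrite invr_ge0 mulr_ge0// ltW.
  by have := mulr_ge0 a0 d0; rewrite sqrrD; lra.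
have e2 : d * expR (- (d ^+ 2 / (4 * t))) <= sqrtpi * Num.sqrt t.
  pose y := d / Num.sqrt t.
  have dE : d = y * Num.sqrt t by rewrite divfK// gt_eqF.
  have -> : d ^+ 2 / (4 * t) = y ^+ 2 / 4.
    rewrite dE exprMn sqr_sqrtr ?ltW//; field; exact: lt0r_neq0.
  rewrite {1}dE mulrAC ler_pM2r//; apply: le_trans (@sqrtpi_ge1 R).
  rewrite expRN ler_pdivrMr ?expR_gt0// mul1r.
  apply: le_trans (expR_ge1Dx _).
  by have := sqr_ge0 (y / 2 - 1); lra.
rewrite mulrA ler_pdivrMr ?mulr_gt0 ?sqrtpi_gt0//.
apply: (le_trans (ler_wpM2l d0 e1)); rewrite mulrCA ler_wpM2l ?expR_ge0//.
Qed.

End HalfLineBounds.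

(** * Waves emitted by the Dirichlet vertices *)

Lemma is_derive_bigsum (R : realType) (I : Type) (r : seq I) (F : I -> R -> R)
    (dF : I -> R) (x : R) : (forall i, is_derive x (1 : R) (F i) (dF i)) ->
  is_derive x (1 : R) (fun y => \sum_(i <- r) F i y) (\sum_(i <- r) dF i).
Proof.
move=> dFP; elim: r => [|i r IH].
  rewrite big_nil (_ : (fun y => _) = cst 0); first exact: is_derive_cst.
  by apply/funext => y; rewrite big_nil.
rewrite big_cons (_ : (fun y => _) = F i + (fun y => \sum_(j <- r) F j y)).
  exact: is_deriveD.
by apply/funext => y; rewrite big_cons.
Qed.

Lemma continuous_bigsum (R : realType) (I : Type) (r : seq I) (F : I -> R -> R) :
  (forall i, continuous (F i)) -> continuous (fun y => \sum_(i <- r) F i y).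
Proof.
move=> cF; elim: r => [|i r IH].
  rewrite (_ : (fun y => _) = cst 0); first by move=> x; exact: cvg_cst.
  by apply/funext => y; rewrite big_nil.
rewrite (_ : (fun y => _) = F i \+ (fun y => \sum_(j <- r) F j y)).
  by move=> x; apply: cvgD; [exact: cF|exact: IH].
by apply/funext => y; rewrite big_cons.
Qed.

Section Waves.
Context {R : realType}.
Variables (G : metric_graph R) (VD : {set vertex G}).
Local Notation mu := (@lebesgue_measure R).
Local Notation end_ := (edge G * bool)%type.
Implicit Types (Phi Psi : R -> R) (x y d l t a : R) (e : edge G) (b : bool) (h : end_).

(** The distance of the point [x] of [e] from the end [b]: waves are functions
    of the distance from the end they start from. *)
Definition end_dist e b x : R := if b then len e - x else x.

Definition end_sign b : R := if b then -1 else 1.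

Lemma is_derive_end_dist e b x :
  is_derive x (1 : R) (end_dist e b) (end_sign b).
Proof.
case: b; rewrite /end_dist /end_sign; last exact: is_derive_id.
exact: is_derive_reflect.
Qed.

Lemma continuous_end_dist e b : continuous (end_dist e b).
Proof. by apply: derive_continuous => x; exact: is_derive_end_dist. Qed.

Lemma end_dist_itv e b x : 0 <= x <= len e -> 0 <= end_dist e b x <= len e.
Proof. by case: b => //= /andP[x0 xl]; rewrite subr_ge0 xl gerBl x0. Qed.

Lemma integral_half_line_end t a e b : 0 < t ->
  \int[mu]_(x in `[0, len e]) half_line t (a + end_dist e b x) =
  2 * Num.sqrt t * (ierfc (a / (2 * Num.sqrt t)) -
                    ierfc ((a + len e) / (2 * Num.sqrt t))).
Proof.
move=> t0; have r0 : 2 * Num.sqrt t != 0 by rewrite mulf_neq0// gt_eqF// sqrtr_gt0.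
rewrite /half_line; set c := 2 * Num.sqrt t in r0 *.
pose H x := - (end_sign b * c) * ierfc ((a + end_dist e b x) / c).
have d1 x : is_derive x (1 : R) (fun x => a + end_dist e b x) (end_sign b).
  have d := is_deriveD (is_derive_cst a x (1 : R)) (is_derive_end_dist e b x).
  by apply: (is_derive_eq d); rewrite add0r.
have d0 x := @is_derive1_comp R (fun y => y / c) (fun x => a + end_dist e b x) x _ _
  (is_derive_scale c (a + end_dist e b x)) (d1 x).
have dH x : is_derive x (1 : R) H (erfc ((a + end_dist e b x) / c)).
  have d : is_derive x (1 : R) H _ := is_deriveZ (- (end_sign b * c))
    (@is_derive1_comp R ierfc (fun x => (a + end_dist e b x) / c) x _ _
      (is_derive_ierfc _) (d0 x)).
  apply: (is_derive_eq d); rewrite -![_ *: _]/(_ * _).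
  by rewrite /end_sign; case: (b); field.
rewrite (Rintegral_derive (len_gt0 e) dH).
  rewrite /H /end_sign /end_dist; case: (b); rewrite ?subrr ?subr0 ?addr0; ring.
apply: derive_continuous => x; exact: is_derive1_comp (is_derive_erfc _) (d0 x).
Qed.

(** Value and slope are those of the constant 1 at d = 0 and those of the
    constant 0 at d = l, so that fading affects no vertex condition. *)
Definition fade l d : R := 1 - 3 * (d / l) ^+ 2 + 2 * (d / l) ^+ 3.
Definition fade_x l d : R := (6 * (d / l) ^+ 2 - 6 * (d / l)) / l.
Definition fade_xx l d : R := (12 * (d / l) - 6) / l ^+ 2.

Lemma is_derive_fade l d : l != 0 -> is_derive d (1 : R) (fade l) (fade_x l d).
Proof.
move=> l0; have d1 := is_derive_scale l d.
have H : is_derive d (1 : R) (fade l) _ := is_deriveD (is_deriveB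
  (is_derive_cst (1 : R) d (1 : R)) (is_deriveZ 3 (is_derive_exprn 2 d1)))
  (is_deriveZ 2 (is_derive_exprn 3 d1)).
apply: (is_derive_eq H); rewrite -![_ *: _]/(_ * _) /fade_x /=.
by field.
Qed.

Lemma is_derive_fade_x l d : l != 0 -> is_derive d (1 : R) (fade_x l) (fade_xx l d).
Proof.
move=> l0; have d1 := is_derive_scale l d.
have H : is_derive d (1 : R) (fade_x l) _ := is_deriveM (is_deriveB
  (is_deriveZ 6 (is_derive_exprn 2 d1)) (is_deriveZ 6 d1))
  (is_derive_cst (l^-1) d (1 : R)).
apply: (is_derive_eq H); rewrite -![_ *: _]/(_ * _) /fade_xx /=.
by field.
Qed.

Lemma fade_itv l d : 0 < l -> 0 <= d <= l -> 0 <= fade l d <= 1.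
Proof.
move=> l0 /andP[d0 dl]; rewrite /fade; set u := d / l.
have u0 : 0 <= u by rewrite divr_ge0// ltW.
have u1 : u <= 1 by rewrite ler_pdivrMr// mul1r.
have p1 : 0 <= (1 - u) ^+ 2 * (1 + 2 * u).
  by apply: mulr_ge0; [exact: sqr_ge0|lra].
have p2 : 0 <= u ^+ 2 * (3 - 2 * u) by apply: mulr_ge0; [exact: sqr_ge0|lra].
have -> : 1 - 3 * u ^+ 2 + 2 * u ^+ 3 = (1 - u) ^+ 2 * (1 + 2 * u) by ring.
rewrite p1 /= -subr_ge0.
by have -> : 1 - (1 - u) ^+ 2 * (1 + 2 * u) = u ^+ 2 * (3 - 2 * u) by ring.
Qed.

Lemma fade_x_le l d : 0 < l -> 0 <= d <= l -> `|fade_x l d| <= 6 / l ^+ 2 * d.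
Proof.
move=> l0 /andP[d0 dl].
have -> : fade_x l d = - (6 / l ^+ 2 * d * (1 - d / l)).
  by rewrite /fade_x; field; rewrite gt_eqF.
have u0 : 0 <= d / l by rewrite divr_ge0// ltW.
have u1 : d / l <= 1 by rewrite ler_pdivrMr// mul1r.
have c0 : 0 <= 6 / l ^+ 2 * d by rewrite mulr_ge0// divr_ge0// exprn_ge0// ltW.
rewrite normrN ger0_norm; last by rewrite mulr_ge0// subr_ge0.
by rewrite -[leRHS]mulr1 ler_wpM2l// gerBl.
Qed.

Lemma fade_xx_le l d : 0 < l -> 0 <= d <= l -> `|fade_xx l d| <= 6 / l ^+ 2.
Proof.
move=> l0 /andP[d0 dl]; rewrite /fade_xx.
have u0 : 0 <= d / l by rewrite divr_ge0// ltW.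
have u1 : d / l <= 1 by rewrite ler_pdivrMr// mul1r.
rewrite normrM [X in _ * X]ger0_norm; last by rewrite invr_ge0 exprn_ge0// ltW.
rewrite ler_wpM2r ?invr_ge0 ?exprn_ge0// ?(ltW l0)// ler_norml.
by apply/andP; split; lra.
Qed.

Definition is_dirichlet h : R := (ends h.1 h.2 \in VD)%:R.

Definition other_end h : end_ := (h.1, ~~ h.2).

(** Scattering at a vertex of degree [deg v] with continuity and Kirchhoff
    conditions: an incoming wave is transmitted with amplitude 2 / deg v and
    reflected with amplitude 2 / deg v - 1; at a Dirichlet vertex it is
    reflected with amplitude -1. *)
Definition transmission (v : vertex G) : R :=
  if v \in VD then 0 else 2 / (deg v)%:R.

(** The amplitude of the wave leaving the end [h] caused by the wave that
    arrives at [h'], having started from the opposite end of the same edge. *)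
Definition scattering h h' : R :=
  (if ends h'.1 h'.2 == ends h.1 h.2
   then transmission (ends h.1 h.2) * is_dirichlet (other_end h') else 0)
  - (if h' == h then is_dirichlet (other_end h) else 0).

(** The argument is the distance travelled since the Dirichlet vertex: a
    scattered wave continues the arriving one. *)
Definition outgoing Phi h d : R :=
  \sum_(h' : end_) scattering h h' * Phi (len h'.1 + d).

(** [waves (half_line t)]: from every Dirichlet end starts the half-line
    solution, and the first scattered waves are faded out before they reach
    another vertex. *)
Definition waves Phi : gfun G := fun e x => \sum_(b : bool)
  (is_dirichlet (e, b) * Phi (end_dist e b x) +
   outgoing Phi (e, b) (end_dist e b x) * fade (len e) (end_dist e b x)).

(** The edgewise derivative of [waves Phi], when [Phi'] is that of [Phi]. *)
Definition waves_x Phi Phi' : gfun G := fun e x => \sum_(b : bool) end_sign b *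
  (is_dirichlet (e, b) * Phi' (end_dist e b x) +
   (outgoing Phi' (e, b) (end_dist e b x) * fade (len e) (end_dist e b x) +
    outgoing Phi (e, b) (end_dist e b x) * fade_x (len e) (end_dist e b x))).

(** The terms of the second derivative of [waves Phi] in which a derivative
    falls on [fade]. *)
Definition fading_defect Phi Phi' : gfun G := fun e x => \sum_(b : bool)
  (2 * (outgoing Phi' (e, b) (end_dist e b x) * fade_x (len e) (end_dist e b x)) +
   outgoing Phi (e, b) (end_dist e b x) * fade_xx (len e) (end_dist e b x)).

Lemma is_derive_outgoing Phi Phi' h d :
  (forall y, is_derive y (1 : R) Phi (Phi' y)) ->
  is_derive d (1 : R) (outgoing Phi h) (outgoing Phi' h d).
Proof.
move=> dPhi; apply: is_derive_bigsum => h'.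
have d1 : is_derive d (1 : R) (fun d => len h'.1 + d) 1.
  have H := is_deriveD (is_derive_cst (len h'.1) d (1 : R)) (is_derive_id d (1 : R)).
  by apply: (is_derive_eq H); rewrite add0r.
have H := is_deriveZ (scattering h h') (@is_derive1_comp R Phi
  (fun d => len h'.1 + d) d _ _ (dPhi _) d1).
by apply: (is_derive_eq H); rewrite mulr1.
Qed.

Lemma continuous_outgoing Phi h : continuous Phi -> continuous (outgoing Phi h).
Proof.
move=> cPhi; apply: continuous_bigsum => h' x; apply: cvgMr.
apply: (continuous_comp (f := fun d => len h'.1 + d) (g := Phi)); last exact: cPhi.
by apply: cvgD; [exact: cvg_cst|exact: cvg_id].
Qed.

Lemma continuous_comp_dist (f : R -> R) e b : continuous f ->
  continuous (fun x => f (end_dist e b x)).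
Proof.
move=> cf x; apply: (continuous_comp (f := end_dist e b) (g := f)); last exact: cf.
exact: continuous_end_dist.
Qed.

Lemma continuous_fade l : l != 0 -> continuous (fade l).
Proof. by move=> l0; apply: derive_continuous => d; exact: is_derive_fade. Qed.

Lemma continuous_fade_x l : l != 0 -> continuous (fade_x l).
Proof. by move=> l0; apply: derive_continuous => d; exact: is_derive_fade_x. Qed.

Lemma continuous_fade_xx l : continuous (fade_xx l).
Proof.
move=> d; apply: cvgMl; apply: cvgB; last exact: cvg_cst.
by apply: cvgMr; apply: cvgMl; exact: cvg_id.
Qed.

Lemma len_neq0 e : len e != 0. Proof. by rewrite gt_eqF// len_gt0. Qed.

Lemma continuous_waves Phi e : continuous Phi -> continuous (waves Phi e).
Proof.
move=> cPhi; apply: continuous_bigsum => b x; apply: cvgD.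
  by apply: cvgMr; exact: (continuous_comp_dist cPhi).
apply: cvgM; first exact: (continuous_comp_dist (continuous_outgoing cPhi)).
exact: (continuous_comp_dist (continuous_fade (len_neq0 e))).
Qed.

Lemma continuous_fading_defect Phi Phi' e : continuous Phi -> continuous Phi' ->
  continuous (fading_defect Phi Phi' e).
Proof.
move=> cPhi cPhi'; apply: continuous_bigsum => b x; apply: cvgD.
  apply: cvgMr; apply: cvgM.
    exact: (continuous_comp_dist (continuous_outgoing cPhi')).
  exact: (continuous_comp_dist (continuous_fade_x (len_neq0 e))).
apply: cvgM; first exact: (continuous_comp_dist (continuous_outgoing cPhi)).
exact: (continuous_comp_dist (@continuous_fade_xx (len e))).
Qed.

Lemma is_derive_comp_dist (f f' : R -> R) e b x : (forall y, is_derive y (1 : R) f (f' y)) ->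
  is_derive x (1 : R) (fun x => f (end_dist e b x)) (end_sign b * f' (end_dist e b x)).
Proof.
move=> df; have H := @is_derive1_comp R f (end_dist e b) x _ _ (df _)
  (is_derive_end_dist e b x).
by apply: (is_derive_eq H); rewrite mulrC.
Qed.

Lemma is_derive_waves Phi Phi' e x : (forall y, is_derive y (1 : R) Phi (Phi' y)) ->
  is_derive x (1 : R) (waves Phi e) (waves_x Phi Phi' e x).
Proof.
move=> dPhi; apply: is_derive_bigsum => b.
have d1 := is_derive_comp_dist e b x dPhi.
have d2 := is_derive_comp_dist e b x (fun y => is_derive_outgoing (e, b) y dPhi).
have d3 := is_derive_comp_dist e b x (fun y => is_derive_fade y (len_neq0 e)).
have H := is_deriveD (is_deriveZ (is_dirichlet (e, b)) d1) (is_deriveM d2 d3).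
by apply: (is_derive_eq H); rewrite -![_ *: _]/(_ * _); ring.
Qed.

Lemma is_derive_waves_x Phi Phi' Phi'' e x :
  (forall y, is_derive y (1 : R) Phi (Phi' y)) ->
  (forall y, is_derive y (1 : R) Phi' (Phi'' y)) ->
  is_derive x (1 : R) (waves_x Phi Phi' e)
    (waves Phi'' e x + fading_defect Phi Phi' e x).
Proof.
move=> dPhi dPhi'; rewrite -big_split/=; apply: is_derive_bigsum => b.
have d1 := is_derive_comp_dist e b x dPhi'.
have d2 := is_derive_comp_dist e b x (fun y => is_derive_outgoing (e, b) y dPhi).
have d2' := is_derive_comp_dist e b x (fun y => is_derive_outgoing (e, b) y dPhi').
have d3 := is_derive_comp_dist e b x (fun y => is_derive_fade y (len_neq0 e)).
have d4 := is_derive_comp_dist e b x (fun y => is_derive_fade_x y (len_neq0 e)).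
have H := is_deriveZ (end_sign b) (is_deriveD (is_deriveZ (is_dirichlet (e, b)) d1)
  (is_deriveD (is_deriveM d2' d3) (is_deriveM d2 d4))).
apply: (is_derive_eq H); rewrite -![_ *: _]/(_ * _).
have s2 : end_sign b * end_sign b = 1.
  by rewrite /end_sign; case: (b); rewrite ?mulrNN mulr1.
rewrite -[RHS]mul1r -{1}s2; ring.
Qed.

End Waves.

(** * Vertex conditions of the waves *)

Section VertexConditions.
Context {R : realType}.
Variables (G : metric_graph R) (VD : {set vertex G}).
Local Notation end_ := (edge G * bool)%type.
Implicit Types (Phi Psi : R -> R) (x y d l : R) (e : edge G) (b : bool) (h : end_).

Lemma big_bool_at b (F : bool -> R) : \sum_(c : bool) F c = F b + F (~~ b).
Proof. by rewrite big_bool /=; case: b => //=; rewrite addrC. Qed.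

(** The sum over the ends [h] at [v] of the waves started from the opposite
    ends, after [d] more units of length. *)
Definition incoming Phi (v : vertex G) d : R :=
  \sum_(h : end_ | ends h.1 h.2 == v) is_dirichlet VD (other_end h) * Phi (len h.1 + d).

Lemma outgoingE Phi h d : outgoing VD Phi h d =
  transmission VD (ends h.1 h.2) * incoming Phi (ends h.1 h.2) d
  - is_dirichlet VD (other_end h) * Phi (len h.1 + d).
Proof.
rewrite /outgoing /scattering.
under eq_bigr => h' _ do rewrite mulrBl.
rewrite sumrB; congr (_ - _).
  rewrite /incoming big_distrr/= [RHS]big_mkcond/=; apply: eq_bigr => h' _.
  by case: ifP => _; rewrite ?mulrA// mul0r.
rewrite (bigD1 h)//= eqxx big1 ?addr0// => h' /negbTE ->.
by rewrite mul0r.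
Qed.

Lemma end_dist_end e b : end_dist e b (end_pos e b) = 0.
Proof. by case: b; rewrite /end_dist/= ?subrr. Qed.

Lemma end_dist_other e b : end_dist e (~~ b) (end_pos e b) = len e.
Proof. by case: b; rewrite /end_dist/= ?subr0. Qed.

Lemma fade0 l : fade l 0 = 1.
Proof. by rewrite /fade mul0r !expr0n/= !mulr0 subr0 addr0. Qed.

Lemma fade_l l : l != 0 -> fade l l = 0.
Proof. by move=> l0; rewrite /fade divff// !expr1n; ring. Qed.

Lemma fade_x0 l : fade_x l 0 = 0.
Proof. by rewrite /fade_x mul0r !expr0n/= !mulr0 subr0 mul0r. Qed.

Lemma fade_x_l l : l != 0 -> fade_x l l = 0.
Proof. by move=> l0; rewrite /fade_x divff// !expr1n subrr mul0r. Qed.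

(** The wave arriving along [e] from its other end is not faded: the reflected
    part of the scattering cancels it. *)
Lemma waves_end Phi e b : waves VD Phi e (end_pos e b) =
  is_dirichlet VD (e, b) * Phi 0 +
  transmission VD (ends e b) * incoming Phi (ends e b) 0.
Proof.
rewrite /waves (big_bool_at b) end_dist_end end_dist_other fade0.
rewrite fade_l ?len_neq0// mulr0 addr0 mulr1 outgoingE /other_end /= addr0.
by rewrite addrA subrK.
Qed.

(** Arriving and reflected waves travel in opposite directions: the two terms
    that cancel in [waves_end] add up here, which gives the factor 2. *)
Lemma waves_x_end Phi Phi' e b : inward_derivative (waves_x VD Phi Phi') e b =
  is_dirichlet VD (e, b) * Phi' 0 +
  transmission VD (ends e b) * incoming Phi' (ends e b) 0
  - 2 * (is_dirichlet VD (other_end (e, b)) * Phi' (len e)).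
Proof.
have -> : inward_derivative (waves_x VD Phi Phi') e b =
    end_sign b * waves_x VD Phi Phi' e (end_pos e b).
  by rewrite /inward_derivative /end_sign; case: b => /=; rewrite ?mulN1r ?mul1r.
rewrite /waves_x (big_bool_at b) end_dist_end end_dist_other fade0 fade_x0.
rewrite fade_l ?fade_x_l ?len_neq0// !mulr0 !addr0 mulr1 outgoingE /other_end /= addr0.
have -> : end_sign (~~ b) = - (end_sign b : R).
  by rewrite /end_sign; case: (b); rewrite ?opprK.
have s2 : end_sign b * end_sign b = 1 :> R.
  by rewrite /end_sign; case: (b); rewrite ?mulrNN mulr1.
by rewrite mulrDr !mulrA s2 mulrN s2; ring.
Qed.

Lemma incoming0 Phi v : incoming Phi v 0 =
  \sum_(h : end_ | ends h.1 h.2 == v) is_dirichlet VD (other_end h) * Phi (len h.1).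
Proof. by apply: eq_bigr => h _; rewrite addr0. Qed.

Lemma deg_neq0 (v : vertex G) : (deg v)%:R != 0 :> R.
Proof.
have [e [b eb]] := ends_surj v.
rewrite pnatr_eq0 -lt0n /deg; apply/card_gt0P; exists (e, b).
by rewrite inE /= eb.
Qed.

(** The transmitted waves 2 / deg v, counted at the deg v ends, compensate the
    arriving ones with their factor 2. *)
Lemma waves_kirchhoff Phi Phi' v : v \notin VD ->
  \sum_(h : end_ | ends h.1 h.2 == v)
    inward_derivative (waves_x VD Phi Phi') h.1 h.2 = 0.
Proof.
move=> vVD.
rewrite (eq_bigr (fun h => transmission VD v * incoming Phi' v 0 -
    2 * (is_dirichlet VD (other_end h) * Phi' (len h.1)))); last first.
  move=> [e b] /= /eqP hv; rewrite waves_x_end hv [is_dirichlet VD (e, b)]/is_dirichlet.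
  by rewrite /= hv (negbTE vVD) mul0r add0r.
rewrite sumrB sumr_const -/(deg v) -big_distrr /=.
rewrite -incoming0.
rewrite /transmission (negbTE vVD) -mulr_natr.
by field; exact: deg_neq0.
Qed.

End VertexConditions.

(** * Size of the waves and of the fading defect *)

Section WaveBounds.
Context {R : realType}.
Variables (G : metric_graph R) (VD : {set vertex G}).
Local Notation end_ := (edge G * bool)%type.
Implicit Types (Phi Psi : R -> R) (x y d l t M : R) (e : edge G) (b : bool) (h : end_).

Definition profile t : gfun G := fun e x => 1 - waves VD (half_line t) e x.

Definition profile_xx t : gfun G := fun e x =>
  - (waves VD (half_line_xx t) e x
     + fading_defect VD (half_line t) (half_line_x t) e x).

Lemma continuous_profile t e : continuous (profile t e).
Proof.
move=> x; have c := continuous_waves (VD := VD) (e := e) (@continuous_half_line R t).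
exact: (continuousB (@cst_continuous _ _ (1 : R) x) (c x)).
Qed.

Lemma continuous_profile_xx t e : continuous (profile_xx t e).
Proof.
move=> x.
have c := continuousD
  ((continuous_waves (VD := VD) (e := e) (@continuous_half_line_xx R t)) x)
  ((continuous_fading_defect (VD := VD) (e := e)
     (@continuous_half_line R t) (@continuous_half_line_x R t)) x).
exact: (continuous_comp c (@oppr_continuous _ _ _)).
Qed.

Lemma profile_laplacian t : 0 < t -> laplacian VD (profile t) (profile_xx t).
Proof.
move=> t0.
apply: (@laplacian_smooth _ _ _ _
  (fun e x => - waves_x VD (half_line t) (half_line_x t) e x)).
- move=> e x.
  have H := is_deriveB (is_derive_cst (1 : R) x (1 : R)) (is_derive_waves VD e x
    (fun y => is_derive_half_line y t0)).
  by apply: (is_derive_eq H); rewrite sub0r.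
- move=> e x.
  exact: is_deriveN (is_derive_waves_x VD e x (fun y => is_derive_half_line y t0)
    (fun y => is_derive_half_line_x y t0)).
- by move=> e; exact: continuous_profile_xx.
- move=> e b e' b' ee; rewrite /profile !waves_end ee; congr (1 - (_ * _ + _)).
  by rewrite /is_dirichlet /= ee.
- move=> e b eD; rewrite /profile waves_end /is_dirichlet /transmission eD.
  by rewrite half_line_at0 mul0r addr0 mulr1 subrr.
- move=> v vD.
  rewrite (eq_bigr (fun h =>
    - inward_derivative (waves_x VD (half_line t) (half_line_x t)) h.1 h.2)).
    by rewrite sumrN waves_kirchhoff// oppr0.
  by move=> [e []] _; rewrite /inward_derivative.
Qed.

Lemma sum_edge_le (F : end_ -> R) e : (forall h, 0 <= F h) ->
  \sum_(b : bool) F (e, b) <= \sum_h F h.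
Proof.
move=> F0.
rewrite [leRHS](eq_bigr (fun h => F (h.1, h.2))); last by move=> [].
rewrite -(pair_bigA _ (fun e b => F (e, b))) /= [leRHS](bigD1 e)//=.
by rewrite lerDl sumr_ge0// => i _; rewrite sumr_ge0.
Qed.

Lemma len_le_total e : len e <= total_length G.
Proof.
rewrite /total_length (bigD1 e)//= lerDl sumr_ge0// => i _; exact: ltW (len_gt0 i).
Qed.

(** Bounds the total weight with which values of the emitted profile enter the
    waves at a point. *)
Definition amplitude : R := \sum_(h : end_) (1 + \sum_(h' : end_) `|scattering VD h h'|).

Lemma sum_scattering_ge0 h : 0 <= \sum_(h' : end_) `|scattering VD h h'|.
Proof. by apply: sumr_ge0. Qed.

Lemma amplitude_ge0 : 0 <= amplitude.
Proof. by apply: sumr_ge0 => h _; rewrite addr_ge0// sum_scattering_ge0. Qed.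

Lemma outgoing_le Phi h d M : (forall e, `|Phi (len e + d)| <= M) ->
  `|outgoing VD Phi h d| <= (\sum_(h' : end_) `|scattering VD h h'|) * M.
Proof.
move=> PM; apply: (le_trans (ler_norm_sum _ _ _)).
rewrite big_distrl/=; apply: ler_sum => h' _.
by rewrite normrM ler_wpM2l.
Qed.

Lemma is_dirichlet_itv h : 0 <= is_dirichlet VD h <= 1.
Proof. by rewrite /is_dirichlet; case: (_ \in _); rewrite lexx ler01. Qed.

Lemma waves_le Phi e x M : 0 <= x <= len e -> 0 <= M ->
  (forall b, `|Phi (end_dist e b x)| <= M) ->
  (forall b e', `|Phi (len e' + end_dist e b x)| <= M) ->
  `|waves VD Phi e x| <= amplitude * M.
Proof.
move=> xl M0 PM PM'; apply: (le_trans (ler_norm_sum _ _ _)).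
rewrite /amplitude big_distrl/=.
apply: (le_trans _ (sum_edge_le (F := fun h => _ * M) e _)); last first.
  by move=> h; rewrite mulr_ge0// addr_ge0// sum_scattering_ge0.
apply: ler_sum => b _; apply: (le_trans (ler_normD _ _)); rewrite mulrDl mul1r.
have /andP[i0 i1] := is_dirichlet_itv (e, b).
have /andP[f0 f1] := fade_itv (len_gt0 e) (end_dist_itv b xl).
apply: lerD; rewrite normrM.
  by rewrite ger0_norm// -[leRHS]mul1r; apply: ler_pM.
rewrite [X in _ * X]ger0_norm// -[leRHS]mulr1; apply: ler_pM => //.
exact: outgoing_le.
Qed.

(** 18 = 2 * 6 + 6, from the bounds of [fade_x] in the mixed term and of
    [fade_xx]. *)
Definition fading_constant : R := amplitude * \sum_(e : edge G) 18 / len e ^+ 2.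

Lemma fading_constant_ge0 : 0 <= fading_constant.
Proof.
rewrite mulr_ge0 ?amplitude_ge0// sumr_ge0// => e _.
by rewrite divr_ge0// sqr_ge0.
Qed.

Lemma min_length_le e : min_length G <= len e.
Proof. by rewrite /min_length (bigD1 e)//= ge_min lexx. Qed.

Lemma min_length_ge0 : 0 <= min_length G.
Proof.
rewrite /min_length; apply: (big_ind (fun x : R => 0 <= x)).
- by apply: sumr_ge0 => e _; exact: ltW (len_gt0 e).
- by move=> a c a0 c0; rewrite le_min a0 c0.
- by move=> e _; exact: ltW (len_gt0 e).
Qed.

Definition decay t : R := expR (- (min_length G ^+ 2 / (4 * t))).

Lemma gauss_len_le_decay t e : 0 < t -> expR (- (len e ^+ 2 / (4 * t))) <= decay t.
Proof.
move=> t0; rewrite ler_expR lerN2 ler_pM2r ?invr_gt0 ?mulr_gt0//.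
by rewrite lerXn2r ?nnegrE ?min_length_ge0 ?min_length_le// ltW// len_gt0.
Qed.

Lemma decay_ge0 t : 0 <= decay t. Proof. exact: expR_ge0. Qed.

(** A scattered wave has already travelled along an edge, hence the Gaussian
    factor; the slope of [fade] is O(d), which compensates the t^(-1/2) in the
    derivative of the half-line solution ([half_line_x_gauss]). *)
Lemma fading_defect_le t e x : 0 < t -> 0 <= x <= len e ->
  `|fading_defect VD (half_line t) (half_line_x t) e x| <= fading_constant * decay t.
Proof.
move=> t0 xl; pose c := 6 / len e ^+ 2.
have c0 : 0 <= c by rewrite divr_ge0// sqr_ge0.
have S0 := decay_ge0 t.
apply: (@le_trans _ _ (amplitude * (3 * c * decay t))); last first.
  rewrite /fading_constant -[leRHS]mulrA ler_wpM2l ?amplitude_ge0// ler_wpM2r//.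
  rewrite (bigD1 e)//= /c mulrA -natrM lerDl sumr_ge0// => i _.
  by rewrite divr_ge0// sqr_ge0.
apply: (le_trans (ler_norm_sum _ _ _)).
rewrite /amplitude big_distrl/=.
apply: (le_trans _ (sum_edge_le (F := fun h => _ * (3 * c * decay t)) e _)); last first.
  move=> h; rewrite mulr_ge0// ?addr_ge0// ?sum_scattering_ge0//.
  by rewrite mulr_ge0// mulr_ge0.
apply: ler_sum => b _; apply: (le_trans (ler_normD _ _)).
have dl := end_dist_itv b xl; have /andP[d0 _] := dl.
have fx := fade_x_le (len_gt0 e) dl; have fxx := fade_xx_le (len_gt0 e) dl.
move: (end_dist e b x) d0 dl fx fxx => d d0 dl fx fxx.
pose S := \sum_(h' : end_) `|scattering VD (e, b) h'|.
have S_ge0 : 0 <= S by exact: sum_scattering_ge0.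
have o0 : `|outgoing VD (half_line t) (e, b) d| <= S * decay t.
  apply: outgoing_le => e'; rewrite ger0_norm ?half_line_ge0//.
  apply: (le_trans _ (gauss_len_le_decay e' t0)).
  by apply: half_line_gauss => //; rewrite ?lerDl// ltW// len_gt0.
have o1 : d * `|outgoing VD (half_line_x t) (e, b) d| <= S * decay t.
  rewrite -{1}[d]ger0_norm// -normrM.
  have -> : d * outgoing VD (half_line_x t) (e, b) d =
      outgoing VD (fun y => d * half_line_x t y) (e, b) d.
    by rewrite /outgoing big_distrr/=; apply: eq_bigr => h' _; ring.
  apply: outgoing_le => e'; rewrite normrM ger0_norm//.
  apply: (le_trans _ (gauss_len_le_decay e' t0)).
  by apply: half_line_x_gauss => //; rewrite ltW// len_gt0.
apply: (@le_trans _ _ (2 * (c * (S * decay t)) + S * decay t * c)); last first.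
  rewrite -/S [leRHS]mulrDl mul1r.
  have -> : 2 * (c * (S * decay t)) + S * decay t * c = S * (3 * c * decay t) by ring.
  by rewrite lerDr mulr_ge0// mulr_ge0.
apply: lerD; rewrite normrM.
  rewrite ger0_norm// ler_wpM2l// normrM.
  apply: (@le_trans _ _ (`|outgoing VD (half_line_x t) (e, b) d| * (c * d))).
    by rewrite ler_wpM2l.
  by rewrite mulrC -mulrA ler_wpM2l.
by apply: ler_pM.
Qed.

End WaveBounds.

(** * The explicit profile approximates the solution *)

Section Approximation.
Context {R : realType}.
Variables (G : metric_graph R) (VD : {set vertex G}).
Local Notation mu := (@lebesgue_measure R).
Local Notation gnrm := (nrm (@gdot R G)).
Local Notation w t := (waves VD (half_line t)).
Implicit Types (Phi Psi : R -> R) (x y d l t M : R) (e : edge G) (b : bool).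

Lemma continuous_L2 (u : gfun G) : (forall e, continuous (u e)) -> L2 u.
Proof.
move=> cu e; apply: continuous_square_integrable.
by apply: continuous_subspaceT; exact: cu.
Qed.

Lemma gdot_le (u : L2fun G) (g : gfun G) : (forall e, continuous (g e)) ->
  (forall e x, 0 <= x <= len e -> l2val u e x ^+ 2 <= g e x) ->
  gdot u u <= gintegral g.
Proof.
move=> cg ug; apply: ler_sum => e _.
have mI : measurable (edge_itv e : set (measurableTypeR R)).
  exact: measurable_itv.
apply: le_Rintegral => //.
- by apply: L2_mul_integrable; exact: L2fun_L2.
- exact: continuous_integrable.
- by move=> x; rewrite /edge_itv/= in_itv/= -expr2; exact: ug.
Qed.

Lemma Rintegral_edge_cst e (c : R) : \int[mu]_(x in edge_itv e) c = c * len e.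
Proof.
have mI : measurable (edge_itv e : set (measurableTypeR R)).
  exact: measurable_itv.
have E : mu `[0%R, len e]%classic = (len e)%:E.
  by rewrite lebesgue_measure_itv /= lte_fin len_gt0 -EFinB subr0.
by rewrite (Rintegral_cst _ mI) -[len e in RHS]/(fine (len e)%:E) -E.
Qed.

Lemma total_length_ge0 : 0 <= total_length G.
Proof. by apply: sumr_ge0 => e _; exact: ltW (len_gt0 e). Qed.

Lemma nrm_le_cst (u : L2fun G) M : 0 <= M ->
  (forall e x, 0 <= x <= len e -> `|l2val u e x| <= M) ->
  gnrm u <= Num.sqrt (total_length G) * M.
Proof.
move=> M0 uM.
have -> : Num.sqrt (total_length G) * M = Num.sqrt (total_length G * M ^+ 2).
  by rewrite sqrtrM ?total_length_ge0// sqrtr_sqr ger0_norm.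
rewrite /nrm ler_sqrt ?mulr_ge0 ?sqr_ge0 ?total_length_ge0//.
rewrite mulrC mulr_sumr.
under eq_bigr do rewrite -Rintegral_edge_cst.
apply: (gdot_le (g := fun _ _ => M ^+ 2)) => [e x|e x xl]; first exact: cvg_cst.
by rewrite -real_normK ?num_real// lerXn2r ?nnegrE ?uM.
Qed.

Definition unit_gfun : L2fun G := toL2 (continuous_L2 (fun e x => cvg_cst (1 : R))).

Lemma gintegral_gdot (u : L2fun G) : gintegral u = gdot u unit_gfun.
Proof.
apply: eq_bigr => e _; apply: eq_Rintegral => x _; by rewrite mulr1.
Qed.

Lemma gintegral_dist (u v : L2fun G) :
  `|gintegral u - gintegral v| <= Num.sqrt (total_length G) * gnrm (u - v).
Proof.
rewrite !gintegral_gdot -(dotBl (gdot_inner G)) mulrC.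
apply: (le_trans (cauchy_schwarz (gdot_inner G) _ _)).
apply: ler_wpM2l; first exact: nrm_ge0.
rewrite -[leRHS]mulr1; apply: nrm_le_cst => // e x _.
by rewrite /= normr1.
Qed.

Lemma waves_comb (a b c : R) Phi Psi X e x :
  waves VD (fun y => a * Phi y + b * Psi y + c * X y) e x =
  a * waves VD Phi e x + b * waves VD Psi e x + c * waves VD X e x.
Proof.
have o h d : outgoing VD (fun y => a * Phi y + b * Psi y + c * X y) h d =
    a * outgoing VD Phi h d + b * outgoing VD Psi h d + c * outgoing VD X h d.
  rewrite /outgoing !mulr_sumr -!big_split/=; apply: eq_bigr => h' _; ring.
rewrite /waves !mulr_sumr -!big_split/=; apply: eq_bigr => k _.
by rewrite o; ring.
Qed.

(** The time derivative of [profile]. *)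
Definition profile_time t : gfun G := fun e x => - waves VD (half_line_xx t) e x.

Lemma continuous_profile_time t e : continuous (profile_time t e).
Proof.
move=> x.
have c := (continuous_waves (VD := VD) (e := e) (@continuous_half_line_xx R t)) x.
exact: (continuous_comp c (@oppr_continuous _ _ _)).
Qed.

Definition profile_fun t : L2fun G := toL2 (continuous_L2 (@continuous_profile R G VD t)).
Definition profile_xx_fun t : L2fun G := toL2 (continuous_L2 (@continuous_profile_xx R G VD t)).
Definition profile_time_fun t : L2fun G :=
  toL2 (continuous_L2 (@continuous_profile_time t)).

Lemma end_dist_total e b x : 0 <= x <= len e ->
  0 <= end_dist e b x <= 2 * total_length G /\
  forall e', 0 <= len e' + end_dist e b x <= 2 * total_length G.
Proof.
move=> xl; have /andP[d0 dl] := end_dist_itv b xl.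
have L := len_le_total e; have L0 := total_length_ge0.
split=> [|e'].
  by rewrite d0 /=; move: (end_dist _ _ _) (len e) dl L => d l; lra.
have L' := len_le_total e'; have l0 := len_gt0 e'.
move: (end_dist _ _ _) (len e) (len e') d0 dl L L' l0 => d l l'.
by move=> *; apply/andP; split; lra.
Qed.

Lemma waves_le_total Phi e x M : 0 <= x <= len e -> 0 <= M ->
  (forall y, 0 <= y <= 2 * total_length G -> `|Phi y| <= M) ->
  `|waves VD Phi e x| <= amplitude VD * M.
Proof.
move=> xl M0 PM; apply: waves_le => // [b|b e'];
  by apply: PM; have [? ?] := end_dist_total b xl.
Qed.

Lemma small_multiple (K eps : R) : 0 <= K -> 0 < eps ->
  \forall h \near (0 : R)^'+, K * h <= eps.
Proof.
move=> K0 e0; have K1 : 0 < K + 1 by rewrite ltr_wpDl.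
near=> h; have h0 : 0 <= h by near: h; exact: nbhs_right_ge.
have hK : h <= eps / (K + 1).
  by near: h; apply: nbhs_right_le; rewrite divr_gt0.
rewrite -[leRHS](divfK (lt0r_neq0 K1)) mulrC; apply: ler_pM => //.
by rewrite lerDl.
Unshelve. all: by end_near. Qed.

(** The waves are linear in the emitted profile, so that the uniform estimate
    of the difference quotients of [half_line] carries over. *)
Lemma profile_right_derivative s : 0 < s ->
  right_derivative (@gdot R G) profile_fun s (profile_time_fun s).
Proof.
move=> s0; have tot0 := total_length_ge0.
have [C C0 CP] := half_line_quotient s0 (mulr_ge0 (ler0n R 2) tot0).
apply/nrm_cvg0P => eps e0.
pose K := Num.sqrt (total_length G) * (amplitude VD * C).
have K0 : 0 <= K by rewrite mulr_ge0 ?sqrtr_ge0// mulr_ge0// amplitude_ge0.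
near=> h; have h0 : 0 < h by near: h; exact: nbhs_right_gt.
have hK : K * h <= eps by near: h; exact: small_multiple.
apply: le_trans hK; rewrite /K -!mulrA.
apply: nrm_le_cst; first by rewrite !mulr_ge0 ?amplitude_ge0// ltW.
move=> e x xl.
have -> : l2val (h^-1 *: (profile_fun (s + h) - profile_fun s) - profile_time_fun s) e x =
    - (h^-1 * w (s + h) e x + (- h^-1) * w s e x + (-1) * waves VD (half_line_xx s) e x).
  rewrite /= /profile /profile_time !fctE -[_ *: _]/(_ * _).
  by move: (waves _ _ _ _) (waves _ _ _ _) (waves _ _ _ _) (h^-1) => p q r a; ring.
rewrite normrN -waves_comb; apply: waves_le_total => //.
  by rewrite mulr_ge0// ltW.
move=> y yX; apply: le_trans (CP y h yX h0).
by rewrite le_eqVlt; apply/orP; left; apply/eqP; congr `|_|; ring.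
Unshelve. all: by end_near. Qed.

Lemma profile_left_continuous s eps : 0 < s -> 0 < eps ->
  \forall h \near 0^'+, gnrm (profile_fun (s - h) - profile_fun s) <= eps.
Proof.
move=> s0 e0; have tot0 := total_length_ge0.
have [C C0 CP] := half_line_backward s0 (mulr_ge0 (ler0n R 2) tot0).
pose K := Num.sqrt (total_length G) * (amplitude VD * C).
have K0 : 0 <= K by rewrite mulr_ge0 ?sqrtr_ge0// mulr_ge0// amplitude_ge0.
near=> h; have h0 : 0 < h by near: h; exact: nbhs_right_gt.
have hs : h < s / 2 by near: h; apply: nbhs_right_lt; rewrite divr_gt0.
have hK : K * h <= eps by near: h; exact: small_multiple.
apply: le_trans hK; rewrite /K -!mulrA.
apply: nrm_le_cst; first by rewrite !mulr_ge0 ?amplitude_ge0// ltW.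
move=> e x xl.
have -> : l2val (profile_fun (s - h) - profile_fun s) e x =
    - (1 * w (s - h) e x + (-1) * w s e x + 0 * w s e x).
  rewrite /= /profile !fctE.
  by move: (waves _ _ _ _) (waves _ _ _ _) => p q; ring.
rewrite normrN -waves_comb; apply: waves_le_total => //.
  by rewrite mulr_ge0// ltW.
move=> y yX; have hh : 0 < h < s / 2 by rewrite h0.
apply: le_trans (CP y h yX hh).
by rewrite le_eqVlt; apply/orP; left; apply/eqP; congr `|_|; ring.
Unshelve. all: by end_near. Qed.

Lemma decay_le s t : 0 < s -> s <= t -> decay G s <= decay G t.
Proof.
move=> s0 st; have t0 := lt_le_trans s0 st.
rewrite ler_expR lerN2 ler_wpM2l ?sqr_ge0// lef_pV2 ?posrE ?mulr_gt0//.
by rewrite ler_pM2l.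
Qed.

Lemma profile_residual s t : 0 < s -> s <= t ->
  gnrm (profile_time_fun s - profile_xx_fun s) <=
  Num.sqrt (total_length G) * (fading_constant VD * decay G t).
Proof.
move=> s0 st; apply: nrm_le_cst.
  by rewrite mulr_ge0 ?fading_constant_ge0 ?decay_ge0.
move=> e x xl.
have -> : l2val (profile_time_fun s - profile_xx_fun s) e x =
    fading_defect VD (half_line s) (half_line_x s) e x.
  rewrite /= /profile_time /profile_xx !fctE.
  by move: (waves _ _ _ _) (fading_defect _ _ _ _ _) => p q; ring.
apply: (le_trans (fading_defect_le VD s0 xl)).
by rewrite ler_wpM2l ?fading_constant_ge0// decay_le.
Qed.

(** On an edge the waves are at most a multiple of half_line x +
    half_line (l - x), with values in [0, 2] and integral O(sqrt s). *)
Lemma profile_cvg0 : gnrm (profile_fun s - unit_gfun) @[s --> 0^'+] --> (0 : R).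
Proof.
apply/nrm_cvg0P => eps e0.
pose K := \sum_(e : edge G) 8 * amplitude VD ^+ 2.
have K0 : 0 <= K by apply: sumr_ge0 => e _; rewrite mulr_ge0// sqr_ge0.
near=> s; have s0 : 0 < s by near: s; exact: nbhs_right_gt.
have sK : K ^+ 2 * s <= eps ^+ 4.
  by near: s; apply: small_multiple; rewrite ?sqr_ge0// exprn_gt0.
have KsE : K * Num.sqrt s <= eps ^+ 2.
  rewrite -(@ler_pXn2r _ 2)// ?nnegrE ?sqr_ge0 ?mulr_ge0 ?sqrtr_ge0//.
  by rewrite exprMn sqr_sqrtr ?(ltW s0)// -exprM.
rewrite /nrm -[leRHS]ger0_norm ?(ltW e0)// -sqrtr_sqr ler_sqrt ?sqr_ge0//.
apply: le_trans KsE.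
pose g : gfun G := fun e x => 2 * amplitude VD ^+ 2 *
  (half_line s x + half_line s (len e - x)).
have c1 := @continuous_half_line R s.
have c2 e : continuous (fun x => half_line s (len e - x)).
  exact: (continuous_comp_dist (e := e) (b := true) c1).
have cg e : continuous (g e).
  by move=> x; apply: cvgMr; apply: cvgD; [exact: c1|exact: c2].
apply: (@le_trans _ _ (gintegral g)).
  apply: gdot_le => // e x xl.
  have -> : l2val (profile_fun s - unit_gfun) e x = - w s e x.
    by rewrite /= /profile !fctE; move: (waves _ _ _ _) => p; ring.
  rewrite sqrrN; have /andP[x0 xl'] := xl.
  set p := half_line s x + half_line s (len e - x).
  have px0 := half_line_ge0 s x; have px1 := half_line_ge0 s (len e - x).
  have py0 := half_line_le1 s x0.
  have py1 : half_line s (len e - x) <= 1 by rewrite half_line_le1// subr_ge0.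
  have p0 : 0 <= p by exact: addr_ge0.
  have wp : `|w s e x| <= amplitude VD * p.
    have D b : half_line s (end_dist e b x) <= p.
      by rewrite /end_dist /p; case: b; rewrite ?lerDl ?lerDr.
    apply: waves_le => // [b|b e']; rewrite ger0_norm ?half_line_ge0//.
    by apply: le_trans (D b); apply: half_line_le; rewrite lerDr ltW// len_gt0.
  rewrite -real_normK ?num_real//; apply: (@le_trans _ _ ((amplitude VD * p) ^+ 2)).
    by rewrite lerXn2r ?nnegrE ?mulr_ge0 ?amplitude_ge0.
  rewrite /g -/p exprMn [2 * _]mulrC -[leRHS]mulrA ler_wpM2l ?sqr_ge0// expr2.
  by rewrite ler_wpM2r// /p; move: (half_line s x) (half_line s _) py0 py1 => *; lra.
rewrite /gintegral /K mulr_suml; apply: ler_sum => e _.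
have mI : measurable (edge_itv e : set (measurableTypeR R)).
  exact: measurable_itv.
have int (f : R -> R) := @continuous_integrable R 0 (len e) f.
have cp : continuous (fun x => half_line s x + half_line s (len e - x)).
  by move=> x; apply: cvgD; [exact: c1|exact: c2].
rewrite /g (RintegralZl _ mI (int _ cp)) (RintegralD mI (int _ c1) (int _ (c2 e))).
have := integral_half_line_end 0 e false s0.
have := integral_half_line_end 0 e true s0.
under eq_Rintegral do rewrite add0r.
move=> ->.
under eq_Rintegral do rewrite add0r.
move=> ->; rewrite mul0r ierfc0 add0r.
have q0 : 0 <= len e / (2 * Num.sqrt s).
  by rewrite divr_ge0 ?mulr_ge0 ?sqrtr_ge0// ltW// len_gt0.
have /andP[i0 _] := ierfc_itv q0.
have v1 : (Num.sqrt (pi : R))^-1 <= 1 by rewrite invf_le1 ?sqrtpi_gt0 ?sqrtpi_ge1.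
set D := _ - _; have D1 : D <= 1 by rewrite /D; move: (ierfc _) i0 v1 => ? ?; lra.
have -> : 2 * amplitude VD ^+ 2 * (2 * Num.sqrt s * D + 2 * Num.sqrt s * D) =
   8 * amplitude VD ^+ 2 * Num.sqrt s * D by ring.
rewrite -[leRHS]mulr1; apply: ler_wpM2l => //.
by rewrite mulr_ge0 ?sqrtr_ge0// mulr_ge0// sqr_ge0.
Unshelve. all: by end_near. Qed.

Lemma profile_approx T t : heat_semigroup VD T -> 0 < t ->
  gnrm (L2evol T t unit_gfun - profile_fun t) <=
  Num.sqrt (total_length G) * (fading_constant VD * decay G t) * t.
Proof.
move=> hT t0.
apply: (evol_approx (gdot_inner G) (heat_evolution hT) (l := profile_xx_fun)
  (w' := profile_time_fun)) => //.
- by rewrite mulr_ge0 ?sqrtr_ge0// mulr_ge0 ?fading_constant_ge0 ?decay_ge0.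
- by move=> s /andP[s0 _]; exact: profile_laplacian.
- by move=> s /andP[s0 _]; exact: profile_right_derivative.
- by move=> s /andP[s0 _] eps e0; exact: profile_left_continuous.
- by move=> s /andP[s0 st]; apply: profile_residual => //; exact: ltW.
- exact: profile_cvg0.
Qed.

End Approximation.

(** * Integral of the profile and conclusion *)

Section HeatContent.
Context {R : realType}.
Variables (G : metric_graph R) (VD : {set vertex G}).
Local Notation mu := (@lebesgue_measure R).
Local Notation sqrtpi := (Num.sqrt (pi : R)).
Implicit Types (Phi Psi : R -> R) (x y d l t M a : R) (e : edge G) (b : bool).

Lemma Rintegral_bigsum (I : Type) (r : seq I) (F : I -> R -> R) l :
  (forall i, continuous (F i)) ->
  \int[mu]_(x in `[0, l]) (\sum_(i <- r) F i x) =
  \sum_(i <- r) \int[mu]_(x in `[0, l]) F i x.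
Proof.
move=> cF; have mI : measurable (`[0, l]%classic : set (measurableTypeR R)).
  exact: measurable_itv.
have int (f : R -> R) := @continuous_integrable R 0 l f.
elim: r => [|i r IH].
  rewrite big_nil; under eq_Rintegral do rewrite big_nil.
  by rewrite (Rintegral_cst _ mI) mul0r.
rewrite big_cons -IH -(RintegralD mI (int _ (cF i)) (int _ (continuous_bigsum cF))).
by under eq_Rintegral do rewrite big_cons.
Qed.

Lemma ierfc_decay t e : 0 < t ->
  0 <= ierfc (len e / (2 * Num.sqrt t)) <= decay G t.
Proof.
move=> t0; have z0 : 0 <= len e / (2 * Num.sqrt t).
  by rewrite divr_ge0 ?mulr_ge0 ?sqrtr_ge0// ltW// len_gt0.
have /andP[-> /= i1] := ierfc_itv z0; apply: (le_trans i1).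
apply: le_trans (gauss_len_le_decay e t0); rewrite gauss_scaleE//.
rewrite ler_pdivrMr ?sqrtpi_gt0// ler_peMr ?expR_ge0//.
exact: sqrtpi_ge1.
Qed.

(** The direct wave has integral 2 sqrt t / sqrt pi over the half-line; the part
    beyond the far end and the scattered waves, which start after the length of
    an edge, are bounded by values of [ierfc] at len / (2 sqrt t). *)
Lemma integral_end_wave t e b : 0 < t ->
  `|\int[mu]_(x in edge_itv e)
      (is_dirichlet VD (e, b) * half_line t (end_dist e b x) +
       outgoing VD (half_line t) (e, b) (end_dist e b x)
         * fade (len e) (end_dist e b x))
    - is_dirichlet VD (e, b) * (2 * Num.sqrt t / sqrtpi)| <=
  (1 + \sum_(h' : edge G * bool) `|scattering VD (e, b) h'|)
    * (2 * Num.sqrt t * decay G t).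
Proof.
move=> t0; have mI : measurable (`[0, len e]%classic : set (measurableTypeR R)).
  exact: measurable_itv.
have int (f : R -> R) := @continuous_integrable R 0 (len e) f.
have c0 := @continuous_half_line R t.
have c1 := continuous_comp_dist (e := e) (b := b) c0.
have c2 : continuous (fun x => outgoing VD (half_line t) (e, b) (end_dist e b x)
         * fade (len e) (end_dist e b x)).
  move=> x; apply: cvgM.
    exact: (continuous_comp_dist (continuous_outgoing c0)).
  exact: (continuous_comp_dist (continuous_fade (len_neq0 e))).
have c3 : continuous (fun x => is_dirichlet VD (e, b) * half_line t (end_dist e b x)).
  by move=> x; apply: cvgMr; exact: c1.
have r0 : 0 <= 2 * Num.sqrt t by rewrite mulr_ge0// sqrtr_ge0.
have S0 := decay_ge0 G t.
rewrite (RintegralD mI (int _ c3) (int _ c2)) (RintegralZl _ mI (int _ c1)).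
have := integral_half_line_end 0 e b t0.
under eq_Rintegral do rewrite add0r.
move=> ->; rewrite mul0r add0r ierfc0.
set I := (\int[mu]_(x in _) _); set i := ierfc _; set D := is_dirichlet _ _.
have -> : D * (2 * Num.sqrt t * (sqrtpi^-1 - i)) + I - D * (2 * Num.sqrt t / sqrtpi)
    = - (D * (2 * Num.sqrt t * i)) + I by ring.
have /andP[D0 D1] : 0 <= D <= 1 by exact: is_dirichlet_itv.
have /andP[i0 i1] : 0 <= i <= decay G t by exact: ierfc_decay.
rewrite [leRHS]mulrDl mul1r; apply: (le_trans (ler_normD _ _)); apply: lerD.
  rewrite normrN ger0_norm ?mulr_ge0// ?mulr_ge0// -[leRHS]mul1r.
  by apply: ler_pM => //; rewrite ?mulr_ge0// ler_wpM2l.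
apply: (le_trans (le_normr_Rintegral mI (int _ c2))).
pose F (h' : edge G * bool) x :=
  `|scattering VD (e, b) h'| * half_line t (len h'.1 + end_dist e b x).
have cl (h' : edge G) : continuous (fun x => half_line t (len h' + end_dist e b x)).
  apply: (continuous_comp_dist (f := fun d => half_line t (len h' + d))) => x.
  apply: (continuous_comp (f := fun d => len h' + d) (g := half_line t)); last exact: c0.
  by apply: cvgD; [exact: cvg_cst|exact: cvg_id].
have cF h' : continuous (F h') by move=> x; apply: cvgMr; exact: cl.
apply: (@le_trans _ _ (\int[mu]_(x in `[0, len e]) (\sum_h' F h' x))).
  apply: le_Rintegral => //.
  - by apply: int => x; apply: (continuous_comp (c2 x)); exact: norm_continuous.
  - by apply: int; exact: continuous_bigsum.
  move=> x; rewrite /= in_itv/= => xl.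
  have /andP[f0 f1] := fade_itv (len_gt0 e) (end_dist_itv b xl).
  rewrite normrM [X in _ * X]ger0_norm// -[leRHS]mulr1; apply: ler_pM => //.
  apply: (le_trans (ler_norm_sum _ _ _)); apply: ler_sum => h' _.
  by rewrite normrM /F [X in _ * X]ger0_norm// half_line_ge0.
rewrite (Rintegral_bigsum _ _ cF) mulr_suml; apply: ler_sum => h' _.
rewrite /F (RintegralZl _ mI (int _ (cl _))) integral_half_line_end//.
apply: ler_wpM2l => //; apply: ler_wpM2l => //.
have /andP[_ j1] := ierfc_decay h'.1 t0; apply: le_trans j1.
have z0 : 0 <= (len h'.1 + len e) / (2 * Num.sqrt t).
  by rewrite divr_ge0// addr_ge0// ltW// len_gt0.
by have /andP[k0 _] := ierfc_itv z0; rewrite gerBl.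
Qed.

(** A Dirichlet vertex carries a single end. *)
Lemma sum_is_dirichlet : (forall v, v \in VD -> deg v = 1%N) ->
  \sum_(h : edge G * bool) is_dirichlet VD h = #|VD|%:R.
Proof.
move=> d1; rewrite (partition_big (fun h => ends h.1 h.2) predT)//=.
rewrite (bigID (mem VD))/= [X in _ + X]big1 ?addr0; last first.
  move=> v vD; apply: big1 => h /eqP hv.
  by rewrite /is_dirichlet hv (negbTE vD).
rewrite -sum1_card natr_sum; apply: eq_bigr => v vD.
rewrite (eq_bigr (fun=> 1)); last by move=> h /eqP hv; rewrite /is_dirichlet hv vD.
by rewrite sumr_const -/(deg v) d1.
Qed.

Lemma gintegral_profile t : (forall v, v \in VD -> deg v = 1%N) -> 0 < t ->
  `|gintegral (profile VD t) - (total_length G - 2 * Num.sqrt t / sqrtpi * #|VD|%:R)|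
  <= amplitude VD * (2 * Num.sqrt t * decay G t).
Proof.
move=> d1 t0; pose c := 2 * Num.sqrt t / sqrtpi.
have c0 := @continuous_half_line R t.
pose F e b x := is_dirichlet VD (e, b) * half_line t (end_dist e b x) +
       outgoing VD (half_line t) (e, b) (end_dist e b x)
         * fade (len e) (end_dist e b x).
have cF e b : continuous (F e b).
  move=> x; apply: cvgD.
    by apply: cvgMr; exact: (continuous_comp_dist c0).
  apply: cvgM; first exact: (continuous_comp_dist (continuous_outgoing c0)).
  exact: (continuous_comp_dist (continuous_fade (len_neq0 e))).
have E e : \int[mu]_(x in edge_itv e) profile VD t e x =
    len e - \sum_(b : bool) \int[mu]_(x in edge_itv e) F e b x.
  have mI : measurable (`[0, len e]%classic : set (measurableTypeR R)).
    exact: measurable_itv.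
  have int (f : R -> R) := @continuous_integrable R 0 (len e) f.
  rewrite -(Rintegral_bigsum _ _ (cF e)).
  rewrite (RintegralB mI (int _ (fun x => cvg_cst (1 : R)))
    (int _ (continuous_bigsum (cF e)))).
  by congr (_ - _); rewrite -[RHS]mul1r -Rintegral_edge_cst.
have -> : gintegral (profile VD t) - (total_length G - c * #|VD|%:R) =
    - \sum_(h : edge G * bool)
        (\int[mu]_(x in edge_itv h.1) F h.1 h.2 x - is_dirichlet VD h * c).
  rewrite sumrB -mulr_suml (sum_is_dirichlet d1) /gintegral (eq_bigr _ (fun e _ => E e)).
  rewrite sumrB (pair_bigA _ (fun e b => \int[mu]_(x in edge_itv e) F e b x)) /=.
  rewrite -/(total_length G); ring.
rewrite normrN; apply: (le_trans (ler_norm_sum _ _ _)).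
rewrite /amplitude mulr_suml; apply: ler_sum => -[e b] _.
exact: integral_end_wave.
Qed.

End HeatContent.

Theorem theoremB (R : realType) (G : metric_graph R) (VD : {set vertex G})
    (p : R -> gkernel G) :
  standing_assumption VD -> heat_kernel VD p ->
  exists C : R, \forall t \near 0^'+,
    `|heat_content p t
      - (total_length G - 2 * Num.sqrt t / Num.sqrt pi * #|VD|%:R)|
    <= C * (Num.sqrt t * expR (- (min_length G ^+ 2 / (4 * t)))).
Proof.
move=> [_ _ d1 _] [T hT Tp].
exists (total_length G * fading_constant VD + 2 * amplitude VD); near=> t.
have t0 : 0 < t by near: t; exact: nbhs_right_gt.
have t1 : t <= 1 by near: t; exact: nbhs_right_le.
have trt : t <= Num.sqrt t.
  rewrite -{1}(sqr_sqrtr (ltW t0)) expr2 ler_piMl ?sqrtr_ge0//.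
  by rewrite -[leRHS]sqrtr1 ler_wsqrtr.
rewrite -/(decay G t).
have -> : heat_content p t = gintegral (L2evol T t (@unit_gfun R G)).
  rewrite /heat_content (kernel_total_integral hT (ltW t0) (Tp t t0)).
  by rewrite (L2evolE hT _ (ltW t0)).
set A := gintegral _.
have A1 := gintegral_dist (L2evol T t (@unit_gfun R G)) (profile_fun VD t).
have A2 := profile_approx hT t0.
have A3 := gintegral_profile d1 t0.
have tot0 := total_length_ge0 G.
set Q := total_length G - _; set P := gintegral (profile VD t) in A3.
have -> : A - Q = (A - P) + (P - Q) by ring.
apply: (le_trans (ler_normD _ _)); rewrite [leRHS]mulrDl; apply: lerD.
  apply: (le_trans A1).
  apply: (@le_trans _ _ (Num.sqrt (total_length G) *
    (Num.sqrt (total_length G) * (fading_constant VD * decay G t) * t))).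
    by rewrite ler_wpM2l// sqrtr_ge0.
  rewrite -{3}(sqr_sqrtr tot0); set r := Num.sqrt (total_length G).
  have -> : r * (r * (fading_constant VD * decay G t) * t) =
    r ^+ 2 * fading_constant VD * (t * decay G t) by ring.
  apply: ler_wpM2l; first by rewrite mulr_ge0 ?sqr_ge0 ?fading_constant_ge0.
  by apply: ler_wpM2r => //; exact: decay_ge0.
apply: (le_trans A3); rewrite le_eqVlt; apply/orP; left; apply/eqP; ring.
Unshelve. all: by end_near. Qed.
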